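(* Let $d\ge 1$, $L>0$, and let $\mathcal D_L=[-L,L)^d$ be the periodic box. Let $V\in C(\mathcal D_L)$ with $V\ge 0$, let $\beta\ge 0$ and $\delta>0$. Let $\{r_\varepsilon\}_{\varepsilon>0}$ be an admissible family of denominators, and let $\sigma(\varepsilon)>0$ satisfy $\sigma(\varepsilon)\to 0$ as $\varepsilon\to 0^+$. Extend $\mathcal E_{\varepsilon,\sigma(\varepsilon),L}$ and $\mathcal E_{0,L}$ from $\mathcal A_L$ to $L^2(\mathcal D_L)$ by setting them equal to $+\infty$ outside $\mathcal A_L$. Then, as $\varepsilon\to0^+$, $$\mathcal E_{\varepsilon,\sigma(\varepsilon),L}\ \xrightarrow{\ \Gamma\ }\ \mathcal E_{0,L}\qquad\text{in the strong } L^2(\mathcal D_L)\text{ topology}.$$ Moreover, the family $\{\mathcal E_{\varepsilon,\sigma(\varepsilon),L}\}_{\varepsilon>0}$ is equicoercive in $L^2(\mathcal D_L)$.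
   Context: The box $\mathcal D_L=[-L,L)^d$ is a periodic box (identified with the torus $\mathbb R^d/(2L\mathbb Z)^d$), so $C(\mathcal D_L)$ denotes continuous functions on the periodic box. $H^1_{\rm p}(\mathcal D_L)$ is the (real) periodic Sobolev space $H^1$ on $\mathcal D_L$. Admissible set: $$\mathcal A_L=\Big\{\rho\in H^1_{\rm p}(\mathcal D_L):\ \rho\ge 0\ \text{a.e.},\ \int_{\mathcal D_L}\rho\,dx=1\Big\}.$$ Admissible denominators: a family $\{r_\varepsilon\}_{\varepsilon>0}$ of functions on $[0,\infty)$ is admissible if for every $\varepsilon>0$: $r_\varepsilon\in C^1([0,\infty))$, $r_\varepsilon>0$, $r_\varepsilon'\ge0$, and $r_\varepsilon$ is concave; and for every $s\ge 0$: $s\le r_{\varepsilon_1}(s)\le r_{\varepsilon_2}(s)$ whenever $0<\varepsilon_1\le\varepsilon_2$, and $r_\varepsilon(s)\to s$ as $\varepsilon\to0^+$. Kinetic integrands: for $s\ge0$, $q\in\mathbb R^d$, $F_\varepsilon(s,q)=\dfrac{|q|^2}{8r_\varepsilon(s)}$ and $$F_0(s,q)=\begin{cases}|q|^2/(8s), & s>0,\\ 0, & s=0,\ q=0,\\ +\infty, & s=0,\ q\neq0.\end{cases}$$ Potential regularization: $p_\sigma(s)=\sqrt{s^2+\sigma^2}-\sigma$ for $s\ge0$, $\sigma>0$. Energies: for $\rho\in\mathcal A_L$, $$\mathcal E_{\varepsilon,\sigma,L}(\rho)=\int_{\mathcal D_L}\Big[F_\varepsilon(\rho,\nabla\rho)+Vp_\sigma(\rho)+\frac\beta2\rho^2+\frac\delta2|\nabla\rho|^2\Big]dx,$$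 $$\mathcal E_{0,L}(\rho)=\int_{\mathcal D_L}\Big[F_0(\rho,\nabla\rho)+V\rho+\frac\beta2\rho^2+\frac\delta2|\nabla\rho|^2\Big]dx\in[0,+\infty].$$ $\Gamma$-convergence is in the usual sense: for every sequence $\varepsilon_n\to0^+$ and every $\rho\in L^2(\mathcal D_L)$, (i) $\liminf_n \mathcal E_{\varepsilon_n,\sigma(\varepsilon_n),L}(\rho_n)\ge\mathcal E_{0,L}(\rho)$ whenever $\rho_n\to\rho$ strongly in $L^2(\mathcal D_L)$, and (ii) there is a sequence $\rho_n\to\rho$ in $L^2(\mathcal D_L)$ with $\limsup_n\mathcal E_{\varepsilon_n,\sigma(\varepsilon_n),L}(\rho_n)\le\mathcal E_{0,L}(\rho)$. Equicoercive means: for every $t\in\mathbb R$ there is a compact set $K_t\subset L^2(\mathcal D_L)$ such that $\{\rho\in L^2(\mathcal D_L):\mathcal E_{\varepsilon,\sigma(\varepsilon),L}(\rho)\le t\}\subset K_t$ for all $\varepsilon>0$. *)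

(* Defs.v *)
From HB Require Import structures.
From mathcomp Require Import all_boot all_order all_algebra.
From mathcomp Require Import lra.
From mathcomp Require Import all_classical all_reals all_analysis.

Set Implicit Arguments.
Unset Strict Implicit.
Unset Printing Implicit Defensive.

Import Order.TTheory GRing.Theory Num.Theory.
Import numFieldNormedType.Exports.

Local Open Scope classical_set_scope.
Local Open Scope ring_scope.

Section rV_measurable.
Context {R : realType} {d : nat}.

Definition rV_coord (i : 'I_d) (x : 'rV[R]_d) : measurableTypeR R := x ord0 i.

Let rV_set0 : g_sigma_preimage rV_coord set0.
Proof. exact: sigma_algebra0. Qed.

Let rV_setC A : g_sigma_preimage rV_coord A -> g_sigma_preimage rV_coord (~` A).
Proof. exact: sigma_algebraC. Qed.

Let rV_bigcup (F : _^nat) : (forall i, g_sigma_preimage rV_coord (F i)) ->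
  g_sigma_preimage rV_coord (\bigcup_i (F i)).
Proof. exact: sigma_algebra_bigcup. Qed.

(* The sigma-algebra generated by the coordinates is the Borel one. *)
HB.instance Definition _ := @isMeasurable.Build default_measure_display
  'rV[R]_d (g_sigma_preimage rV_coord) rV_set0 rV_setC rV_bigcup.

Lemma measurable_rV_coord (i : 'I_d) : measurable_fun [set: 'rV[R]_d] (rV_coord i).
Proof.
move=> _ Y mY; rewrite setTI; apply: sub_sigma_algebra => /=.
rewrite -bigcup_seq/=; exists i => /=; first by rewrite mem_index_enum.
by exists Y => //; rewrite setTI.
Qed.

Lemma measurable_fun_rVP d1 (T1 : measurableType d1) (f : T1 -> 'rV[R]_d) :
  (forall i, measurable_fun [set: T1] (rV_coord i \o f)) ->
  measurable_fun [set: T1] f.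
Proof.
move=> mf _ A mA; rewrite setTI.
suff : g_sigma_preimage (fun i => rV_coord i \o f) `<=` measurable.
  by apply; rewrite g_sigma_preimage_comp; exists A => //; rewrite setTI.
apply: smallest_sub; first exact: sigma_algebra_measurable.
rewrite -bigcup_seq; apply: bigcup_sub => i _ B [C mC <-].
exact: mf.
Qed.

End rV_measurable.

Section lebesgue_rV.
Context {R : realType}.

Definition rV_cons n (p : measurableTypeR R * 'rV[R]_n) : 'rV[R]_n.+1 :=
  \row_i if unlift ord0 i is Some j then p.2 ord0 j else p.1.

Definition rV_uncons n (x : 'rV[R]_n.+1) : measurableTypeR R * 'rV[R]_n :=
  (x ord0 ord0, \row_j x ord0 (lift ord0 j)).

Lemma rV_unconsK n : cancel (@rV_uncons n) (@rV_cons n).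
Proof.
move=> x; apply/rowP => i; rewrite mxE /=.
by case: unliftP => [j|] ->; rewrite ?mxE.
Qed.

Lemma rV_consK n : cancel (@rV_cons n) (@rV_uncons n).
Proof.
case=> a x; congr pair; first by rewrite /= mxE unlift_none.
by apply/rowP => j; rewrite !mxE liftK.
Qed.

Lemma measurable_rV_cons n : measurable_fun [set: _] (@rV_cons n).
Proof.
apply: measurable_fun_rVP => i.
rewrite (_ : _ \o _ = fun p : measurableTypeR R * 'rV[R]_n =>
  if unlift ord0 i is Some j then rV_coord j p.2 else p.1); last first.
  by apply/funext => p /=; rewrite /rV_coord mxE.
case: (unlift ord0 i) => [j|]; last exact: measurable_fst.
by apply: measurableT_comp; [exact: measurable_rV_coord|exact: measurable_snd].
Qed.

Lemma measurable_rV_uncons n : measurable_fun [set: _] (@rV_uncons n).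
Proof.
apply: measurable_fun_pair; first exact: (measurable_rV_coord ord0).
apply: measurable_fun_rVP => i.
rewrite (_ : _ \o _ = rV_coord (lift ord0 i)); last first.
  by apply/funext => x /=; rewrite /rV_coord mxE.
exact: measurable_rV_coord.
Qed.


HB.instance Definition _ n :=
  @isMeasurableFun.Build _ _ _ _ (@rV_cons n) (@measurable_rV_cons n).

Section step.
Variables (n : nat) (m : {sigma_finite_measure set 'rV[R]_n -> \bar R}).

Definition lebesgue_rVS : set 'rV[R]_n.+1 -> \bar R :=
  pushforward (lebesgue_measure \x m)%E (@rV_cons n).

Let lebesgue_rVS0 : lebesgue_rVS set0 = 0%E.
Proof. exact: measure0. Qed.

Let lebesgue_rVS_ge0 A : (0 <= lebesgue_rVS A)%E.
Proof. exact: measure_ge0. Qed.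

Let lebesgue_rVS_sigma_additive : semi_sigma_additive lebesgue_rVS.
Proof. exact: measure_semi_sigma_additive. Qed.

HB.instance Definition _ := isMeasure.Build _ _ _ lebesgue_rVS
  lebesgue_rVS0 lebesgue_rVS_ge0 lebesgue_rVS_sigma_additive.

Let lebesgue_rVS_sigma_finite : sigma_finite setT lebesgue_rVS.
Proof.
have /sigma_finiteP[F [TF ndF Foo]] := sigma_finiteT (@lebesgue_measure R).
have /sigma_finiteP[G [TG ndG Goo]] := sigma_finiteT m.
have mFG k : measurable (@rV_uncons n @^-1` (F k `*` G k)).
  rewrite -[X in measurable X]setTI; apply: measurable_rV_uncons => //.
  by apply: measurableX; [exact: (Foo k).1|exact: (Goo k).1].
exists (fun k => @rV_uncons n @^-1` (F k `*` G k)).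
  rewrite -preimage_bigcup (_ : \bigcup_k _ = setT) ?preimage_setT//.
  apply/seteqP; split=> // -[a x] _.
  have [i _ Fa] : (\bigcup_k F k) a by rewrite -TF.
  have [j _ Gx] : (\bigcup_k G k) x by rewrite -TG.
  exists (maxn i j) => //; split => /=.
    by move: a Fa; exact/subsetPset/ndF/leq_maxl.
  by move: x Gx; exact/subsetPset/ndG/leq_maxr.
move=> k; split => //; rewrite /lebesgue_rVS /pushforward.
rewrite (_ : _ @^-1` _ = F k `*` G k); last first.
  rewrite -comp_preimage (_ : _ \o _ = id) ?preimage_id//; exact/funext/rV_consK.
have [? ?] := Foo k; have [? ?] := Goo k.
by rewrite product_measure1E// lte_mul_pinfty// ge0_fin_numE.
Qed.

HB.instance Definition _ := @Measure_isSigmaFinite.Build _ _ _ lebesgue_rVS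
  lebesgue_rVS_sigma_finite.

End step.

Fixpoint lebesgue_rV n : {sigma_finite_measure set 'rV[R]_n -> \bar R} :=
  match n return {sigma_finite_measure set 'rV[R]_n -> \bar R} with
  | 0 => dirac (0 : 'rV[R]_0)
  | n'.+1 => lebesgue_rVS (lebesgue_rV n')
  end.

Lemma lebesgue_rV_prod n (A : 'I_n -> set (measurableTypeR R)) :
  (forall i, measurable (A i)) ->
  lebesgue_rV n [set x | forall i, A i (x ord0 i)] =
  (\prod_(i < n) lebesgue_measure (A i))%E.
Proof.
elim: n A => [|n IH] A mA.
  rewrite big_ord0 /= diracE mem_set//; first by case.
have mB : measurable [set x : 'rV[R]_n | forall i, A (lift ord0 i) (x ord0 i)].
  rewrite [X in measurable X](_ : _ = \bigcap_(i in [set: 'I_n])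
    (rV_coord i @^-1` A (lift ord0 i))); last first.
    by apply/seteqP; split=> [x xA i _|x xA i]; exact: xA.
  apply: fin_bigcap_measurable => // i _.
  by rewrite -[X in measurable X]setTI; exact: measurable_rV_coord.
rewrite big_ord_recl -IH//= -product_measure1E//.
congr product_measure1; apply/seteqP; split=> -[a x] /= xA.
  split=> [|i]; first by have := xA ord0; rewrite mxE unlift_none.
  by have := xA (lift ord0 i); rewrite mxE liftK.
by move=> i; rewrite mxE; case: unliftP => [j|] ->; [exact: xA.2|exact: xA.1].
Qed.

End lebesgue_rV.

Section torus.
Context {R : realType} (d : nat) (L : R).

Definition box : set 'rV[R]_d := [set x | forall i, - L <= x ord0 i < L].

Lemma boxE : box = [set x | forall i, `[- L, L[%classic (x ord0 i)].
Proof. by apply/seteqP; split=> x /= xL i; have := xL i; rewrite in_itv. Qed.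

Lemma measurable_box : measurable box.
Proof.
rewrite (_ : box = \bigcap_(i in [set: 'I_d]) (rV_coord i @^-1` `[- L, L[)).
  apply: fin_bigcap_measurable => // i _.
  by rewrite -[X in measurable X]setTI; exact: measurable_rV_coord.
by rewrite boxE; apply/seteqP; split=> [x xA i _|x xA i]; exact: xA.
Qed.

Definition box_measure := mrestr (lebesgue_rV d) measurable_box.

HB.instance Definition _ := Measure.on box_measure.

Lemma box_measureT : 0 <= L -> box_measure setT = ((L *+ 2) ^+ d)%:E.
Proof.
move=> L0; rewrite /box_measure /mrestr setTI boxE.
rewrite (@lebesgue_rV_prod _ _ (fun=> `[- L, L[%classic))//.
rewrite (eq_bigr (fun=> (L *+ 2)%:E)); last first.
  move=> i _; rewrite lebesgue_measure_itv/= lte_fin.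
  case: ifPn => [_|]; first by rewrite -EFinB opprK mulr2n.
  rewrite -leNgt => LN; suff -> : L = 0 by rewrite mul0rn.
  by apply/eqP; rewrite eq_le L0 andbT; lra.
by rewrite prodEFin prodr_const card_ord.
Qed.

End torus.

Arguments box {R} d L.
Arguments box_measure {R} d L.

Section L2.
Context {disp : measure_display} {T : measurableType disp} {R : realType}.
Variable mu : {measure set T -> \bar R}.

Definition L2 : Type := LspaceType2 mu.

Definition L2_fun (f : L2) : T -> R := f : LspaceType2 mu.

Coercion L2_fun : L2 >-> Funclass.

HB.instance Definition _ := gen_eqMixin L2.
HB.instance Definition _ := gen_choiceMixin L2.

Definition L2_dist (f g : L2) : R :=
  fine ('N[mu]_2%:E[EFin \o (fun x => f x - g x)%R])%E.

Let L2_repr (f : L2) : {mfun T >-> measurableTypeR R} :=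
  repr (LebesgueSpace.sort (f : LspaceType2 mu)).

Lemma L2_Lfun (f : L2) : (f : T -> R) \in Lfun mu 2%:E.
Proof.
apply/andP; split; rewrite inE.
  exact: (@measurable_funPT _ _ _ _ (L2_repr f)).
exact: (@Lebesgue_finite _ _ _ _ _ _ (f : LspaceType2 mu)).
Qed.

Let lf (f : L2) : LfunType mu (lee1n 2) :=
  Lfun_Sub (lee1n 2) (L2_Lfun f).

Let L2_distE f g : L2_dist f g = fine ('N[mu]_2%:E[EFin \o (lf f - lf g)%R])%E.
Proof. by []. Qed.

Lemma L2_distxx f : L2_dist f f = 0.
Proof.
rewrite /L2_dist (_ : EFin \o _ = cst 0%E) ?Lnorm0//.
by apply/funext => x /=; rewrite subrr.
Qed.

Lemma L2_dist_positivity f g : L2_dist f g = 0 -> f = g.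
Proof.
rewrite L2_distE => /fine_Lnormr_eq0 fg.
have {}fg : LebesgueSpace.sort (f : LspaceType2 mu) =
    LebesgueSpace.sort (g : LspaceType2 mu).
  apply/eqP; rewrite -[X in X == _]reprK -[X in _ == X]reprK.
  apply/ae_eqP.
  apply: filterS fg => x /(_ I) /eqP; rewrite subr_eq0 => /eqP fgx _.
  exact: fgx.
case: f g fg => [f [[f2]]] [g [[g2]]] /= fg.
by case: _ / fg g2 => g2; rewrite (Prop_irrelevance f2 g2).
Qed.

Lemma L2_dist_sym f g : L2_dist f g = L2_dist g f.
Proof. 
rewrite !L2_distE -LnormrN; congr (fine (Lnorm _ _ _)).
by apply/funext => x /=; rewrite opprB.
Qed.

Lemma L2_dist_triangle g f h : L2_dist f h <= L2_dist f g + L2_dist g h.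
Proof.
rewrite !L2_distE (_ : lf f - lf h = (lf f - lf g) + (lf g - lf h)).
  exact: ler_LnormD.
by rewrite addrA subrK.
Qed.

HB.instance Definition _ := @isMetric.Build R L2 L2_dist
  L2_distxx L2_dist_positivity L2_dist_sym L2_dist_triangle.

End L2.

(* Elements coerce to functions on the whole space, but [box_measure d L] only
   sees their values on the fundamental domain [box d L] of the torus. *)
Notation L2box d L := (L2 (box_measure d L)).

Section periodic_sobolev.
Context {R : realType} (d : nat) (L : R).

Definition basis_vec (i : 'I_d) : 'rV[R]_d := delta_mx ord0 i.

Definition box_periodic (f : 'rV[R]_d -> R) : Prop :=
  forall x i, f (x + (L *+ 2) *: basis_vec i) = f x.

(* [iter_partial [:: i1; ...; ik] f] is the iterated partial derivative
   d_{i1} ... d_{ik} f. *)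
Definition iter_partial (s : seq 'I_d) (f : 'rV[R]_d -> R) : 'rV[R]_d -> R :=
  foldr (fun i g => 'D_(basis_vec i) g) f s.

Definition smooth (f : 'rV[R]_d -> R) : Prop :=
  forall s x, differentiable (iter_partial s f) x.

Definition is_weak_partial (i : 'I_d) (rho g : L2box d L) : Prop :=
  forall phi, smooth phi -> box_periodic phi ->
  (\int[box_measure d L]_x (rho x * 'D_(basis_vec i) phi x)%:E =
   - \int[box_measure d L]_x (g x * phi x)%:E)%E.

Definition H1p (rho : L2box d L) : Prop :=
  forall i, exists g, is_weak_partial i rho g.

(* The default value [rho] of [xget] is only used outside [H1p]. *)
Definition weak_partial (i : 'I_d) (rho : L2box d L) : L2box d L :=
  xget rho (is_weak_partial i rho).

Definition weak_grad (rho : L2box d L) (x : 'rV[R]_d) : 'rV[R]_d :=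
  \row_i weak_partial i rho x.

Definition admissible (rho : L2box d L) : Prop :=
  [/\ H1p rho, {ae box_measure d L, forall x, 0 <= rho x} &
      (\int[box_measure d L]_x (rho x)%:E = 1)%E].

End periodic_sobolev.

Section denominators.
Context {R : realType}.

(* Two-sided difference quotient for 0 < s, right difference quotient at 0. *)
Definition is_derive_halfline (f f' : R -> R) : Prop :=
  forall s, 0 <= s ->
  h^-1 * (f (s + h) - f s) @[h --> within [set h | 0 <= s + h] 0^'] --> f' s.

Definition concave_halfline (f : R -> R) : Prop :=
  convex_function (`[0, +oo[%classic : set R) (fun s => - f s).

(* Only the values [r eps s] with 0 < eps and 0 <= s matter. *)
Record admissible_denominators (r : R -> R -> R) : Prop := {
  denom_C1_ndecr : forall eps, 0 < eps -> exists r' : R -> R,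
    [/\ is_derive_halfline (r eps) r',
        {within `[0, +oo[%classic, continuous r'} &
        forall s, 0 <= s -> 0 <= r' s];
  denom_gt0 : forall eps s, 0 < eps -> 0 <= s -> 0 < r eps s;
  denom_concave : forall eps, 0 < eps -> concave_halfline (r eps);
  denom_ge : forall eps s, 0 < eps -> 0 <= s -> s <= r eps s;
  denom_mono : forall eps1 eps2 s, 0 < eps1 -> eps1 <= eps2 -> 0 <= s ->
    r eps1 s <= r eps2 s;
  denom_cvg : forall s, 0 <= s -> r eps s @[eps --> 0^'+] --> s
}.

End denominators.

Section energies.
Context {R : realType} (d : nat) (L : R).

(* Squared Euclidean norm; the library norm on row vectors is the sup norm. *)
Definition sqnorm (q : 'rV[R]_d) : R := \sum_i q ord0 i ^+ 2.

(* [kinetic] and [kinetic0] are meant for 0 <= s; the values at s < 0 are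
   immaterial since admissible densities are nonnegative almost everywhere. *)
Definition kinetic (r : R -> R) (s : R) (q : 'rV[R]_d) : R :=
  if 0 <= s then sqnorm q / (8 * r s) else 0.

Definition kinetic0 (s : R) (q : 'rV[R]_d) : \bar R :=
  if 0 < s then (sqnorm q / (8 * s))%:E else if q == 0 then 0%E else +oo%E.

Definition potential_reg (sigma s : R) : R :=
  Num.sqrt (s ^+ 2 + sigma ^+ 2) - sigma.

Definition energy (V : 'rV[R]_d -> R) (beta delta : R) (r : R -> R) (sigma : R)
    (rho : L2box d L) : \bar R :=
  if `[< admissible rho >] then
    (\int[box_measure d L]_x
       (kinetic r (rho x) (weak_grad rho x)
        + V x * potential_reg sigma (rho x)
        + beta / 2 * rho x ^+ 2
        + delta / 2 * sqnorm (weak_grad rho x))%:E)%E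
  else +oo%E.

Definition energy0 (V : 'rV[R]_d -> R) (beta delta : R)
    (rho : L2box d L) : \bar R :=
  if `[< admissible rho >] then
    (\int[box_measure d L]_x
       (kinetic0 (rho x) (weak_grad rho x)
        + (V x * rho x
           + beta / 2 * rho x ^+ 2
           + delta / 2 * sqnorm (weak_grad rho x))%:E))%E
  else +oo%E.

End energies.

Arguments energy {R d} L V beta delta r sigma rho.
Arguments energy0 {R d} L V beta delta rho.

Section gamma_convergence.
Context {R : realType} {X : topologicalType}.

Definition Gamma_cvg (E : R -> X -> \bar R) (E0 : X -> \bar R) : Prop :=
  forall eps : R^nat, (forall n, 0 < eps n) -> eps n @[n --> \oo] --> 0 ->
  forall x : X,
    (forall u : nat -> X, u n @[n --> \oo] --> x ->
       (E0 x <= limn_einf (fun n => E (eps n) (u n)))%E) /\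
    (exists u : nat -> X, u n @[n --> \oo] --> x /\
       (limn_esup (fun n => E (eps n) (u n)) <= E0 x)%E).

Definition equicoercive (E : R -> X -> \bar R) : Prop :=
  forall t : R, exists2 K : set X, compact K &
    forall eps, 0 < eps -> [set x | (E eps x <= t%:E)%E] `<=` K.

End gamma_convergence.

(* Main.v *)
(* The constant sequence is a recovery sequence, since F_eps <= F_0 and
   p_sigma(s) <= s. For the lower bound let rho_n -> rho in L^2 with energies at
   most t along a subsequence. The regularized energies increase as eps and sigma
   decrease and are midpoint convex, because |q|^2/r is convex in (s,q) for r
   concave. So the densities at squared distance at most 2^-m from rho, with
   energy at most t at the parameters 1/(m+1), form a decreasing sequence of
   midpoint convex sets; choosing in them elements with almost minimal gradient
   norm, the parallelogram identity gives strongly convergent gradients without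
   any weak compactness. Two applications of Fatou's lemma, along this sequence
   and then as eps -> 0, bound the limit energy by t.

   Weak partial derivatives are determined by their coefficients on
   cas(k.x) = cos(k.x) + sin(k.x), a system that is shown to be complete by a
   multiplicative class argument. In these coefficients, a bound on the energy
   puts rho in an ellipsoid with weights tending to infinity, which is compact in
   L^2 by Parseval's identity. *)

(* The integrand [kinetic0] is discontinuous at s = 0, q = 0. The limit of the densities is
   therefore taken at fixed parameters, where [denom_gt0] keeps the integrand continuous on s >= 0;
   only then do the parameters tend to 0, with the density and its gradient fixed.

   As sigma(eps) need not be monotone in eps, the two are independent parameters throughout. For
   large n both eps_n and sigma(eps_n) are at most 1/(m+1), and monotonicity in each replaces the
   moving pair by a fixed one.

   The given gradients are merely bounded in L^2. Minimizing the gradient norm over the competitors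
   stands in for Mazur's lemma; midpoints are the only convex combinations that the parallelogram
   identity asks for. The bound on the gradients comes from the term delta/2 |grad rho|^2, which
   does not depend on eps and so serves equicoercivity as well. There, the gradient controls every
   coefficient except that of frequency 0, and the mass constraint fixes this one. *)
Require Import Defs.
From HB Require Import structures.
From mathcomp Require Import all_boot all_order all_algebra.
From mathcomp Require Import zify ring lra.
From mathcomp Require Import all_classical all_reals all_analysis.
From mathcomp Require Import measurable_realfun.

Set Implicit Arguments.
Unset Strict Implicit.
Unset Printing Implicit Defensive.

Import Order.TTheory GRing.Theory Num.Theory.
Import numFieldNormedType.Exports.

Local Open Scope classical_set_scope.
Local Open Scope ring_scope.

(** * Square-integrable functions *)

Lemma integrable_bounded_on {d} {T : measurableType d} {R : realType}
    (mu : {measure set T -> \bar R}) (D : set T) (f : T -> R) (C : R) :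
  measurable D -> measurable_fun D f -> (mu D < +oo)%E ->
  (forall x, `|f x| <= C) -> mu.-integrable D (EFin \o f).
Proof.
move=> mD mf muD fC; apply: (@le_integrable _ _ _ _ _ _ _ (cst C%:E)) => //.
- exact/measurable_EFinP.
- by move=> x _ /=; rewrite lee_fin (le_trans (fC x))// ler_norm.
- apply/integrableP; split=> //; rewrite integral_cst//.
  by rewrite lte_mul_pinfty// ?abse_ge0.
Qed.

Section square_integrable.
Context {disp : measure_display} {T : measurableType disp} {R : realType}.
Variable mu : {measure set T -> \bar R}.
Implicit Types f g h : T -> R.

(** Plain functions rather than classes of [L2]: midpoints, series and limits are then pointwise,
    and [L2_sqi] and [exists_L2] translate at the two ends. *)
Definition sqi f : Prop := measurable_fun [set: T] f /\
  mu.-integrable [set: T] (EFin \o (fun x => f x ^+ 2)).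

Definition ip f g : R := \int[mu]_x (f x * g x).

Lemma sqi_mulr_integrable f g : sqi f -> sqi g ->
  mu.-integrable [set: T] (EFin \o (fun x => f x * g x)).
Proof.
move=> [mf f2] [mg g2].
apply: (le_integrable _ _ _ (integrableD _ f2 g2)) => //.
  by apply/measurable_EFinP; exact: measurable_funM.
move=> x _ /=; rewrite lee_fin [leRHS]ger0_norm ?addr_ge0 ?sqr_ge0//.
by rewrite ler_norml; apply/andP; split; nra.
Qed.

Lemma sqiZ (a : R) f : sqi f -> sqi (fun x => a * f x).
Proof.
move=> [mf f2]; split; first exact: measurable_funM.
apply: (eq_integrable _ (fun x => ((a ^+ 2)%:E * (f x ^+ 2)%:E)%E)) => //.
  by move=> x _ /=; rewrite exprMn EFinM.
exact: integrableZl.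
Qed.

Lemma sqiD f g : sqi f -> sqi g -> sqi (fun x => f x + g x).
Proof.
move=> sf sg; split; first exact: measurable_funD sf.1 sg.1.
apply: (le_integrable _ _ _
    (integrableZl _ 2 (integrableD _ sf.2 sg.2))) => //.
  apply/measurable_EFinP; apply: measurable_funX.
  exact: measurable_funD sf.1 sg.1.
move=> x _; rewrite /= lee_fin !ger0_norm ?sqr_ge0//.
  by have := sqr_ge0 (f x - g x); nra.
by rewrite mulr_ge0// addr_ge0 ?sqr_ge0.
Qed.

Lemma sqiB f g : sqi f -> sqi g -> sqi (fun x => f x - g x).
Proof.
move=> sf sg; have := sqiD sf (sqiZ (-1) sg).
by under eq_fun do rewrite mulN1r.
Qed.

Lemma sqi0 : sqi (fun=> 0).
Proof.
split=> //; apply: (eq_integrable _ (cst 0%E)) => //.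
  by move=> x _ /=; rewrite expr0n.
exact: integrable0.
Qed.

Lemma sqi_sum (I : Type) (s : seq I) (F : I -> T -> R) :
  (forall i, sqi (F i)) -> sqi (fun x => \sum_(i <- s) F i x).
Proof.
move=> sF; elim: s => [|i s IH].
  by under eq_fun do rewrite big_nil; exact: sqi0.
by under eq_fun do rewrite big_cons; exact: sqiD.
Qed.

Lemma ipC f g : ip f g = ip g f.
Proof. by apply: eq_Rintegral => x _; rewrite mulrC. Qed.

Lemma ip0r f : ip f (fun=> 0) = 0.
Proof.
rewrite /ip (eq_Rintegral _ (g := fun=> 0)); first by rewrite Rintegral_cst// mul0r.
by move=> x _; rewrite mulr0.
Qed.

Lemma ipDl f g h : sqi f -> sqi g -> sqi h ->
  ip (fun x => f x + g x) h = ip f h + ip g h.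
Proof.
move=> sf sg sh; rewrite /ip -RintegralD//; last 2 first.
- exact: sqi_mulr_integrable.
- exact: sqi_mulr_integrable.
by apply: eq_Rintegral => x _; rewrite mulrDl.
Qed.

Lemma ipZl (a : R) f h : sqi f -> sqi h -> ip (fun x => a * f x) h = a * ip f h.
Proof.
move=> sf sh; rewrite /ip -RintegralZl//; last exact: sqi_mulr_integrable.
by apply: eq_Rintegral => x _; rewrite mulrA.
Qed.

Lemma ipBl f g h : sqi f -> sqi g -> sqi h ->
  ip (fun x => f x - g x) h = ip f h - ip g h.
Proof.
move=> sf sg sh; rewrite /ip -RintegralB//; last 2 first.
- exact: sqi_mulr_integrable.
- exact: sqi_mulr_integrable.
by apply: eq_Rintegral => x _; rewrite mulrBl.
Qed.

Lemma ip_suml (I : Type) (s : seq I) (F : I -> T -> R) h :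
  (forall i, sqi (F i)) -> sqi h ->
  ip (fun x => \sum_(i <- s) F i x) h = \sum_(i <- s) ip (F i) h.
Proof.
move=> sF sh; elim: s => [|i s IH].
  by rewrite big_nil; under [X in ip X]eq_fun do rewrite big_nil; rewrite ipC ip0r.
rewrite big_cons -IH -ipDl//; last exact: sqi_sum.
by apply: eq_Rintegral => x _; rewrite big_cons.
Qed.

Lemma ip_ge0 f : 0 <= ip f f.
Proof. by apply: Rintegral_ge0 => x _; rewrite -expr2 sqr_ge0. Qed.

Lemma ip_sqE f : sqi f -> ((ip f f)%:E = \int[mu]_x (f x ^+ 2)%:E)%E.
Proof.
move=> [mf f2]; rewrite /ip /Rintegral.
under [in RHS]eq_integral do rewrite expr2.
rewrite fineK//; apply: integrable_fin_num => //; exact: eq_integrable f2.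
Qed.

Lemma ip_sqrB f g : sqi f -> sqi g ->
  ip (fun x => f x - g x) (fun x => f x - g x) = ip f f - 2 * ip f g + ip g g.
Proof.
move=> sf sg; rewrite ipBl//; last exact: sqiB.
rewrite ![ip _ (fun x => _ - _)]ipC !ipBl ?(ipC g f)//; ring.
Qed.

Lemma ip_sqrD f g : sqi f -> sqi g ->
  ip (fun x => f x + g x) (fun x => f x + g x) = ip f f + 2 * ip f g + ip g g.
Proof.
move=> sf sg; rewrite ipDl//; last exact: sqiD.
rewrite ![ip _ (fun x => _ + _)]ipC !ipDl ?(ipC g f)//; ring.
Qed.

Lemma ip_CauchySchwarz f g : sqi f -> sqi g ->
  ip f g ^+ 2 <= ip f f * ip g g.
Proof.
move=> sf sg; have P a b : 0 <= a ^+ 2 * ip f f - 2 * (a * b) * ip f g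
    + b ^+ 2 * ip g g.
  have := ip_ge0 (fun x => a * f x - b * g x).
  rewrite ip_sqrB; [|exact: sqiZ|exact: sqiZ].
  rewrite !(ipZl _ sf) ?(ipZl _ sg); [|exact: sqiZ|exact: sqiZ|exact: sqiZ].
  rewrite (ipC f (fun x => a * _)) (ipC g (fun x => b * _))
    (ipC f (fun x => b * _)) !(ipZl _ sf) ?(ipZl _ sg)// (ipC g f).
  by congr (_ <= _); ring.
have f0 := ip_ge0 f; have g0 := ip_ge0 g.
have [gz|gn] := eqVneq (ip g g) 0.
  have [->|fgn] := eqVneq (ip f g) 0; first by rewrite expr0n mulr_ge0.
  (* With <g,g> = 0 and <f,g> nonzero, this choice would give the form the negative value -<f,f> -
     2. *)
  have := P 1 ((ip f f + 1) / ip f g); rewrite gz mul1r -[2 * _ * _]mulrA divfK//.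
  lra.
have gp : 0 < ip g g by rewrite lt_neqAle eq_sym gn.
(* With these coefficients the form is <g,g> times the difference of the two sides. *)
have := P (ip g g) (ip f g).
rewrite (_ : _ + _ = ip g g * (ip f f * ip g g - ip f g ^+ 2)); last by ring.
by rewrite pmulr_rge0// subr_ge0.
Qed.

Lemma ip_sqD_le f g : sqi f -> sqi g ->
  ip (fun x => f x + g x) (fun x => f x + g x) <= 2 * (ip f f + ip g g).
Proof.
move=> sf sg; have := ip_ge0 (fun x => f x - g x).
by rewrite (ip_sqrD sf sg) (ip_sqrB sf sg); lra.
Qed.

Lemma ip_sqB_le g f h : sqi f -> sqi g -> sqi h ->
  ip (fun x => f x - h x) (fun x => f x - h x) <=
  2 * (ip (fun x => f x - g x) (fun x => f x - g x)
       + ip (fun x => g x - h x) (fun x => g x - h x)).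
Proof.
move=> sf sg sh.
have := ip_sqD_le (sqiB sf sg) (sqiB sg sh).
by under [X in ip X X <= _]eq_fun do rewrite addrA subrK.
Qed.

Lemma eq_ip_ae f g h : measurable_fun setT f -> measurable_fun setT g ->
  measurable_fun setT h ->
  {ae mu, forall x, f x = g x} -> ip f h = ip g h.
Proof.
move=> mf mg mh fg; congr fine; apply: ae_eq_integral => //.
- by apply/measurable_EFinP; exact: measurable_funM.
- by apply/measurable_EFinP; exact: measurable_funM.
- by apply: filterS fg => x /= ->.
Qed.

Hypothesis mu_fin : (mu [set: T] < +oo)%E.

Lemma integrable_bounded f (C : R) : measurable_fun setT f ->
  (forall x, `|f x| <= C) -> mu.-integrable setT (EFin \o f).
Proof. by move=> mf; exact: integrable_bounded_on. Qed.

Lemma sqi_bounded f (C : R) : measurable_fun setT f ->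
  (forall x, `|f x| <= C) -> sqi f.
Proof.
move=> mf fC; split=> //; apply: (@integrable_bounded _ (C ^+ 2)).
  exact: measurable_funX.
move=> x; rewrite normrX ler_pXn2r// ?nnegrE//.
exact: le_trans (normr_ge0 _) (fC x).
Qed.

Lemma sqi_cst (a : R) : sqi (fun=> a).
Proof. exact: (@sqi_bounded _ `|a|). Qed.

Lemma sqi_integrable f : sqi f -> mu.-integrable setT (EFin \o f).
Proof.
move=> sf; apply: eq_integrable (sqi_mulr_integrable sf (sqi_cst 1)) => //.
by move=> x _ /=; rewrite mulr1.
Qed.

End square_integrable.

(** * Almost everywhere limits and completeness of L^2 *)

Section ae_limits.
Context {disp : measure_display} {T : measurableType disp} {R : realType}.
Variable mu : {measure set T -> \bar R}.

Lemma measurable_fun_limn_einf (h : nat -> T -> \bar R) :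
  (forall n, measurable_fun setT (h n)) ->
  measurable_fun setT (fun x => limn_einf (h^~ x)).
Proof.
move=> mh; rewrite (_ : (fun x => _) =
    (fun x => - limn_esup (fun n => - h n x))%E); last first.
  apply/funext => x; rewrite -[LHS]oppeK -limn_esupN.
  by congr (- limn_esup _)%E.
apply: measurableT_comp => //.
apply: (@measurable_fun_limn_esup _ _ _ _ (fun n x => - h n x)%E) => n.
exact: measurableT_comp.
Qed.

(** The lower limit ignores finitely many terms and the integral ignores null sets, so Fatou's lemma
    holds in this weaker form. *)
Lemma fatou_le (h : nat -> T -> \bar R) (l : T -> \bar R) (c : \bar R) N :
  (forall n, measurable_fun setT (h n)) -> measurable_fun setT l ->
  (forall n x, 0 <= h n x)%E -> (forall x, 0 <= l x)%E ->
  {ae mu, forall x, h n x @[n --> \oo] --> l x} ->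
  (forall n, (N <= n)%N -> \int[mu]_x h n x <= c)%E ->
  (\int[mu]_x l x <= c)%E.
Proof.
move=> mh ml h0 l0 hl hc.
have -> : (\int[mu]_x l x = \int[mu]_x limn_einf (h^~ x))%E.
  apply: ge0_ae_eq_integral => //.
  - exact: measurable_fun_limn_einf.
  - move=> x _; rewrite limn_einf_lim; apply: lime_ge.
      exact: is_cvg_einfs.
    by apply: nearW => n; apply: le_ereal_inf_tmp => _ [k /= nk <-].
  apply: filterS hl => x hx _.
  rewrite is_cvg_limn_einfE; last by apply/cvg_ex; exists (l x).
  exact/esym/cvg_lim.
apply: le_trans (fatou mu measurableT mh (fun n x _ => h0 n x)) _.
rewrite limn_einf_lim; apply: lime_le; first exact: is_cvg_einfs.
apply: nearW => n; apply: le_trans (hc (maxn n N) (leq_maxr _ _)).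
by apply: ereal_inf_lbound; exists (maxn n N) => //=; exact: leq_maxl.
Qed.

(** By monotone convergence the sum has integral at most [C], hence is finite almost everywhere. *)
Lemma ae_cvg_series (w : nat -> T -> R) (C : R) :
  (forall n, measurable_fun setT (w n)) -> (forall n x, 0 <= w n x) ->
  (forall n, \sum_(0 <= k < n) \int[mu]_x (w k x)%:E <= C%:E)%E ->
  {ae mu, forall x, cvgn (series (w^~ x))}.
Proof.
move=> mw w0 wC.
pose W x := (\sum_(0 <= k <oo) (w k x)%:E)%E.
have mw' n : measurable_fun setT (EFin \o w n) by exact/measurable_EFinP.
have W0 x : (0 <= W x)%E by apply: nneseries_ge0 => n _ _; rewrite lee_fin.
have mW : measurable_fun setT W.
  by apply: (@ge0_emeasurable_sum _ _ _ _ (fun n x => (w n x)%:E) xpredT)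
    => [k x _ _|k _]; [rewrite lee_fin|exact: mw'].
have iW : mu.-integrable setT W.
  apply/integrableP; split=> //.
  under eq_integral do rewrite gee0_abs//.
  rewrite /W integral_nneseries//; last by move=> n x _; rewrite lee_fin.
  apply: (@le_lt_trans _ _ C%:E); last exact: ltry.
  apply: lime_le; last by apply: nearW => n; exact: wC.
  apply: is_cvg_nneseries => n _ _; apply: integral_ge0 => x _.
  by rewrite lee_fin.
apply: filterS (integrable_ae measurableT iW) => x /(_ I) Wfin.
apply: nondecreasing_is_cvgn.
  by apply: nondecreasing_series => n _ _; exact: w0.
exists (fine (W x)) => _ [n _ <-].
rewrite -lee_fin fineK// /series /= -sumEFin.
by apply: nneseries_lim_ge => k _ _; rewrite lee_fin.
Qed.

Lemma sum_geometric_half_le n : \sum_(0 <= k < n) (2^-1 : R) ^+ k <= 2.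
Proof.
have := @geometric_le_lim R n 1 2^-1 ler01.
rewrite ger0_norm//; have h : (2^-1 : R) < 1 by lra.
move=> /(_ _ h); rewrite invr_gt0 ltr0n => /(_ isT).
rewrite (_ : 1 / (1 - 2^-1) = 2 :> R); last by field.
by apply: le_trans; rewrite /series/=; apply: ler_sum => k _; rewrite mul1r.
Qed.

(** The squares have summable integrals, so their series converges almost everywhere and its terms
    tend to 0; the geometric rate spares a subsequence. *)
Lemma ae_cvg_sqi0 (h : nat -> T -> R) : (forall n, sqi mu (h n)) ->
  (forall n, ip mu (h n) (h n) <= 2^-1 ^+ n) ->
  {ae mu, forall x, h n x @[n --> \oo] --> 0}.
Proof.
move=> sh hn.
have /= : {ae mu, forall x, cvgn (series (fun n => h n x ^+ 2))}.
  apply: (@ae_cvg_series (fun n x => h n x ^+ 2) 2).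
  - by move=> n; apply: measurable_funX; exact: (sh n).1.
  - by move=> n x; exact: sqr_ge0.
  - move=> n; apply: (@le_trans _ _ (\sum_(0 <= k < n) (2^-1 ^+ k)%:E)%E).
      by apply: lee_sum => k _; rewrite -ip_sqE// lee_fin.
    by rewrite sumEFin lee_fin sum_geometric_half_le.
apply: filterS => x /cvg_series_cvg_0 h0.
apply/cvgr0Pnorm_lt => e e0.
move/cvgr0Pnorm_lt : h0 => /(_ _ (exprn_gt0 2 e0)).
apply: filterS => n; rewrite normrX => hlt.
by rewrite -(ltr_pXn2r (n:=2)) ?nnegrE// ltW.
Qed.

(** Riesz-Fischer: along a subsequence with increments of squared norm at most 4^-j the series of
    increments converges absolutely almost everywhere. Fatou's lemma then gives convergence in norm
    of the whole sequence. *)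
Lemma sqi_complete (u : nat -> T -> R) : (mu setT < +oo)%E ->
  (forall n, sqi mu (u n)) ->
  (forall e, 0 < e -> exists N, forall m n, (N <= m)%N -> (N <= n)%N ->
     ip mu (fun x => u m x - u n x) (fun x => u m x - u n x) <= e) ->
  exists2 f, sqi mu f &
  (forall e, 0 < e -> exists N, forall n, (N <= n)%N ->
     ip mu (fun x => u n x - f x) (fun x => u n x - f x) <= e).
Proof.
move=> mufin su uC.
have /choice[N NP] j : exists N, forall m n, (N <= m)%N -> (N <= n)%N ->
    ip mu (fun x => u m x - u n x) (fun x => u m x - u n x) <= (2^-1 ^+ j) ^+ 2.
  by apply: uC; rewrite !exprn_gt0.
(* Summing the thresholds puts both [p j] and [p j.+1] beyond [N j]; the term [j] makes [p]
   unbounded. *)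
pose p j := (j + \sum_(i < j.+1) N i)%N.
have Np j : (N j <= p j)%N by rewrite /p big_ord_recr/= addnA leq_addl.
have NpS j : (N j <= p j.+1)%N.
  apply: leq_trans (Np j) _; rewrite /p [in leqRHS]big_ord_recr/=.
  by rewrite leq_add ?leq_addr.
have jp j : (j <= p j)%N by rewrite leq_addr.
pose h j x := u (p j.+1) x - u (p j) x.
have sh j : sqi mu (h j) by exact: sqiB.
have mu_ n : measurable_fun setT (u n) := (su n).1.
(* The upper limit is measurable whether or not the sequence converges; where it is infinite, which
   happens on a null set only, [fine] returns 0. *)
pose f x := fine (limn_esup (fun n => (u (p n) x)%:E)).
have mf : measurable_fun setT f.
  apply: measurableT_comp; first exact: fine_measurable.
  apply: (@measurable_fun_limn_esup _ _ _ _ (fun n x => (u (p n) x)%:E)) => n.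
  exact/measurable_EFinP.
have cvgf : {ae mu, forall x, u (p n) x @[n --> \oo] --> f x}.
  (* The factor 2^j still leaves 2^-j of the bound 4^-j, and it makes |h_j| <= 2^-j + 2^j h_j^2
     available for comparison. *)
  have := @ae_cvg_series (fun j x => 2 ^+ j * h j x ^+ 2) 2.
  have mw j : measurable_fun setT (fun x => 2 ^+ j * h j x ^+ 2).
    by apply: measurable_funM => //; apply: measurable_funX; exact: (sh j).1.
  move=> /(_ mw) /(_ _ _)/wrap[].
    by move=> j x; rewrite mulr_ge0// ?sqr_ge0// exprn_ge0.
  - move=> n; apply: (@le_trans _ _ (\sum_(0 <= k < n) (2^-1 ^+ k)%:E)%E).
      apply: lee_sum => k _; under eq_integral do rewrite EFinM.
      rewrite (ge0_integralZl_EFin _ measurableT); first last.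
      - by rewrite exprn_ge0.
      - by apply/measurable_EFinP/measurable_funX; exact: (sh k).1.
      - by move=> x _; rewrite lee_fin sqr_ge0.
      rewrite -ip_sqE// -EFinM lee_fin.
      apply: (@le_trans _ _ (2 ^+ k * (2^-1 ^+ k) ^+ 2)).
        by rewrite ler_pM2l ?exprn_gt0//; exact: NP.
      by rewrite expr2 mulrA -exprMn divff// expr1n mul1r.
    by rewrite sumEFin lee_fin sum_geometric_half_le.
  apply: filterS => x cw.
  have cg : cvgn (series (fun j => 2^-1 ^+ j : R)).
    have := @is_cvg_geometric_series R 1 2^-1.
    by rewrite ger0_norm// -exprn_geometric; apply; lra.
  have /normed_cvg ch : cvgn [normed series (h^~ x)].
    apply: series_le_cvg (is_cvg_seriesD cg cw) => [j|j|j] /=.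
    - exact: normr_ge0.
    - by rewrite /= addr_ge0 ?exprn_ge0// mulr_ge0 ?sqr_ge0// exprn_ge0.
    - rewrite -[leRHS]/(2^-1 ^+ j + 2 ^+ j * h j x ^+ 2); set a := h j x; rewrite /=.
      have b0 : 0 < 2 ^+ j :> R by rewrite exprn_gt0.
      rewrite exprVn -[in leRHS]real_normK ?num_real//.
      rewrite -(ler_pM2l b0) mulrDr divff ?gt_eqF//.
      by have := sqr_ge0 (2 ^+ j * `|a| - 1); nra.
  have /cvg_ex[l ul] : cvgn (fun n => u (p n) x).
    have -> : (fun n => u (p n) x) = (fun n => u (p 0%N) x + series (h^~ x) n).
      apply/funext => n; rewrite /series/= telescope_sumr//; ring.
    by apply: is_cvgD => //; exact: is_cvg_cst.
  suff -> : f x = l by [].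
  have ul' : (u (p n) x)%:E @[n --> \oo] --> l%:E by apply: cvg_EFin => //; exact: nearW.
  rewrite /f is_cvg_limn_esupE; last by apply/cvg_ex; exists l%:E.
  by rewrite (cvg_lim _ ul').
have uf e : 0 < e -> exists N, forall n, (N <= n)%N ->
    (\int[mu]_x ((u n x - f x) ^+ 2)%:E <= e%:E)%E.
  move=> /uC[M MP]; exists M => n Mn.
  apply: (@fatou_le (fun k x => ((u n x - u (p k) x) ^+ 2)%:E) _ _ M).
  - by move=> k; apply/measurable_EFinP/measurable_funX/measurable_funB.
  - by apply/measurable_EFinP/measurable_funX/measurable_funB.
  - by move=> k x; rewrite lee_fin sqr_ge0.
  - by move=> x; rewrite lee_fin sqr_ge0.
  - apply: filterS cvgf => x ufx; apply: cvg_EFin; first exact: nearW.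
    have cd : u n x - u (p k) x @[k --> \oo] --> u n x - f x.
      by apply: cvgB => //; exact: cvg_cst.
    exact: (cvgM cd cd).
  - move=> k Mk; rewrite -ip_sqE ?lee_fin; last exact: sqiB.
    by apply: MP => //; exact: leq_trans (jp k).
have suf e : 0 < e -> exists N, forall n, (N <= n)%N ->
    sqi mu (fun x => u n x - f x) /\
    ip mu (fun x => u n x - f x) (fun x => u n x - f x) <= e.
  move=> /uf[M MP]; exists M => n /MP Mn.
  have sq : sqi mu (fun x => u n x - f x).
    split; first exact: measurable_funB.
    apply/integrableP; split.
      by apply/measurable_EFinP/measurable_funX/measurable_funB.
    apply: le_lt_trans (ltry e); apply: le_trans Mn.
    rewrite le_eqVlt; apply/orP; left; apply/eqP; apply: eq_integral => x _ /=.
    by rewrite ger0_norm// sqr_ge0.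
  by split=> //; rewrite -lee_fin ip_sqE.
exists f.
  have [M /(_ M (leqnn M))[sM _]] := suf 1 ltr01.
  have := sqiB (su M) sM.
  by under eq_fun do rewrite opprB addrC subrK.
by move=> e /suf[M MP]; exists M => n /MP[].
Qed.

End ae_limits.

(** * Functions and their classes in L^2 *)

Section L2_elements.
Context {disp : measure_display} {T : measurableType disp} {R : realType}.
Variable mu : {measure set T -> \bar R}.

Lemma sqi_Lfun (f : T -> R) : sqi mu f <-> f \in Lfun mu 2%:E.
Proof.
split=> [[mf f2]|fL]; last first.
  split; last exact: Lfun2_integrable_sqr.
  by move: fL => /andP[]; rewrite inE.
apply/andP; split; rewrite inE//= /finite_norm unlock poweR_lty//.
under eq_integral do rewrite /= powR_mulrn// -normrX.
by have /integrableP[_] := f2.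
Qed.

Lemma L2_sqi (f : L2 mu) : sqi mu f.
Proof. by apply/sqi_Lfun; exact: L2_Lfun. Qed.

Lemma measurable_L2 (f : L2 mu) : measurable_fun setT f.
Proof. exact: (L2_sqi f).1. Qed.

Lemma L2_dist_sqr (f g : L2 mu) :
  L2_dist f g ^+ 2 = ip mu (fun x => f x - g x) (fun x => f x - g x).
Proof.
have sfg := sqiB (L2_sqi f) (L2_sqi g).
apply: EFin_inj; rewrite ip_sqE// /L2_dist.
have /andP[_] := (sqi_Lfun _).1 sfg; rewrite inE /= /finite_norm => fin.
have N0 := Lnorm_ge0 mu 2%:E (EFin \o (fun x => f x - g x)).
rewrite -powR_mulrn ?fine_ge0// -poweR_EFin fineK ?ge0_fin_numE//.
rewrite powR_Lnorm//; apply: eq_integral => x _ /=.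
by rewrite powR_mulrn// real_normK ?num_real.
Qed.

Lemma exists_L2 (f : T -> R) : sqi mu f ->
  exists g : L2 mu, {ae mu, forall x, g x = f x}.
Proof.
move=> sf; have [mf _] := sf.
pose F : {mfun T >-> measurableTypeR R} := HB.pack f
  (isMeasurableFun.Build _ _ T (measurableTypeR R) f mf).
pose q : {mfun_ mu, T >-> measurableTypeR R} :=
  (\pi_({mfun_ mu, T >-> measurableTypeR R}) F)%qT.
have qF : {ae mu, forall x, q x = f x}.
  have : (repr q == F %[mod {mfun_ mu, T >-> measurableTypeR R}])%qT.
    by rewrite reprK.
  by rewrite eqmodE => /asboolP; apply: filterS => x; apply.
have qfin : finite_norm mu 2%:E q.
  have /andP[_] := (sqi_Lfun _).1 sf; rewrite inE /= /finite_norm unlock.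
  have E (g : T -> R) : (fun x => `|(EFin \o g) x| `^ 2)%E =
      (fun x => (g x ^+ 2)%:E).
    apply/funext => x /=; rewrite powR_mulrn//.
    by rewrite real_normK ?num_real.
  rewrite /= !E; congr (_ `^ _ < _)%E.
  apply: ge0_ae_eq_integral => //.
  - by apply/measurable_EFinP/measurable_funX.
  - by apply/measurable_EFinP/measurable_funX;
    exact: (@measurable_funPT _ _ _ _ (repr q)).
  - by move=> x _; rewrite lee_fin sqr_ge0.
  - by move=> x _; rewrite lee_fin sqr_ge0.
  - by apply: filterS qF => x /= -> _.
pose Q : LspaceType2 mu := HB.pack q
  (isFinLebesgue.Build _ _ _ _ _ (lee1n 2) q qfin).
by exists (Q : L2 mu).
Qed.

End L2_elements.

Section L2_convergence.
Context {disp : measure_display} {T : measurableType disp} {R : realType}.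
Variable mu : {measure set T -> \bar R}.

Definition sqdist (f g : T -> R) : R :=
  ip mu (fun x => f x - g x) (fun x => f x - g x).

Lemma sqdist_ge0 f g : 0 <= sqdist f g.
Proof. exact: ip_ge0. Qed.

Lemma sqdistC f g : sqdist f g = sqdist g f.
Proof. by apply: eq_Rintegral => x _; ring. Qed.

Lemma eq_sqdist_ael h f g : sqi mu h -> sqi mu f -> sqi mu g ->
  {ae mu, forall x, f x - g x = 0} -> sqdist f h = sqdist g h.
Proof.
move=> [mh _] [mf _] [mg _] fg.
have mfh : measurable_fun setT (fun x => f x - h x) by exact: measurable_funB.
have mgh : measurable_fun setT (fun x => g x - h x) by exact: measurable_funB.
have fgh : {ae mu, forall x, f x - h x = g x - h x}.
  by apply: filterS fg => x /eqP; rewrite subr_eq0 => /eqP ->.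
by rewrite /sqdist (eq_ip_ae mfh mgh mfh fgh) ipC (eq_ip_ae mfh mgh mgh fgh).
Qed.

Lemma L2_dist_ge0 (f g : L2 mu) : 0 <= L2_dist f g.
Proof. exact/fine_ge0/Lnorm_ge0. Qed.

Lemma sqdist_cvg0P (u : nat -> T -> R) f :
  sqdist (u n) f @[n --> \oo] --> 0 <->
  (forall e, 0 < e -> exists N, forall n, (N <= n)%N -> sqdist (u n) f <= e).
Proof.
split=> [uf e e0|uf].
  move/cvgr0Pnorm_lt : uf => /(_ _ e0) [N _ NP].
  by exists N => n /NP /=; rewrite ger0_norm ?sqdist_ge0// => /ltW.
apply/cvgr0Pnorm_le => e /uf[N NP]; exists N => // n /= /NP.
by rewrite ger0_norm ?sqdist_ge0.
Qed.

Lemma L2_cvgP (u : nat -> L2 mu) (l : L2 mu) :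
  u n @[n --> \oo] --> l <-> sqdist (u n) l @[n --> \oo] --> 0.
Proof.
split=> [/cvg_ballP ul|/sqdist_cvg0P ul].
  apply/cvgr0Pnorm_lt => e e0.
  (* Below 1 the square of the distance is at most the distance. *)
  have : 0 < Num.min e 1 by rewrite lt_min e0 /=.
  move=> /ul; apply: filterS => n; rewrite ballEmdist /= => ne.
  rewrite ger0_norm ?sqdist_ge0// /sqdist -L2_dist_sqr -/(L2_dist _ _).
  have d0 : 0 <= L2_dist (u n) l by exact: L2_dist_ge0.
  have : L2_dist (u n) l < Num.min e 1 by rewrite L2_dist_sym.
  by rewrite lt_min => /andP[? ?]; nra.
apply/cvg_ballP => e e0.
have [N NP] := ul (e ^+ 2 / 4) (divr_gt0 (exprn_gt0 2 e0) (ltr0n _ 4)).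
exists N => // n /= /NP; rewrite /sqdist -L2_dist_sqr ballEmdist /= => h.
rewrite -[mdist l (u n)]/(L2_dist l (u n)) L2_dist_sym.
have d0 : 0 <= L2_dist (u n) l by exact: L2_dist_ge0.
by rewrite ltNge; apply/negP => eh; nra.
Qed.

Lemma cvg_ip (u : nat -> T -> R) f h : (forall n, sqi mu (u n)) -> sqi mu f ->
  sqi mu h -> sqdist (u n) f @[n --> \oo] --> 0 ->
  ip mu (u n) h @[n --> \oo] --> ip mu f h.
Proof.
move=> su sf sh uf; apply/cvgrPdist_lt => e e0.
have h0 := ip_ge0 mu h.
have d0 : 0 < e ^+ 2 / (ip mu h h + 1) by rewrite divr_gt0 ?exprn_gt0//; lra.
move/cvgr0Pnorm_lt : uf => /(_ _ d0); apply: filterS => n.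
rewrite ger0_norm ?sqdist_ge0// ltr_pdivlMr; last by lra.
move=> un; rewrite distrC -(ltr_pXn2r (n:=2)) ?nnegrE// ?(ltW e0)//.
rewrite -normrX ger0_norm ?sqr_ge0// -ipBl//.
apply: le_lt_trans (ip_CauchySchwarz (sqiB (su n) sf) sh) _.
apply: le_lt_trans un; rewrite ler_wpM2l ?sqdist_ge0//; lra.
Qed.

Lemma L2_complete (u : nat -> L2 mu) : (mu setT < +oo)%E ->
  (forall e, 0 < e -> exists N, forall m n, (N <= m)%N -> (N <= n)%N ->
     sqdist (u m) (u n) <= e) ->
  exists l : L2 mu, sqdist (u n) l @[n --> \oo] --> 0.
Proof.
move=> mufin /(sqi_complete mufin (fun n => L2_sqi (u n)))[f sf uf].
have [l lf] := exists_L2 sf; exists l; apply/sqdist_cvg0P => e /uf[N NP].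
exists N => n /NP; apply: le_trans.
rewrite sqdistC (eq_sqdist_ael (L2_sqi (u n)) (L2_sqi l) sf) 1?sqdistC//.
by apply: filterS lf => x ->; rewrite subrr.
Qed.

End L2_convergence.

(** * Fourier coefficients and compact ellipsoids *)

Section orthogonal_system.
Context {disp : measure_display} {T : measurableType disp} {R : realType}.
Variable mu : {measure set T -> \bar R}.
Hypothesis mu_fin : (mu setT < +oo)%E.
Variables (e : nat -> T -> R) (B : R).
Hypothesis B_gt0 : 0 < B.
Hypothesis e_sqi : forall n, sqi mu (e n).
Hypothesis e_orth : forall m n, m != n -> ip mu (e m) (e n) = 0.
(* Zero vectors are allowed, so that a partial enumeration can be padded. *)
Hypothesis e_norm : forall n, ip mu (e n) (e n) = B \/ e n = fun=> 0.

Let fsum (a : nat -> R) (m n : nat) x := \sum_(m <= k < n) a k * e k x.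

Let fsum_sqi a m n : sqi mu (fsum a m n).
Proof. by apply: sqi_sum => k; exact: sqiZ. Qed.

Lemma orth_sum_ip (a : nat -> R) m n h : sqi mu h ->
  ip mu (fsum a m n) h = \sum_(m <= k < n) a k * ip mu h (e k).
Proof.
move=> sh; rewrite /fsum ip_suml//; last by move=> k; exact: sqiZ.
by apply: eq_bigr => k _; rewrite ipZl// ipC.
Qed.

Lemma orth_sum_coef (a : nat -> R) m n k : ip mu (fsum a m n) (e k) =
  if (m <= k < n)%N then a k * ip mu (e k) (e k) else 0.
Proof.
rewrite orth_sum_ip//; case: ifPn => [kmn|kmn].
  rewrite (big_rem k) ?mem_index_iota//= big1_seq ?addr0// => i /andP[_].
  rewrite mem_rem_uniq ?iota_uniq// inE => /andP[ik _].
  by rewrite (e_orth _) ?mulr0// eq_sym.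
rewrite big1_seq// => i /andP[_]; rewrite mem_index_iota => imn.
rewrite e_orth ?mulr0//; apply: contraNneq kmn => ->; exact: imn.
Qed.

Definition fcoef h n := ip mu h (e n).

Lemma fcoefB f g n : sqi mu f -> sqi mu g ->
  fcoef (fun x => f x - g x) n = fcoef f n - fcoef g n.
Proof. by move=> sf sg; rewrite /fcoef ipBl. Qed.

(** The coefficient at a padding vector is 0, so the same factor [B] fits there and [psum] may
    divide by [B] at every index. *)
Lemma fcoef_norm h n : fcoef h n * ip mu (e n) (e n) = B * fcoef h n.
Proof.
have [->|en] := e_norm n; first exact: mulrC.
suff -> : fcoef h n = 0 by rewrite mul0r mulr0.
by rewrite /fcoef en ip0r.
Qed.

Definition psum h m n := fsum (fun k => B^-1 * fcoef h k) m n.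

Lemma psum_sqi h m n : sqi mu (psum h m n).
Proof. exact: fsum_sqi. Qed.

Lemma psum_ip h m n : sqi mu h ->
  ip mu (psum h m n) h = B^-1 * \sum_(m <= k < n) fcoef h k ^+ 2.
Proof.
move=> sh; rewrite orth_sum_ip// mulr_sumr; apply: eq_bigr => k _.
by rewrite -mulrA expr2.
Qed.

Lemma psum_coef h m n k : ip mu (psum h m n) (e k) =
  if (m <= k < n)%N then fcoef h k else 0.
Proof.
rewrite orth_sum_coef; case: ifPn => // _.
by rewrite -mulrA fcoef_norm mulrA mulVf ?mul1r// gt_eqF.
Qed.

Lemma psum_norm h m n : sqi mu h ->
  ip mu (psum h m n) (psum h m n) = B^-1 * \sum_(m <= k < n) fcoef h k ^+ 2.
Proof.
move=> sh; rewrite orth_sum_ip; last exact: psum_sqi.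
rewrite mulr_sumr !big_nat; apply: eq_bigr => k kmn.
by rewrite psum_coef kmn -mulrA expr2.
Qed.

Lemma sqdist_psum h n : sqi mu h ->
  sqdist mu h (psum h 0 n) = ip mu h h - B^-1 * \sum_(0 <= k < n) fcoef h k ^+ 2.
Proof.
move=> sh; rewrite /sqdist ip_sqrB//; last exact: psum_sqi.
rewrite psum_norm// ipC psum_ip//; ring.
Qed.

Lemma Bessel h n : sqi mu h ->
  \sum_(0 <= k < n) fcoef h k ^+ 2 <= B * ip mu h h.
Proof.
move=> sh; have := sqdist_ge0 mu h (psum h 0 n).
by rewrite sqdist_psum// subr_ge0 -(ler_pM2l B_gt0) mulrA divff ?mul1r// gt_eqF.
Qed.

Hypothesis e_complete : forall h, sqi mu h -> (forall n, fcoef h n = 0) ->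
  {ae mu, forall x, h x = 0}.

(** The partial sums are Cauchy by Bessel's inequality. Their limit has the coefficients of [h], so
    by completeness of the system it is [h] almost everywhere. *)
Lemma Parseval h : sqi mu h ->
  B^-1 * \sum_(0 <= k < n) fcoef h k ^+ 2 @[n --> \oo] --> ip mu h h.
Proof.
move=> sh.
pose a n := B^-1 * \sum_(0 <= k < n) fcoef h k ^+ 2.
have aS m n : (m <= n)%N ->
    a n - a m = B^-1 * \sum_(m <= k < n) fcoef h k ^+ 2.
  by move=> mn; rewrite /a -mulrBr [X in X - _](big_cat_nat _ mn)//= addrAC subrr add0r.
have psumB m n : (m <= n)%N ->
    sqdist mu (psum h 0 n) (psum h 0 m) = a n - a m.
  move=> mn; rewrite aS// -(psum_norm m n sh) /sqdist.
  have -> : (fun x => psum h 0 n x - psum h 0 m x) = psum h m n.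
    apply/funext => x; rewrite /psum /fsum [X in X - _](big_cat_nat _ mn)//=.
    by rewrite addrAC subrr add0r.
  by [].
have a_nd : {homo a : m n / (m <= n)%N >-> m <= n}.
  by move=> m n mn; rewrite -subr_ge0 -psumB// sqdist_ge0.
have a_cvg : cvgn a.
  apply: nondecreasing_is_cvgn => //; exists (ip mu h h) => _ [n _ <-].
  by rewrite -subr_ge0 -sqdist_psum// sqdist_ge0.
have [|s ss Ss] := @sqi_complete _ _ _ _ (psum h 0) mu_fin (psum_sqi h 0).
  move=> eps eps0; have /cvgrPdist_le/(_ _ eps0)[N _ NP] := a_cvg.
  have aL n : a n <= limn a by exact: nondecreasing_cvgn_le.
  have wlog_le m n : (N <= m)%N -> (m <= n)%N ->
      sqdist mu (psum h 0 n) (psum h 0 m) <= eps.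
    move=> Nm mn; rewrite psumB//; have := NP m Nm; have := aL n.
    by rewrite /= ger0_norm ?subr_ge0//; lra.
  exists N => m n Nm Nn; have [mn|nm] := leqP m n; last exact/wlog_le/ltnW.
  by rewrite -/(sqdist _ _ _) sqdistC; exact: wlog_le.
have /sqdist_cvg0P {}Ss := Ss.
have hs : {ae mu, forall x, h x - s x = 0}.
  apply: e_complete => [|n]; first exact: sqiB.
  rewrite fcoefB//; apply/eqP; rewrite subr_eq0; apply/eqP/esym.
  have c1 := cvg_ip (psum_sqi h 0) ss (e_sqi n) Ss.
  apply: (cvg_unique _ c1) => //; apply: cvg_near_cst.
  by exists n.+1 => // m /= nm; rewrite psum_coef/= nm.
have aE n : a n = ip mu h h - sqdist mu (psum h 0 n) s.
  have := sqdist_psum n sh; rewrite -/(a n).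
  by rewrite (eq_sqdist_ael (psum_sqi h 0 n) sh ss hs) sqdistC; lra.
rewrite (_ : (fun n => _) = a)// (funext aE) -[X in _ --> X]subr0.
by apply: cvgB => //; exact: cvg_cst.
Qed.

(** From index [m] on the weights are at least [W], so the tail of Parseval's sum is at most M /
    W. *)
Lemma norm_le_weighted (w : nat -> R) (W M : R) m h : sqi mu h -> 0 < W ->
  (forall k, 0 <= w k) -> (forall k, (m <= k)%N -> W <= w k) ->
  (forall n, \sum_(0 <= k < n) w k * fcoef h k ^+ 2 <= M) ->
  ip mu h h <= B^-1 * (\sum_(0 <= k < m) fcoef h k ^+ 2 + M / W).
Proof.
move=> sh W0 w0 Ww wM; have hP := Parseval sh.
rewrite -(cvg_lim _ hP)//; apply: limr_le; first by apply/cvg_ex; eexists; exact: hP.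
exists m => // n /= mn; rewrite ler_pM2l ?invr_gt0//.
rewrite (big_cat_nat _ mn)//= lerD2l ler_pdivlMr// mulr_suml.
apply: le_trans (wM n); rewrite [leRHS](big_cat_nat _ mn)//= ler_wpDl//.
  by apply: sumr_ge0 => k _; rewrite mulr_ge0 ?sqr_ge0.
rewrite !big_nat; apply: ler_sum => k /andP[mk _].
by rewrite mulrC ler_wpM2r ?sqr_ge0// Ww.
Qed.

End orthogonal_system.

(** * Compactness of weighted ellipsoids *)

Section ellipsoid.
Context {disp : measure_display} {T : measurableType disp} {R : realType}.
Variable mu : {measure set T -> \bar R}.
Hypothesis mu_fin : (mu setT < +oo)%E.
Variables (e : nat -> T -> R) (B : R).
Hypothesis B_gt0 : 0 < B.
Hypothesis e_sqi : forall n, sqi mu (e n).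
Hypothesis e_orth : forall m n, m != n -> ip mu (e m) (e n) = 0.
Hypothesis e_norm : forall n, ip mu (e n) (e n) = B \/ e n = fun=> 0.
Hypothesis e_complete : forall h, sqi mu h -> (forall n, fcoef mu e h n = 0) ->
  {ae mu, forall x, h x = 0}.
Variables (w : nat -> R) (M : R).
Hypothesis w_ge1 : forall n, 1 <= w n.
Hypothesis w_large : forall W, exists m, forall n, (m <= n)%N -> W <= w n.

(** Each bounded partial sum is a continuous condition on finitely many coefficients, so closedness
    is immediate and no infinite series occurs. *)
Definition ellipsoid : set (L2 mu) :=
  [set h | forall n, \sum_(0 <= k < n) w k * fcoef mu e h k ^+ 2 <= M].

Let c (h : L2 mu) k := fcoef mu e h k.

Let w_ge0 k : 0 <= w k. Proof. exact: le_trans (w_ge1 k). Qed.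

Lemma ellipsoid_coef_le h k : ellipsoid h -> `|c h k| <= M + 1.
Proof.
move=> /(_ k.+1); rewrite big_nat_recr//= => h1.
have s0 : 0 <= \sum_(0 <= i < k) w i * fcoef mu e h i ^+ 2.
  by apply: sumr_ge0 => i _; rewrite mulr_ge0 ?sqr_ge0.
have aE : `|c h k| ^+ 2 = c h k ^+ 2 by rewrite real_normK ?num_real.
have w1 : c h k ^+ 2 <= w k * c h k ^+ 2.
  by rewrite -[leLHS]mul1r ler_wpM2r ?sqr_ge0.
(* 2|c| <= c^2 + 1 turns the bound on the square into one on |c| without a square root. *)
have := sqr_ge0 (`|c h k| - 1); rewrite -/(c h k) in h1.
rewrite sqrrB expr1n mulr1 aE.
by have := normr_ge0 (c h k); lra.
Qed.

(** Since (a - b)^2 <= 2 a^2 + 2 b^2, the difference of two points satisfies the weighted bound with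
    4 M in place of M. *)
Lemma ellipsoid_sqdist W m f g : ellipsoid f -> ellipsoid g -> 0 < W ->
  (forall k, (m <= k)%N -> W <= w k) ->
  sqdist mu f g <= B^-1 * (\sum_(0 <= k < m) (c f k - c g k) ^+ 2 + 4 * M / W).
Proof.
move=> Ef Eg W0 Ww; have [sf sg] := (L2_sqi f, L2_sqi g).
have -> : \sum_(0 <= k < m) (c f k - c g k) ^+ 2 =
    \sum_(0 <= k < m) fcoef mu e (fun x => f x - g x) k ^+ 2.
  by apply: eq_bigr => k _; rewrite fcoefB.
apply: (norm_le_weighted mu_fin _ e_sqi e_orth _ e_complete (w := w)) => //.
  exact: sqiB.
move=> n; apply: (@le_trans _ _ (2 * (\sum_(0 <= k < n) w k * c f k ^+ 2 +
    \sum_(0 <= k < n) w k * c g k ^+ 2))).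
  rewrite -big_split mulr_sumr; apply: ler_sum => k _; rewrite fcoefB// -/(c f k) -/(c g k).
  rewrite /=; have := mulr_ge0 (w_ge0 k) (sqr_ge0 (c f k + c g k)).
  by rewrite sqrrD sqrrB !mulrDr mulrN; lra.
by have := Ef n; have := Eg n; rewrite -/c; lra.
Qed.

Lemma ellipsoid_closed (u : nat -> L2 mu) (l : L2 mu) :
  (forall n, ellipsoid (u n)) ->
  sqdist mu (u n) l @[n --> \oo] --> 0 -> ellipsoid l.
Proof.
move=> Eu ul n.
have cu : \sum_(0 <= k < n) w k * c (u j) k ^+ 2 @[j --> \oo] -->
    \sum_(0 <= k < n) w k * c l k ^+ 2.
  apply: cvg_big => [|k _]; first exact: add_continuous.
  apply: cvgM; first exact: cvg_cst.
  have ck : c (u j) k @[j --> \oo] --> c l k.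
    by apply: cvg_ip => // [j|]; exact: L2_sqi.
  exact: (cvgM ck ck).
rewrite -(cvg_lim _ cu)//; apply: limr_le; first by apply/cvg_ex; eexists; exact: cu.
by apply: nearW => j; exact: Eu.
Qed.

(* Along an ultrafilter each Fourier coefficient converges, and the weights make
   the tails uniformly small, so the ultrafilter has sets of arbitrarily small
   diameter and completeness provides the limit. *)
Lemma ellipsoid_compact : compact ellipsoid.
Proof.
rewrite compact_ultra => U UU UE /=.
have /choice[l lP] k : exists l : R, forall eps, 0 < eps ->
    U [set h | `|c h k - l| <= eps].
  pose G : set_system R := (fun h => c h k) @ U.
  have GP : ProperFilter G by exact: fmap_proper_filter.
  have GS : G (`[- (M + 1), M + 1]%classic : set R).
    have sub : ellipsoid `<=` [set h | c h k \in `[- (M + 1), M + 1]].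
      by move=> h /(ellipsoid_coef_le k); rewrite /= in_itv/= ler_norml.
    exact: (filterS sub UE).
  have [l [_ Ul]] := segment_compact GP GS; exists l => eps eps0.
  have [//|nU] := in_ultra_setVsetC [set h | `|c h k - l| <= eps] UU.
  have [||y [/= h1 h2]] := Ul (~` [set y | `|y - l| <= eps]) (ball l eps).
  - exact: nU.
  - exact: nbhsx_ballx.
  - by case: h1; rewrite distrC ltW.
have small eps : 0 < eps -> exists2 A, U A & forall f g, A f -> A g ->
    sqdist mu f g <= eps.
  (* [W] makes the tail 4 M / W at most half of B eps; [eta] makes the [m] leading squares, each at
     most 4 eta, sum to at most the other half. The summands 1 keep both constants positive. *)
  move=> eps0; pose W := 8 * (`|M| + 1) / (B * eps).
  have W0 : 0 < W by rewrite divr_gt0 ?mulr_gt0//; have := normr_ge0 M; lra.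
  have [m mW] := w_large W.
  pose eta := B * eps / (8 * m.+1%:R).
  have m0 : 0 < m.+1%:R :> R by rewrite ltr0n.
  have eta0 : 0 < eta by rewrite divr_gt0 ?mulr_gt0.
  (* Capping at 1 gives r^2 <= r <= eta. *)
  pose r := Num.min eta 1.
  have r0 : 0 < r by rewrite lt_min eta0/=.
  exists (ellipsoid `&` [set h | forall k : 'I_m, `|c h k - l k| <= r]).
    apply: filterI => //.
    by apply: filter_forall => k; exact: lP.
  move=> f g [Ef fl] [Eg gl].
  apply: le_trans (ellipsoid_sqdist Ef Eg W0 mW) _.
  rewrite ler_pdivrMl//.
  have h1 : \sum_(0 <= k < m) (c f k - c g k) ^+ 2 <= B * eps / 2.
    apply: (@le_trans _ _ (\sum_(0 <= k < m) 4 * eta)).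
      rewrite !big_nat; apply: ler_sum => k /andP[_ km].
      have rr : r ^+ 2 <= eta.
        apply: (@le_trans _ _ r); last by rewrite ge_min lexx.
        by rewrite expr2 ler_piMr ?ge_min ?lexx ?orbT// ltW.
      have := fl (Ordinal km); have := gl (Ordinal km).
      rewrite /= !ler_norml => /andP[g1 g2] /andP[f1 f2].
      have : 0 <= (2 * r - (c f k - c g k)) * (2 * r + (c f k - c g k)).
        by rewrite mulr_ge0//; lra.
      nra.
    rewrite sumr_const_nat subn0 -[_ *+ m]mulr_natr /eta.
    rewrite (_ : 4 * _ * _ = B * eps / 2 * (m%:R / m.+1%:R)); last by field; lra.
    have q1 : m%:R / m.+1%:R <= 1 :> R.
      by rewrite ler_pdivrMr// mul1r ler_nat.
    have b0 : 0 <= B * eps / 2 by rewrite divr_ge0// mulr_ge0// ltW.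
    by rewrite ler_piMr.
  have h2 : 4 * M / W <= B * eps / 2.
    rewrite ler_pdivrMr// (_ : _ * W = 4 * (`|M| + 1)).
      by have := ler_norm M; lra.
    by rewrite /W; field; rewrite !gt_eqF.
  lra.
have /choice[A AP] j : exists A, U A /\ forall f g, A f -> A g ->
    sqdist mu f g <= 2^-1 ^+ j.
  by have [|A UA AP] := small (2^-1 ^+ j); [rewrite exprn_gt0|exists A].
(* [U] need not have a countable base. Points picked from these nested members form a Cauchy
   sequence, and its limit attracts [U] because all of [A j] is close to the later points. *)
pose C j := ellipsoid `&` [set h | forall i : 'I_j.+1, A i h].
have UC j : U (C j).
  by apply: filterI => //; apply: filter_forall => i; exact: (AP i).1.
have /choice[x xP] j : exists x, C j x by exact: filter_ex (UC j).
have xA i j : (i <= j)%N -> A i (x j) by rewrite -ltnS => ij; exact: ((xP j).2 (Ordinal ij)).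
have half_small eps : 0 < eps -> exists j, 2^-1 ^+ j <= eps :> R.
  move=> eps0; have : (2^-1 ^+ n : R) @[n --> \oo] --> 0.
    by apply: cvg_expr; rewrite ger0_norm//; lra.
  move/cvgr0Pnorm_le => /(_ _ eps0)[j _ /(_ j)/= /(_ (leqnn j)) jeps].
  by exists j; apply: le_trans jeps; exact: ler_norm.
have [|l' xl] := @L2_complete _ _ _ _ x mu_fin.
  move=> eps /half_small[j jeps]; exists j => m n jm jn.
  by apply: le_trans jeps; apply: (AP j).2; exact: xA.
exists l'; split; first by apply: ellipsoid_closed xl => j; exact: (xP j).1.
apply/cvg_ballP => eps eps0.
(* Two squared distances of at most [d], doubled by the triangle inequality for squares, add up to
   eps^2 / 2. *)
pose d := eps ^+ 2 / 8.
have d0 : 0 < d by rewrite divr_gt0 ?exprn_gt0.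
have [j jd] := half_small _ d0.
have /sqdist_cvg0P/(_ _ d0)[N NP] := xl.
pose J := maxn j N.
apply: filterS (AP j).1 => h Ah; rewrite ballEmdist /= -[mdist _ _]/(L2_dist _ _).
have h1 := NP J (leq_maxr _ _).
have h2 := (AP j).2 _ _ Ah (xA _ _ (leq_maxl j N)).
have := ip_sqB_le (L2_sqi h) (L2_sqi (x J)) (L2_sqi l').
rewrite -/(sqdist _ _ _) -/(sqdist _ _ _) -/(sqdist _ _ _) {1}/sqdist -L2_dist_sqr L2_dist_sym.
have := L2_dist_ge0 l' h; set D := L2_dist _ _ => D0 Dle.
rewrite ltNge; apply/negP => epsD; rewrite /d in d0 jd h1.
have : D ^+ 2 <= 2 * (eps ^+ 2 / 8 + eps ^+ 2 / 8).
  by apply: le_trans Dle _; rewrite ler_pM2l// lerD// (le_trans h2).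
by nra.
Qed.

End ellipsoid.

(** * Trigonometric functions on the box *)

Section continuous_rV.
Context {R : realType} {d : nat}.

(** An open set is the union of the cubes with rational centre and radius 1/(n+1) that it contains.
    These are countably many, and each is a finite intersection of preimages under coordinates. *)
Lemma open_measurable_rV (U : set 'rV[R]_d) : open U -> measurable U.
Proof.
move=> oU.
pose cube (p : 'rV[rat]_d * nat) : set 'rV[R]_d :=
  \bigcap_(i in [set: 'I_d])
    (rV_coord i @^-1` `]ratr (p.1 ord0 i) - p.2.+1%:R^-1,
                        ratr (p.1 ord0 i) + p.2.+1%:R^-1[%classic).
have mcube p : measurable (cube p).
  apply: fin_bigcap_measurable => // i _.
  by rewrite -[X in measurable X]setTI; apply: measurable_rV_coord.
rewrite (_ : U = \bigcup_(p : 'rV[rat]_d * nat)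
    (if `[< cube p `<=` U >] then cube p else set0)); last first.
  apply/seteqP; split=> [x Ux|x [p _]]; last by case: asboolP => // pU /pU.
  have /nbhs_ballP[e /= e0 xeU] : nbhs x U by exact: open_nbhs_nbhs.
  have [n ne] : exists n, n.+1%:R^-1 *+ 2 < e.
    have /ltr_add_invr[n nP] : (0 : R) < e / 2 by rewrite divr_gt0.
    exists n; rewrite mulr2n; move: nP; rewrite add0r => nP.
    by rewrite [ltRHS]splitr ltrD.
  have : 0 < n.+1%:R^-1 :> R by rewrite invr_gt0 ltr0n.
  move hE : (n.+1%:R^-1) ne => h; rewrite mulr2n => he h0.
  have /choice[q qP] i : exists q : rat,
      ratr q \in `]x ord0 i - h, x ord0 i + h[.
    by apply: rat_in_itvoo; lra.
  have xq : cube (\row_i q i, n) x.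
    move=> j _; rewrite /= /rV_coord mxE in_itv/= hE.
    by have := qP j; rewrite in_itv/= => /andP[? ?]; apply/andP; split; lra.
  exists (\row_i q i, n) => //; case: asboolP => [_|]; first exact: xq.
  case=> y yc; apply: xeU; split=> // i j; rewrite (ord1 i) /ball/= ltr_norml.
  have := yc j I; rewrite /= /rV_coord mxE in_itv/= hE => /andP[? ?].
  have := qP j; rewrite in_itv/= => /andP[? ?].
  by apply/andP; split; lra.
apply: countable_bigcupT_measurable => [|p]; first exact: countableP.
by case: ifP => // _; exact: mcube.
Qed.

Lemma continuous_measurable_rV (f : 'rV[R]_d -> R) :
  continuous f -> measurable_fun setT f.
Proof.
move=> cf; apply: (measurability _ (RGenOpens.measurableE R)).
move=> _ [_ [a [b ->] <-]]; rewrite setTI; apply: open_measurable_rV.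
by move/continuousP : cf; apply; exact: interval_open.
Qed.

End continuous_rV.

Section trigonometric_system.
Context {R : realType} (d : nat) (L : R).
Implicit Types (k : 'rV[int]_d) (x y : 'rV[R]_d).

Definition phase k x : R := pi / L * \sum_i (k ord0 i)%:~R * x ord0 i.

(** For each [k] this two-parameter family is stable under partial derivatives, so its smoothness
    reduces to differentiability. *)
Definition trig (a b : R) k x : R := a * cos (phase k x) + b * sin (phase k x).

Lemma phaseD k x y : phase k (x + y) = phase k x + phase k y.
Proof.
rewrite /phase -mulrDr -big_split; congr (_ * _).
by apply: eq_bigr => i _ /=; rewrite mxE mulrDr.
Qed.

Lemma phaseZ k (a : R) x : phase k (a *: x) = a * phase k x.
Proof.
rewrite /phase mulrCA; congr (_ * _); rewrite mulr_sumr.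
by apply: eq_bigr => i _ /=; rewrite mxE mulrCA.
Qed.

Lemma phase_basis k i : phase k (basis_vec i) = pi / L * (k ord0 i)%:~R.
Proof.
rewrite /phase (bigD1 i)//= big1 ?addr0; first by rewrite mxE !eqxx mulr1.
by move=> j ji; rewrite mxE (negbTE ji) andbF mulr0.
Qed.

Lemma phaseDk k1 k2 x : phase (k1 + k2) x = phase k1 x + phase k2 x.
Proof.
rewrite /phase -mulrDr -big_split; congr (_ * _).
by apply: eq_bigr => i _ /=; rewrite mxE intrD mulrDl.
Qed.

Lemma phaseNk k x : phase (- k) x = - phase k x.
Proof.
rewrite /phase -mulrN -sumrN; congr (_ * _).
by apply: eq_bigr => i _ /=; rewrite mxE mulrNz mulNr.
Qed.

Lemma phase0k x : phase 0 x = 0.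
Proof. by rewrite /phase big1 ?mulr0// => i _; rewrite mxE mul0r. Qed.

Lemma differentiable_phase k x : differentiable (phase k) x.
Proof.
have -> : phase k =
    (pi / L) \*: (\sum_i (fun y : 'rV[R]_d => (k ord0 i)%:~R * y ord0 i)).
  by apply/funext => y; rewrite /phase /= fct_sumE.
apply: differentiableZ; apply: differentiable_sum => i.
have -> : (fun y : 'rV[R]_d => (k ord0 i)%:~R * y ord0 i) =
    (k ord0 i)%:~R \*: (fun y : 'rV[R]_d => y ord0 i) by [].
exact/differentiableZ/differentiable_coord.
Qed.

Lemma continuous_phase k : continuous (phase k).
Proof. by move=> x; exact/differentiable_continuous/differentiable_phase. Qed.

Lemma diff_phase k x : 'd (phase k) x = phase k :> (_ -> _).
Proof.
have lin : linear (phase k) by move=> a u v; rewrite phaseD phaseZ.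
pose F : {linear 'rV[R]_d -> R} := HB.pack (phase k)
  (GRing.isLinear.Build _ _ _ _ (phase k) lin).
by rewrite (_ : phase k = F)// diff_lin//; exact: continuous_phase.
Qed.

Lemma differentiable_comp_phase (f f' : R -> R) k x :
  (forall t : R, is_derive t (1 : R) f (f' t)) -> differentiable (f \o phase k) x.
Proof.
move=> df; apply: differentiable_comp; first exact: differentiable_phase.
by apply/derivable1_diffP; exact: ex_derive.
Qed.

Let cos_phase k x := @differentiable_comp_phase _ _ k x (fun t => is_derive_cos t).
Let sin_phase k x := @differentiable_comp_phase _ _ k x (fun t => is_derive_sin t).

Let trigE a b k : trig a b k = a \*: (cos \o phase k) + b \*: (sin \o phase k).
Proof. by apply/funext. Qed.

Lemma differentiable_trig a b k x : differentiable (trig a b k) x.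
Proof. by rewrite trigE; apply: differentiableD; apply: differentiableZ. Qed.

Lemma derive_comp_phase (f f' : R -> R) k v x :
  (forall t : R, is_derive t (1 : R) f (f' t)) ->
  'D_v (f \o phase k) x = phase k v * f' (phase k x).
Proof.
move=> df; have dfx : differentiable f (phase k x).
  by apply/derivable1_diffP; exact: ex_derive.
rewrite deriveE; last exact: differentiable_comp (differentiable_phase k x) dfx.
rewrite diff_comp//; last exact: differentiable_phase.
rewrite /= diff_phase diff1E// derive1E.
by rewrite (@derive_val _ _ _ _ _ _ _ (df _)).
Qed.

Lemma derive_trig a b k i : 'D_(basis_vec i) (trig a b k) =
  trig (b * (pi / L * (k ord0 i)%:~R)) (- a * (pi / L * (k ord0 i)%:~R)) k.
Proof.
apply/funext => x.
have dc : derivable (cos \o phase k) x (basis_vec i) by exact: diff_derivable.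
have ds : derivable (sin \o phase k) x (basis_vec i) by exact: diff_derivable.
rewrite trigE deriveD; [|exact: derivableZ|exact: derivableZ].
rewrite !deriveZ//.
rewrite (derive_comp_phase _ _ _ (fun t => is_derive_cos t)).
rewrite (derive_comp_phase _ _ _ (fun t => is_derive_sin t)).
by rewrite phase_basis /trig /GRing.scale/=; ring.
Qed.

Lemma smooth_trig a b k : smooth (trig a b k).
Proof.
move=> s; suff [a' [b' ->]] : exists a' b', iter_partial s (trig a b k) = trig a' b' k.
  by move=> x; exact: differentiable_trig.
elim: s => [|i s [a' [b' IH]]]; first by exists a, b.
by rewrite /= IH derive_trig; do 2 eexists.
Qed.

Lemma cosD2pi_int (a : R) (m : int) : cos (a + pi *+ 2 * m%:~R) = cos a.
Proof.
case: m => n; first by rewrite -pmulrn mulr_natr (periodicn (@cosD2pi R)).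
rewrite NegzE mulrNz mulrN -[RHS](periodicn (@cosD2pi R) n.+1) -pmulrn mulr_natr.
by rewrite -[in RHS](subrK (pi *+ 2 *+ n.+1) a) !(periodicn (@cosD2pi R)).
Qed.

Lemma sinD2pi_int (a : R) (m : int) : sin (a + pi *+ 2 * m%:~R) = sin a.
Proof.
case: m => n; first by rewrite -pmulrn mulr_natr (periodicn (@sinD2pi R)).
rewrite NegzE mulrNz mulrN -[RHS](periodicn (@sinD2pi R) n.+1) -pmulrn mulr_natr.
by rewrite -[in RHS](subrK (pi *+ 2 *+ n.+1) a) !(periodicn (@sinD2pi R)).
Qed.

Lemma periodic_trig a b k : L != 0 -> box_periodic L (trig a b k).
Proof.
move=> L0 x i; rewrite /trig phaseD phaseZ phase_basis.
have -> : L *+ 2 * (pi / L * (k ord0 i)%:~R) = pi *+ 2 * (k ord0 i)%:~R.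
  by field.
by rewrite cosD2pi_int sinD2pi_int.
Qed.

Lemma norm_trig_le a b k x : `|trig a b k x| <= `|a| + `|b|.
Proof.
rewrite (le_trans (ler_normD _ _))// !normrM lerD// ler_piMr//.
  exact: cos_max.
exact: sin_max.
Qed.

Lemma measurable_trig a b k : measurable_fun setT (trig a b k).
Proof.
apply: continuous_measurable_rV => x.
exact/differentiable_continuous/differentiable_trig.
Qed.

(* The Hartley kernel cos + sin: over the integer frequencies it forms a real
   orthogonal basis indexed like the complex exponentials. *)
Definition cas : 'rV[int]_d -> 'rV[R]_d -> R := trig 1 1.

Lemma cosE_cas k x : cos (phase k x) = (cas k x + cas (- k) x) / 2.
Proof. by rewrite /cas /trig phaseNk cosN sinN; field. Qed.

Lemma sinE_cas k x : sin (phase k x) = (cas k x - cas (- k) x) / 2.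
Proof. by rewrite /cas /trig phaseNk cosN sinN; field. Qed.

Lemma casM k1 k2 x : cas k1 x * cas k2 x =
  cos (phase (k1 - k2) x) + sin (phase (k1 + k2) x).
Proof.
by rewrite /cas /trig !phaseDk phaseNk cosD sinD cosN sinN; ring.
Qed.

(** cos - sin at [k] is [cas] at [- k]: differentiation permutes the real basis up to factors, which
    is why coefficients of derivatives are read at the opposite frequency. *)
Lemma derive_cas k i x : 'D_(basis_vec i) (cas k) x =
  pi / L * (k ord0 i)%:~R * cas (- k) x.
Proof.
apply: (eq_trans (congr1 (@^~ x) (derive_trig 1 1 k i))).
by rewrite /cas /trig phaseNk cosN sinN; ring.
Qed.

End trigonometric_system.

(** * Integration over the box *)

Section box_integral.
Context {R : realType} (L : R).
Hypothesis L_ge0 : 0 <= L.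

Lemma box_measure_lty n : (box_measure n L [set: 'rV[R]_n] < +oo)%E.
Proof. by rewrite box_measureT// ltry. Qed.

Lemma box_measure_setC n : box_measure n L (~` box n L) = 0%E.
Proof. by rewrite /box_measure/= /mrestr setIC setICr measure0. Qed.

Lemma ae_box n (P : 'rV[R]_n -> Prop) : (forall x, box n L x -> P x) ->
  {ae box_measure n L, forall x, P x}.
Proof.
move=> boxP; exists (~` box n L); split.
- by apply: measurableC; exact: measurable_box.
- exact: box_measure_setC.
- by move=> x /= nPx bx; exact/nPx/boxP.
Qed.

Lemma integral_box n (f : 'rV[R]_n -> \bar R) :
  (box_measure n L).-integrable setT f ->
  (\int[box_measure n L]_x f x = \int[lebesgue_rV n]_(x in box n L) f x)%E.
Proof.
move=> fi; have mB := @measurable_box R n L.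
rewrite (negligible_integral (measurableC mB) measurableT fi); last first.
  exact: box_measure_setC.
rewrite setTD setCK; apply: eq_measure_integral => A mA /setIidPl AB.
by rewrite -[LHS]/(lebesgue_rV n (A `&` box n L)) AB.
Qed.

Let I : set (measurableTypeR R) := `[- L, L[%classic.

(** Fubini's theorem: [lebesgue_rV] is the image under [rV_cons] of a product measure, and the box
    pulls back to a product. Restricting both factors by zero moves the domain into the integrand;
    the bound [C] supplies integrability. *)
Lemma Rintegral_box_cons n (F : measurableTypeR R -> R) (G : 'rV[R]_n -> R) (C : R) :
  measurable_fun setT F -> measurable_fun setT G ->
  (forall t, `|F t| <= C) -> (forall x, `|G x| <= C) ->
  \int[box_measure n.+1 L]_x (F (x ord0 ord0) * G (\row_j x ord0 (lift ord0 j))) =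
  (\int[lebesgue_measure]_(t in I) F t) * \int[box_measure n L]_x G x.
Proof.
move=> mF mG FC GC.
have C0 : 0 <= C := le_trans (normr_ge0 _) (FC 0).
pose H (x : 'rV[R]_n.+1) := F (rV_uncons x).1 * G (rV_uncons x).2.
have mH : measurable_fun setT H.
  apply: measurable_funM.
    by apply: (measurableT_comp mF); apply: measurableT_comp (@measurable_rV_uncons R n).
  by apply: (measurableT_comp mG); apply: measurableT_comp (@measurable_rV_uncons R n).
have HC x : `|H x| <= C * C by rewrite normrM ler_pM.
pose f (z : measurableTypeR R * 'rV[R]_n) := ((F \_ I) z.1 * (G \_ (box n L)) z.2)%:E.
have mI : measurable I by exact: measurable_itv.
have mB := @measurable_box R n L.
have mFI : measurable_fun setT (F \_ I).
  by apply/(measurable_restrictT _ _).1 => //; exact: measurable_funTS.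
have mGB : measurable_fun setT (G \_ (box n L)).
  by apply/(measurable_restrictT _ _).1 => //; exact: measurable_funTS.
have mf : measurable_fun setT f.
  apply/measurable_EFinP/measurable_funM.
    exact: measurableT_comp mFI measurable_fst.
  exact: measurableT_comp mGB measurable_snd.
have iG : (lebesgue_rV n).-integrable setT (EFin \o (G \_ (box n L))).
  rewrite -restrict_EFin; apply: (integrable_mkcond _ mB).1.
  apply: (@integrable_bounded_on _ _ _ _ _ _ C) => //; first exact: measurable_funTS.
  by have := box_measure_lty n; rewrite /box_measure/= /mrestr setTI.
have iF : lebesgue_measure.-integrable setT (EFin \o (F \_ I)).
  rewrite -restrict_EFin; apply: (integrable_mkcond _ mI).1.
  apply: (@integrable_bounded_on _ _ _ _ _ _ C) => //; first exact: measurable_funTS.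
  suff : (lebesgue_measure I < +oo)%E by [].
  by rewrite lebesgue_measure_itv/=; case: ifP => _; rewrite -?EFinB ltry.
have fubE a : (\int[lebesgue_rV n]_y f (a, y) =
    ((F \_ I) a)%:E * \int[lebesgue_rV n]_y ((G \_ (box n L)) y)%:E)%E.
  by rewrite /f/=; under eq_integral do rewrite EFinM; exact: (integralZl measurableT iG).
have fi : (lebesgue_measure \x lebesgue_rV n)%E.-integrable setT f.
  apply/integrable12ltyP => //.
  pose K : \bar R := (\int[lebesgue_rV n]_y `|((G \_ (box n L)) y)%:E|)%E.
  have K0 : (0 <= K)%E by exact: integral_ge0.
  have Kfin : K \is a fin_num.
    by rewrite ge0_fin_numE//; have /integrableP[] := iG.
  have KE a : (\int[lebesgue_rV n]_y `|f (a, y)| = `|((F \_ I) a)%:E| * K)%E.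
    rewrite /K; under eq_integral do rewrite /f EFinM abseM.
    rewrite -ge0_integralZl//.
    by apply: measurableT_comp => //; exact/measurable_EFinP.
  under eq_integral do rewrite KE.
  have /integrableP[_ Ffin] := iF.
  rewrite -(fineK Kfin) ge0_integralZr//; last 2 first.
  - by apply: measurableT_comp => //; exact/measurable_EFinP.
  - by rewrite lee_fin fine_ge0.
  apply: lte_mul_pinfty; [exact: integral_ge0| |exact: ltry].
  by rewrite ge0_fin_numE//; exact: integral_ge0.
have -> : \int[box_measure n.+1 L]_x
    (F (x ord0 ord0) * G (\row_j x ord0 (lift ord0 j))) =
    fine (\int[box_measure n.+1 L]_x (H x)%:E) by [].
rewrite integral_box; last first.
  exact: (integrable_bounded (box_measure_lty n.+1) mH HC).
rewrite [X in fine X](_ : _ =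
    \int[(lebesgue_measure \x lebesgue_rV n)%E]_z f z)%E; last first.
  have pre : @rV_cons R n @^-1` box n.+1 L = I `*` box n L.
    apply/seteqP; split=> -[a y] /=.
      move=> h; split=> [|i]; first by rewrite /I/= in_itv/=; have := h ord0; rewrite mxE unlift_none.
      by have := h (lift ord0 i); rewrite mxE liftK.
    rewrite /I/= in_itv/= => -[aI yb] i; rewrite mxE.
    by case: unliftP => [j|] _; [exact: yb|exact: aI].
  have fH : f = ((EFin \o H) \o @rV_cons R n) \_ (I `*` box n L).
    apply/funext => -[a y]; rewrite /f /patch /= in_setX /= /H rV_consK /=.
    by case: (a \in I); case: (y \in box n L) => /=; rewrite ?mul0r ?mulr0.
  have mEH : measurable_fun setT (EFin \o H) by exact/measurable_EFinP.
  have iH : (lebesgue_measure \x lebesgue_rV n)%E.-integrable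
      (@rV_cons R n @^-1` box n.+1 L) ((EFin \o H) \o @rV_cons R n).
    by rewrite pre; apply: (integrable_mkcond _ (measurableX mI mB)).2; rewrite -fH.
  have := integral_pushforward (@measurable_rV_cons R n) mEH iH (@measurable_box R n.+1 L).
  by rewrite pre [RHS]integral_mkcond -fH; apply.
rewrite -integral12_prod_meas1//.
under eq_integral do rewrite /fubini_F fubE.
rewrite -(fineK (integrable_fin_num measurableT iG)) integralZr//.
rewrite fineM//; last exact: integrable_fin_num.
rewrite /Rintegral; congr (fine _ * fine _); last first.
  rewrite integral_box; last exact: (integrable_bounded (box_measure_lty n) mG GC).
  rewrite fineK; last exact: integrable_fin_num iG.
  rewrite [RHS]integral_mkcond; apply: eq_integral => x _.
  by rewrite /patch /=; case: ifP.
rewrite [RHS]integral_mkcond; apply: eq_integral => x _.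
by rewrite /patch /=; case: ifP.
Qed.

End box_integral.

(** * Orthogonality of the Hartley system *)

Section orthogonality.
Context {R : realType} (L : R).
Hypothesis L_gt0 : 0 < L.

Let I : set (measurableTypeR R) := `[- L, L[%classic.

Lemma Rintegral_derive_period (f F : R -> R) : continuous f ->
  (forall t : R, is_derive t (1 : R) F (f t)) -> F L = F (- L) ->
  \int[lebesgue_measure]_(t in I) f t = 0.
Proof.
move=> cf dF FL; have NL : - L < L by rewrite gtrN.
have cF : continuous F.
  move=> t; apply: differentiable_continuous; apply/derivable1_diffP.
  by have := dF t => -[].
rewrite /Rintegral integral_itv_bndo_bndc; last first.
  by apply/measurable_EFinP/measurable_funTS; exact: continuous_measurable_fun.
rewrite (continuous_FTC2 NL (F := F)) ?FL ?subrr//.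
- by rewrite -EFinB subrr.
- exact: continuous_subspaceT.
- split=> [x _||].
  + by have := dF x => -[].
  + exact: cvg_at_right_filter (cF _).
  + exact: cvg_at_left_filter (cF _).
- by move=> x _; rewrite derive1E; have := dF x => -[].
Qed.

Lemma is_derive_comp_lin (f f' : R -> R) (a b c t : R) :
  (forall y : R, is_derive y (1 : R) f (f' y)) ->
  is_derive t (1 : R) (fun t => a * f (b * (c * t)))
    (a * (f' (b * (c * t)) * (b * c))).
Proof.
move=> df.
have dl : is_derive t (1 : R) (fun t : R => b * (c * t)) (b * c).
  have -> : (fun t : R => b * (c * t)) = (b * c) \*: (id : R -> R).
    by apply/funext => y /=; rewrite mulrA.
  by apply: is_derive_eq; rewrite /GRing.scale/= mulr1.
exact: (is_deriveZ a (@is_derive1_comp _ f (fun t => b * (c * t)) t _ _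
  (df (b * (c * t))) dl)).
Qed.

Lemma Rintegral_cos_period (m : int) : m != 0 ->
  \int[lebesgue_measure]_(t in I) cos (pi / L * (m%:~R * t)) = 0.
Proof.
move=> m0; have mR : m%:~R != 0 :> R by rewrite intr_eq0.
have p0 : pi != 0 :> R by rewrite gt_eqF ?pi_gt0.
have L0 : L != 0 by rewrite gt_eqF.
pose c := pi / L * m%:~R.
have c0 : c != 0 by rewrite !mulf_neq0 ?invr_neq0.
apply: (@Rintegral_derive_period _ (fun t => c^-1 * sin (pi / L * (m%:~R * t)))).
- move=> t; apply: continuous_comp; last exact: continuous_cos.
  by apply: cvgM; [exact: cvg_cst|apply: cvgM; [exact: cvg_cst|exact: cvg_id]].
- move=> t; apply: is_derive_eq (is_derive_comp_lin _ _ _ _ (fun y => is_derive_sin y)) _.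
  by rewrite -/c mulrCA mulVf ?mulr1.
- congr (_ * _); rewrite -[RHS](sinD2pi_int _ m); congr sin.
  by field.
Qed.

Lemma Rintegral_sin_period (m : int) : m != 0 ->
  \int[lebesgue_measure]_(t in I) sin (pi / L * (m%:~R * t)) = 0.
Proof.
move=> m0; have mR : m%:~R != 0 :> R by rewrite intr_eq0.
have p0 : pi != 0 :> R by rewrite gt_eqF ?pi_gt0.
have L0 : L != 0 by rewrite gt_eqF.
pose c := pi / L * m%:~R.
have c0 : c != 0 by rewrite !mulf_neq0 ?invr_neq0.
apply: (@Rintegral_derive_period _ (fun t => - c^-1 * cos (pi / L * (m%:~R * t)))).
- move=> t; apply: continuous_comp; last exact: continuous_sin.
  by apply: cvgM; [exact: cvg_cst|apply: cvgM; [exact: cvg_cst|exact: cvg_id]].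
- move=> t; apply: is_derive_eq (is_derive_comp_lin _ _ _ _ (fun y => is_derive_cos y)) _.
  by rewrite -/c !mulNr mulrN opprK mulrCA mulVf ?mulr1.
- congr (_ * _); rewrite -[RHS](cosD2pi_int _ m); congr cos.
  by field.
Qed.

Lemma phase_cons n (k : 'rV[int]_n.+1) (x : 'rV[R]_n.+1) : phase L k x =
  pi / L * ((k ord0 ord0)%:~R * x ord0 ord0) +
  phase L (\row_j k ord0 (lift ord0 j)) (\row_j x ord0 (lift ord0 j)).
Proof.
rewrite /phase big_ord_recl mulrDr; congr (_ + _ * _).
by apply: eq_bigr => i _; rewrite !mxE.
Qed.

(** Induction on the dimension. The addition formulas split off the first coordinate and mix cosine
    with sine, hence the joint statement. In each product the first factor integrates to 0 if its
    frequency is nonzero, the second one otherwise. *)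
Lemma trig_mean n (k : 'rV[int]_n) : k != 0 ->
  \int[box_measure n L]_x cos (phase L k x) = 0 /\
  \int[box_measure n L]_x sin (phase L k x) = 0.
Proof.
elim: n k => [k|n IH k k0]; first by rewrite (thinmx0 k) eqxx.
have L0 := ltW L_gt0.
set k' : 'rV[int]_n := \row_j k ord0 (lift ord0 j).
pose c0 (t : measurableTypeR R) := cos (pi / L * ((k ord0 ord0)%:~R * t)).
pose s0 (t : measurableTypeR R) := sin (pi / L * ((k ord0 ord0)%:~R * t)).
pose c1 x := cos (phase L k' x).
pose s1 x := sin (phase L k' x).
have lin_cont (a b : R) : continuous (fun t : R => a * (b * t)).
  by move=> t; apply: cvgM; [exact: cvg_cst|apply: cvgM; [exact: cvg_cst|exact: cvg_id]].
have mc0 : measurable_fun setT c0.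
  apply: continuous_measurable_fun => t.
  by apply: continuous_comp; [exact: lin_cont|exact: continuous_cos].
have ms0 : measurable_fun setT s0.
  apply: continuous_measurable_fun => t.
  by apply: continuous_comp; [exact: lin_cont|exact: continuous_sin].
have mc1 : measurable_fun setT c1.
  apply: continuous_measurable_rV => x.
  by apply: continuous_comp; [exact: continuous_phase|exact: continuous_cos].
have ms1 : measurable_fun setT s1.
  apply: continuous_measurable_rV => x.
  by apply: continuous_comp; [exact: continuous_phase|exact: continuous_sin].
have bc t := @cos_max R t; have bs t := @sin_max R t.
have prodE (F : measurableTypeR R -> R) (G : 'rV[R]_n -> R) :
    measurable_fun setT F -> measurable_fun setT G ->
    (forall t, `|F t| <= 1) -> (forall x, `|G x| <= 1) ->
    F = c0 \/ F = s0 -> G = c1 \/ G = s1 ->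
    (box_measure n.+1 L).-integrable setT (EFin \o
      (fun x => F (x ord0 ord0) * G (\row_j x ord0 (lift ord0 j)))) /\
    \int[box_measure n.+1 L]_x
      (F (x ord0 ord0) * G (\row_j x ord0 (lift ord0 j))) = 0.
  move=> mF mG F1 G1 FE GE; split.
    apply: (@integrable_bounded _ _ _ _ (box_measure_lty L0 n.+1) _ 1).
      apply: measurable_funM.
        exact: (measurableT_comp mF (measurable_rV_coord ord0)).
      apply: (measurableT_comp mG); apply: measurable_fun_rVP => i.
      rewrite (_ : _ \o _ = rV_coord (lift ord0 i)); first exact: measurable_rV_coord.
      by apply/funext => x /=; rewrite /rV_coord mxE.
    by move=> x; rewrite normrM mulr_ile1.
  rewrite (Rintegral_box_cons L0 mF mG F1 G1).
  have [k00|k00] := eqVneq (k ord0 ord0) 0; last first.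
    case: FE => ->; first by rewrite Rintegral_cos_period ?mul0r.
    by rewrite Rintegral_sin_period ?mul0r.
  have k'0 : k' != 0.
    apply: contraNneq k0 => k'0; apply/eqP/rowP => i; rewrite mxE.
    case: (unliftP ord0 i) => [j|] ->; last exact: k00.
    by have /rowP/(_ j) := k'0; rewrite !mxE.
  by have [I1 I2] := IH _ k'0; case: GE => ->; rewrite ?I1 ?I2 mulr0.
have [cci ccE] := prodE c0 c1 mc0 mc1 (fun=> bc _) (fun=> bc _) (or_introl erefl) (or_introl erefl).
have [ssi ssE] := prodE s0 s1 ms0 ms1 (fun=> bs _) (fun=> bs _) (or_intror erefl) (or_intror erefl).
have [csi csE] := prodE c0 s1 mc0 ms1 (fun=> bc _) (fun=> bs _) (or_introl erefl) (or_intror erefl).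
have [sci scE] := prodE s0 c1 ms0 mc1 (fun=> bs _) (fun=> bc _) (or_intror erefl) (or_introl erefl).
split.
- rewrite (eq_Rintegral _ (g := fun x : 'rV[R]_n.+1 => c0 (x ord0 ord0) * c1 (\row_j x ord0 (lift ord0 j)) -
    s0 (x ord0 ord0) * s1 (\row_j x ord0 (lift ord0 j)))).
    by rewrite RintegralB// ccE ssE subrr.
  by move=> x _; rewrite phase_cons cosD.
- rewrite (eq_Rintegral _ (g := fun x : 'rV[R]_n.+1 => s0 (x ord0 ord0) * c1 (\row_j x ord0 (lift ord0 j)) +
    c0 (x ord0 ord0) * s1 (\row_j x ord0 (lift ord0 j)))).
    by rewrite RintegralD// csE scE addr0.
  by move=> x _; rewrite phase_cons sinD.
Qed.

Variable d : nat.

Lemma cas_bounded (k : 'rV[int]_d) x : `|cas L k x| <= 2.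
Proof. by apply: le_trans (norm_trig_le _ _ _ _ _) _; rewrite normr1. Qed.

Lemma cas_sqi (k : 'rV[int]_d) : sqi (box_measure d L) (cas L k).
Proof.
apply: (sqi_bounded (box_measure_lty (ltW L_gt0) d) (measurable_trig L 1 1 k)).
exact: cas_bounded.
Qed.

(** [casM] turns the product into a sine, of mean 0 at every frequency, plus a cosine of frequency
    k1 - k2, of mean 0 unless k1 = k2. *)
Lemma ip_cas (k1 k2 : 'rV[int]_d) :
  ip (box_measure d L) (cas L k1) (cas L k2) = if k1 == k2 then (L *+ 2) ^+ d else 0.
Proof.
have L0 := ltW L_gt0; have fin := box_measure_lty L0 d.
have ic k : (box_measure d L).-integrable setT (EFin \o (fun x => cos (phase L k x))).
  apply: (integrable_bounded fin (C := 1)) => [|x]; last exact: cos_max.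
  apply: continuous_measurable_rV => x.
  by apply: continuous_comp; [exact: continuous_phase|exact: continuous_cos].
have iS k : (box_measure d L).-integrable setT (EFin \o (fun x => sin (phase L k x))).
  apply: (integrable_bounded fin (C := 1)) => [|x]; last exact: sin_max.
  apply: continuous_measurable_rV => x.
  by apply: continuous_comp; [exact: continuous_phase|exact: continuous_sin].
have sin0 k : \int[box_measure d L]_x sin (phase L k x) = 0.
  have [->|/trig_mean[]//] := eqVneq k 0.
  rewrite (eq_Rintegral _ (g := fun=> 0)); first by rewrite Rintegral_cst// mul0r.
  by move=> x _; rewrite phase0k sin0.
rewrite /ip (eq_Rintegral _ (g := fun x => cos (phase L (k1 - k2) x) + sin (phase L (k1 + k2) x))); last first.
  by move=> x _; rewrite casM.
rewrite RintegralD// sin0 addr0.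
case: eqP => [->|/eqP k12]; last by have [] := trig_mean (_ : k1 - k2 != 0); rewrite ?subr_eq0.
rewrite subrr (eq_Rintegral _ (g := fun=> 1)); last first.
  by move=> x _; rewrite phase0k cos0.
by rewrite Rintegral_cst// mul1r -[RHS]/(fine ((L *+ 2) ^+ d)%:E) -box_measureT.
Qed.

End orthogonality.

(** * Completeness of the Hartley system *)

Section multiplicative_class.
Context {disp : measure_display} {T : measurableType disp} {R : realType}.
Variable mu : {measure set T -> \bar R}.
Hypothesis mu_fin : (mu setT < +oo)%E.
Variables (h : T -> R) (E : set (T -> R)).
Hypothesis h_sqi : sqi mu h.

Definition bmeas (f : T -> R) : Prop :=
  measurable_fun setT f /\ exists C, forall x, `|f x| <= C.

(* [annih_mul] is a unital algebra, closed under bounded almost everywhere limits,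
   of functions that [h] annihilates; hence the sets whose indicator it contains
   form a sigma-algebra. *)
Definition annih : set (T -> R) :=
  [set f | bmeas f /\ forall e, E e -> ip mu h (fun x => f x * e x) = 0].

Definition annih_mul : set (T -> R) :=
  [set f | bmeas f /\ forall g, annih g -> annih (fun x => f x * g x)].

Hypothesis E_bmeas : forall e, E e -> bmeas e.
Hypothesis E_one : E (fun=> 1).
Hypothesis E_annih : forall e, E e -> ip mu h e = 0.

Lemma bmeas_sqi f : bmeas f -> sqi mu f.
Proof. by move=> [mf [C fC]]; exact: sqi_bounded fC. Qed.

Lemma bmeasM f g : bmeas f -> bmeas g -> bmeas (fun x => f x * g x).
Proof.
move=> [mf [C fC]] [mg [D gD]]; split; first exact: measurable_funM.
by exists (C * D) => x; rewrite normrM ler_pM.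
Qed.

Lemma bmeasD f g : bmeas f -> bmeas g -> bmeas (fun x => f x + g x).
Proof.
move=> [mf [C fC]] [mg [D gD]]; split; first exact: measurable_funD.
by exists (C + D) => x; rewrite (le_trans (ler_normD _ _))// lerD.
Qed.

Lemma bmeas_cst (a : R) : bmeas (fun=> a).
Proof. by split=> //; exists `|a|. Qed.

Lemma annihD f g : annih f -> annih g -> annih (fun x => f x + g x).
Proof.
move=> [bf fE] [bg gE]; split=> [|e Ee]; first exact: bmeasD.
under eq_fun do rewrite mulrDl.
have [sf sg] := (bmeas_sqi (bmeasM bf (E_bmeas Ee)), bmeas_sqi (bmeasM bg (E_bmeas Ee))).
by rewrite ipC ipDl// !(ipC mu _ h) fE// gE// addr0.
Qed.

Lemma annihZ (a : R) f : annih f -> annih (fun x => a * f x).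
Proof.
move=> [bf fE]; split=> [|e Ee]; first exact/bmeasM/bf/bmeas_cst.
under eq_fun do rewrite -mulrA.
by rewrite ipC ipZl ?(ipC mu _ h) ?fE ?mulr0//; exact: bmeas_sqi (bmeasM bf (E_bmeas Ee)).
Qed.

Lemma annih1 : annih (fun=> 1).
Proof.
split=> [|e Ee]; first exact: bmeas_cst.
by under eq_fun do rewrite mul1r; exact: E_annih.
Qed.

Lemma annih_lim (f_ : nat -> T -> R) (f : T -> R) (C : R) : (forall n, annih (f_ n)) ->
  (forall n x, `|f_ n x| <= C) -> bmeas f ->
  {ae mu, forall x, f_ n x @[n --> \oo] --> f x} -> annih f.
Proof.
move=> Nf fC bf ff; split=> // e Ee.
have [me [D eD]] := E_bmeas Ee; have [mh _] := h_sqi; have [mf _] := bf.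
have mfn n : measurable_fun setT (f_ n) by have [[]] := Nf n.
have := @dominated_convergence _ _ _ mu setT measurableT
  (fun n x => (h x * (f_ n x * e x))%:E) (fun x => (h x * (f x * e x))%:E)
  (fun x => (C * D * `|h x|)%:E).
case.
- by move=> n; apply/measurable_EFinP; do 2 apply: measurable_funM => //.
- by apply/measurable_EFinP; do 2 apply: measurable_funM => //.
- apply: filterS ff => x fx _; apply: cvg_EFin; first exact: nearW.
  by apply: cvgM; [exact: cvg_cst|apply: cvgM => //; exact: cvg_cst].
- apply: eq_integrable (integrableZl measurableT (C * D)
    (integrable_abse (sqi_integrable mu_fin h_sqi))) => //.
- apply: nearW => x n _ /=; rewrite lee_fin !normrM mulrC ler_wpM2r//.
  by rewrite ler_pM.
move=> _ _; rewrite (_ : (fun n => _) = fun=> 0%E) => [/cvg_lim h0|].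
  by rewrite /ip /Rintegral -h0// lim_cst.
apply/funext => n; have := (Nf n).2 _ Ee; rewrite /ip /Rintegral => fE.
rewrite -[LHS]fineK ?fE//; apply: integrable_fin_num => //.
apply: sqi_mulr_integrable => //; apply: bmeas_sqi; apply: bmeasM (E_bmeas Ee).
by have [] := Nf n.
Qed.

Lemma annih_mul_annih f : annih_mul f -> annih f.
Proof.
by move=> [bf fN]; have := fN _ annih1; under eq_fun do rewrite mulr1.
Qed.

Lemma annih_mulM f g : annih_mul f -> annih_mul g -> annih_mul (fun x => f x * g x).
Proof.
move=> [bf fN] [bg gN]; split=> [|u Nu]; first exact: bmeasM.
by under eq_fun do rewrite -mulrA; exact/fN/gN.
Qed.

Lemma annih_mulD f g : annih_mul f -> annih_mul g -> annih_mul (fun x => f x + g x).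
Proof.
move=> [bf fN] [bg gN]; split=> [|u Nu]; first exact: bmeasD.
by under eq_fun do rewrite mulrDl; exact: annihD (fN _ Nu) (gN _ Nu).
Qed.

Lemma annih_mul_cst (a : R) : annih_mul (fun=> a).
Proof. by split=> [|u Nu]; [exact: bmeas_cst|exact: annihZ]. Qed.

Lemma annih_mul_lim (f_ : nat -> T -> R) (f : T -> R) (C : R) : (forall n, annih_mul (f_ n)) ->
  (forall n x, `|f_ n x| <= C) -> measurable_fun setT f -> (forall x, `|f x| <= C) ->
  {ae mu, forall x, f_ n x @[n --> \oo] --> f x} -> annih_mul f.
Proof.
move=> Mf fC mf fC' ff.
have bf : bmeas f by split=> //; exists C.
split=> // u Nu; have [[mu' [D uD]] _] := Nu.
apply: (@annih_lim (fun n x => f_ n x * u x) _ (C * D)).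
- by move=> n; exact: (Mf n).2.
- by move=> n x; rewrite normrM ler_pM.
- exact: bmeasM (Nu.1).
- by apply: filterS ff => x fx; apply: cvgM => //; exact: cvg_cst.
Qed.

(** As [f] is bounded by [C], the partial sums of the exponential series are polynomials in [f]
    bounded by [expR C], so they pass to the limit. *)
Lemma annih_mul_exp f : annih_mul f -> annih_mul (fun x => expR (f x)).
Proof.
move=> Mf; have [[mf [C fC]] _] := Mf.
have Mpow n : annih_mul (fun x => f x ^+ n).
  elim: n => [|n IH]; first exact: annih_mul_cst.
  by under eq_fun do rewrite exprS; exact: annih_mulM.
have Msum n : annih_mul (fun x => series (exp_coeff (f x)) n).
  elim: n => [|n IH].
    by under eq_fun do rewrite /series/= big_nil; exact: annih_mul_cst.
  under eq_fun do rewrite seriesSr.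
  apply: annih_mulD => //; under eq_fun do rewrite /exp_coeff/= mulrC.
  exact: annih_mulM (annih_mul_cst _) (Mpow n).
have expC x n : `|series (exp_coeff (f x)) n| <= expR C.
  apply: (@le_trans _ _ (series (exp_coeff C) n)).
    rewrite /series/=; apply: le_trans (ler_norm_sum _ _ _) _; apply: ler_sum => i _.
    rewrite /exp_coeff/= normrM normrX [X in _ * X <= _]ger0_norm ?invr_ge0//.
    by rewrite ler_wpM2r ?invr_ge0// lerXn2r ?nnegrE// (le_trans (normr_ge0 _) (fC x)).
  apply: nondecreasing_cvgn_le; last exact: is_cvg_series_exp_coeff.
  apply: nondecreasing_series => i _ _.
  by rewrite /exp_coeff/= divr_ge0// exprn_ge0// (le_trans (normr_ge0 _) (fC x)).
apply: (@annih_mul_lim _ _ (expR C) Msum) => //.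
- exact: measurableT_comp.
- move=> x; rewrite ger0_norm ?expR_ge0// ler_expR.
  exact: le_trans (ler_norm _) (fC x).
- by apply: nearW => x; exact: is_cvg_series_exp_coeff.
Qed.

(** Sums, products, exponentials and bounded limits are the operations at hand, whence the double
    exponential as an approximate step function. *)
Lemma annih_mul_gt0 f : annih_mul f -> annih_mul \1_[set x | 0 < f x].
Proof.
move=> Mf; have [[mf _] _] := Mf.
(* [g n] tends to 1 where [f > 0] and to 0 elsewhere, and stays in [0, 1]. *)
pose g n x := expR (- expR (n%:R - n%:R ^+ 2 * f x)).
have Mg n : annih_mul (g n).
  have MN u : annih_mul u -> annih_mul (fun x => - u x).
    move=> Mu; under eq_fun do rewrite -mulN1r.
    exact: annih_mulM (annih_mul_cst _) Mu.
  apply/annih_mul_exp/MN/annih_mul_exp/annih_mulD; first exact: annih_mul_cst.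
  by apply/MN/annih_mulM => //; exact: annih_mul_cst.
apply: (@annih_mul_lim g _ 1 Mg).
- by move=> n x; rewrite ger0_norm ?expR_ge0// -expR0 ler_expR oppr_le0 expR_ge0.
- apply: measurable_indic; rewrite -[X in measurable X]setTI.
  rewrite (_ : [set x | 0 < f x] = f @^-1` `]0, +oo[%classic); first exact: mf.
  by apply/seteqP; split=> x /=; rewrite in_itv/= andbT.
- by move=> x; rewrite indicE; case: (_ \in _); rewrite ?normr1 ?normr0.
- have expN (n : nat) y : n%:R <= y -> expR (- y) <= harmonic n :> R.
    move=> ny; rewrite expRN /harmonic/= lef_pV2 ?posrE ?expR_gt0//.
    by apply: le_trans (expR_ge1Dx y); rewrite -natr1 addrC lerD2l.
  apply: nearW => x; rewrite indicE; case: (ltP 0 (f x)) => fx.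
  + rewrite mem_set//= -[X in _ --> X]expR0 -[X in expR X]oppr0.
    have ch : continuous (fun y : R => expR (- y)).
      by move=> y; apply: continuous_comp; [exact: opp_continuous|exact: continuous_expR].
    apply: (@cvg_comp _ _ _ (fun n : nat => expR (n%:R - n%:R ^+ 2 * f x))
      (fun y => expR (- y)) _ (nbhs (0 : R))); last exact: ch.
    apply: (@squeeze_cvgr _ _ _ _ (fun=> 0) harmonic); [|exact: cvg_cst|exact: cvg_harmonic].
    (* Once n f >= 2, the inner exponent n - n^2 f is at most -n. Where f <= 0 it is at least n, and
       the linear term ensures this at f = 0 too. *)
    have [N _ NP] := nbhs_infty_ger (2 / f x : R).
    exists N => // n /NP /=; rewrite ler_pdivrMr// => fn.
    rewrite expR_ge0/= -[X in expR X]opprK; apply: expN.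
    by rewrite opprB; have := ler0n R n; nra.
  + rewrite memNset/=; last by apply/negP; rewrite -leNgt.
    apply: (@squeeze_cvgr _ _ _ _ (fun=> 0) harmonic); [|exact: cvg_cst|exact: cvg_harmonic].
    apply: nearW => n; rewrite expR_ge0/=; apply: expN.
    apply: le_trans (expR_ge1Dx _).
    by have := ler0n R n; nra.
Qed.

Lemma annih_mul_sigma_algebra :
  sigma_algebra setT [set A | measurable A /\ annih_mul (\1_A : T -> R)].
Proof.
split.
- by split=> //; rewrite indic0; exact: annih_mul_cst.
- move=> A [mA MA]; rewrite setTD; split; first exact: measurableC.
  rewrite (_ : \1_(~` A) = fun x => 1 + -1 * \1_A x).
    by apply: annih_mulD; [exact: annih_mul_cst|apply: annih_mulM => //; exact: annih_mul_cst].
  by apply/funext => x; rewrite !indicE in_setC; case: (x \in A) => /=; lra.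
- move=> F MF; have mU : measurable (\bigcup_i F i).
    by apply: bigcupT_measurable => i; exact: (MF i).1.
  split=> //.
  (* The indicator of the union of the first [n] sets, written with the algebra operations. *)
  pose g n x := 1 + -1 * \prod_(i < n) (1 + -1 * \1_(F i) x) : R.
  apply: (@annih_mul_lim g _ 1).
  + move=> n; apply: annih_mulD; first exact: annih_mul_cst.
    apply: annih_mulM; first exact: annih_mul_cst.
    elim: n => [|n IH].
      by under eq_fun do rewrite big_ord0; exact: annih_mul_cst.
    under eq_fun do rewrite big_ord_recr/=; apply: annih_mulM => //.
    apply: annih_mulD; first exact: annih_mul_cst.
    by apply: annih_mulM; [exact: annih_mul_cst|exact: (MF n).2].
  + move=> n x; rewrite /g; set p := \prod_(i < n) _.
    have : 0 <= p <= 1.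
      rewrite /p; apply: (big_ind (fun y => 0 <= y <= 1)) => [|a b|i _].
      * by rewrite ler01 lexx.
      * by move=> /andP[? ?] /andP[? ?]; rewrite mulr_ge0// mulr_ile1.
      * by rewrite indicE; case: (_ \in _) => /=; lra.
    by move=> /andP[? ?]; rewrite ger0_norm; lra.
  + exact: measurable_indic.
  + by move=> x; rewrite indicE; case: (_ \in _); rewrite ?normr1 ?normr0.
  + apply: nearW => x; apply: cvg_near_cst; rewrite indicE.
    have [/set_mem[j _ Fj]|xF] := boolP (x \in _).
      exists j.+1 => // n /= jn; have p0 : \prod_(i < n) (1 + -1 * \1_(F i) x) = 0 :> R.
        by rewrite (bigD1 (Ordinal jn))//= indicE mem_set//= mulN1r subrr mul0r.
      by rewrite /g p0 mulr0 addr0.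
    apply: nearW => n; rewrite /g big1 ?mulr1 ?subrr// => i _.
    rewrite indicE memNset ?mulr0 ?addr0// => Fi.
    by move/negP : xF; apply; apply/mem_set; exists i.
Qed.

(** Pairing an indicator with the constant 1 of [E] shows that [h] has integral 0 over every
    measurable set. *)
Lemma annih_eq0 :
  measurable `<=` [set A | measurable A /\ annih_mul (\1_A : T -> R)] ->
  {ae mu, forall x, h x = 0}.
Proof.
move=> GA.
have : ae_eq mu setT (EFin \o h) (cst 0%E).
  apply: integral_ae_eq => //; first exact: sqi_integrable.
  move=> A _ mA; have [_ /annih_mul_annih[_ /(_ _ E_one)]] := GA A mA.
  move=> h0; rewrite integral0 integral_mkcond.
  rewrite (_ : (fun x => _) = (fun x => (h x * (\1_A x * 1))%:E)); last first.
    apply/funext => x; rewrite /patch indicE mulr1.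
    by case: (x \in A); rewrite ?mulr1 ?mulr0.
  move: h0; rewrite /ip /Rintegral => h0; rewrite -[LHS]fineK ?h0//.
  apply: integrable_fin_num => //; apply: sqi_mulr_integrable => //.
  by apply: bmeas_sqi; apply: bmeasM (bmeas_cst _); have [_ []] := GA A mA.
by apply: filterS => x /(_ I) [].
Qed.

End multiplicative_class.

Section completeness.
Context {R : realType} (d : nat) (L : R).
Hypothesis L_gt0 : 0 < L.
Variable h : 'rV[R]_d -> R.
Hypothesis h_sqi : sqi (box_measure d L) h.
Hypothesis h_coef : forall k, ip (box_measure d L) h (cas L k) = 0.

Let mu_fin := box_measure_lty (ltW L_gt0) d.
Let E : set ('rV[R]_d -> R) := range (cas L).
Local Notation annih := (annih (box_measure d L) h E).
Local Notation annih_mul := (annih_mul (box_measure d L) h E).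

Let cas_bmeas k : bmeas (cas L k : 'rV[R]_d -> R).
Proof. by split; [exact: measurable_trig|exists 2; exact: cas_bounded]. Qed.

Let E_bmeas e : E e -> bmeas e.
Proof. by move=> [k _ <-]. Qed.

Let E_one : E (fun=> 1).
Proof.
exists 0 => //; apply/funext => x.
by rewrite /cas /trig phase0k cos0 sin0 mulr0 addr0 mulr1.
Qed.

Let E_annih e : E e -> ip (box_measure d L) h e = 0.
Proof. by move=> [k _ <-]. Qed.

Lemma casM_sum k l (x : 'rV[R]_d) : cas L k x * cas L l x =
  2^-1 * cas L (k - l) x + 2^-1 * cas L (l - k) x +
  (2^-1 * cas L (k + l) x + - 2^-1 * cas L (- k - l) x).
Proof. by rewrite casM cosE_cas sinE_cas (opprB k) (opprD k); field. Qed.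

(** The span of the system is an algebra: a product of two members is a combination of four, and
    each of them is annihilated. *)
Let cas_annih_mul k : annih_mul (cas L k).
Proof.
split=> // g [bg gE]; split=> [|_ [l _ <-]]; first exact: bmeasM.
have sg m : sqi (box_measure d L) (fun x => g x * cas L m x).
  exact/bmeas_sqi/bmeasM.
have g0 m : ip (box_measure d L) (fun x => g x * cas L m x) h = 0.
  by rewrite ipC; apply: gE; exists m.
have -> : (fun x => cas L k x * g x * cas L l x) = (fun x =>
    (2^-1 * (g x * cas L (k - l) x) + 2^-1 * (g x * cas L (l - k) x)) +
    (2^-1 * (g x * cas L (k + l) x) + - 2^-1 * (g x * cas L (- k - l) x))).
  by apply/funext => x; rewrite mulrAC casM_sum; ring.
have sZ a m := sqiZ a (sg m).
rewrite ipC (ipDl (sqiD (sZ _ _) (sZ _ _)) (sqiD (sZ _ _) (sZ _ _)) h_sqi).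
by rewrite !ipDl// !ipZl// !g0 !mulr0 !addr0.
Qed.

(* The difference of cosines is 2 sin(pi(t-a)/2L) sin(pi(L-t)/2L), so a half-line
   is, inside the box, the positivity set of a trigonometric polynomial. *)
Lemma halfline_phase (a t : R) : - L <= a < L -> - L <= t < L ->
  (0 < cos (pi / L * t - pi * (a + L) / (2 * L)) - cos (pi * (L - a) / (2 * L)))
  = (a < t).
Proof.
move=> /andP[aL La] /andP[tL Lt].
pose u := pi * (t - a) / (2 * L); pose v := pi * (L - t) / (2 * L).
have L2 : 0 < 2 * L by rewrite mulr_gt0.
have -> : pi / L * t - pi * (a + L) / (2 * L) = u - v by rewrite /u /v; field; rewrite gt_eqF.
have -> : pi * (L - a) / (2 * L) = u + v by rewrite /u /v; field; rewrite gt_eqF.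
have -> : cos (u - v) - cos (u + v) = 2 * (sin u * sin v).
  by rewrite !cosD cosN sinN; ring.
have p0 := pi_gt0 R.
have v0 : 0 < v by rewrite divr_gt0 ?mulr_gt0// subr_gt0.
have vpi : v <= pi by rewrite ler_pdivrMr// ler_pM2l//; lra.
have sv0 : 0 <= sin v by apply: sin_ge0_pi; rewrite (ltW v0).
rewrite pmulr_rgt0//; case: (ltP a t) => at_.
  apply: mulr_gt0; apply: sin_gt0_pi.
    rewrite divr_gt0 ?mulr_gt0 ?subr_gt0//= ltr_pdivrMr// ltr_pM2l//; lra.
  by rewrite v0/= ltr_pdivrMr// ltr_pM2l//; lra.
apply/negbTE; rewrite -leNgt -oppr_ge0 -mulNr -sinN; apply: mulr_ge0 => //.
have -> : - u = pi * (a - t) / (2 * L) by rewrite /u; field; rewrite gt_eqF.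
have u0 : 0 <= pi * (a - t) / (2 * L).
  by rewrite divr_ge0 ?mulr_ge0 ?subr_ge0// ltW.
apply: sin_ge0_pi; rewrite u0/= ler_pdivrMr// ler_pM2l//; lra.
Qed.

(** [annih_mul_lim] applied to a constant sequence; values off the box are thus free to change. *)
Let annih_mul_ae f g : annih_mul f -> bmeas g ->
  (forall x, box d L x -> f x = g x) -> annih_mul g.
Proof.
move=> Mf bg fg; have [[_ [C fC]] _] := Mf; have [mg [D gD]] := bg.
apply: (@annih_mul_lim _ _ _ _ mu_fin _ _ h_sqi E_bmeas (fun=> f) g (Num.max C D)) => //.
- by move=> _ x; rewrite le_max fC.
- by move=> x; rewrite le_max gD orbT.
- by apply: ae_box => x /fg <-; exact: cvg_cst.
Qed.

Let measurable_halfline a (i : 'I_d) : measurable [set x : 'rV[R]_d | a < x ord0 i].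
Proof.
rewrite (_ : [set x | _] = rV_coord i @^-1` `]a, +oo[%classic).
  by rewrite -[X in measurable X]setTI; exact: measurable_rV_coord.
by apply/seteqP; split=> x /=; rewrite in_itv/= andbT.
Qed.

Let annih_mul_halfline a (i : 'I_d) :
  annih_mul \1_[set x : 'rV[R]_d | a < x ord0 i].
Proof.
have bA : bmeas (\1_[set x : 'rV[R]_d | a < x ord0 i] : 'rV[R]_d -> R).
  split; first by apply: measurable_indic; exact: measurable_halfline.
  by exists 1 => x; rewrite indicE; case: (_ \in _); rewrite ?normr1 ?normr0.
have cst_mul c := annih_mul_cst mu_fin h_sqi E_bmeas c.
(* For [a] outside [-L, L) the indicator is constant on the box; for the others, [tau] below is a
   trigonometric polynomial to which [halfline_phase] applies. *)
have [aL|aL] := ltP a (- L).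
  apply: (annih_mul_ae (cst_mul 1) bA) => x /(_ i)/andP[xL _].
  by rewrite indicE mem_set//= (lt_le_trans aL).
have [La|La] := leP L a.
  apply: (annih_mul_ae (cst_mul 0) bA) => x /(_ i)/andP[_ Lx].
  by rewrite indicE memNset//=; apply/negP; rewrite -leNgt (le_trans (ltW Lx)).
pose k : 'rV[int]_d := delta_mx ord0 i.
have phaseE (x : 'rV[R]_d) : phase L k x = pi / L * x ord0 i.
  rewrite /phase (bigD1 i)//= big1 ?addr0 => [|j ji]; first by rewrite mxE !eqxx mul1r.
  by rewrite mxE (negbTE ji) andbF mul0r.
pose al := pi * (a + L) / (2 * L); pose c := cos (pi * (L - a) / (2 * L)).
pose tau (x : 'rV[R]_d) := cos (phase L k x - al) - c.
have Mtau : annih_mul tau.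
  have -> : tau = fun x => ((cos al + sin al) / 2 * cas L k x +
      (cos al - sin al) / 2 * cas L (- k) x) + - c.
    by apply/funext => x; rewrite /tau cosD cosN sinN cosE_cas sinE_cas; field.
  have Mk m (b : R) : annih_mul (fun x => b * cas L m x).
    by apply: (annih_mulM (cst_mul b)) => //.
  exact: (annih_mulD mu_fin h_sqi E_bmeas
    (annih_mulD mu_fin h_sqi E_bmeas (Mk _ _) (Mk _ _)) (cst_mul _)).
apply: (annih_mul_ae (annih_mul_gt0 mu_fin h_sqi E_bmeas Mtau) bA) => x /(_ i) xL.
rewrite !indicE; congr (_%:R); congr nat_of_bool.
have E1 : (0 < tau x) = (a < x ord0 i).
  by rewrite /tau phaseE halfline_phase// aL.
by apply/idP/idP => /set_mem /=; rewrite ?E1 => ?; apply/mem_set; rewrite /= ?E1.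
Qed.

(** The half-spaces a < x_i generate the sigma-algebra one coordinate at a time, so [annih_mul]
    contains the indicators of all measurable sets. *)
Lemma cas_complete : {ae box_measure d L, forall x, h x = 0}.
Proof.
apply: (annih_eq0 mu_fin h_sqi E_one E_annih).
have SA := annih_mul_sigma_algebra mu_fin h_sqi E_bmeas.
apply: smallest_sub; first exact: SA.
rewrite -bigcup_seq; apply: bigcup_sub => i _ B [C mC <-].
have SB := sigma_algebra_image (rV_coord i) SA.
move: C mC; rewrite RGenOInfty.measurableE; apply: smallest_sub; first exact: SB.
move=> _ [a ->]; rewrite /image_set_system /= setTI.
rewrite (_ : rV_coord i @^-1` _ = [set x | a < x ord0 i]).
  by split; [exact: measurable_halfline|exact: annih_mul_halfline].
by apply/seteqP; split=> x /=; rewrite in_itv/= andbT.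
Qed.

End completeness.

(** * Weak derivatives *)

Section weak_partials.
Context {R : realType} (d : nat) (L : R).
Hypothesis L_gt0 : 0 < L.
Local Notation mu := (box_measure d L).

Let mu_fin := box_measure_lty (ltW L_gt0) d.

(** [f] may be unbounded on the whole space, but the measure lives on the box, which lies in a
    compact cube. *)
Lemma continuous_sqi (f : 'rV[R]_d -> R) : continuous f -> sqi mu f.
Proof.
move=> cf; have mf := continuous_measurable_rV cf.
have : compact (f @` [set x : 'rV[R]_d | forall i, `[- L, L]%classic (x ord0 i)]).
  apply: continuous_compact; first exact: continuous_subspaceT.
  by apply: (@rV_compact _ _ (fun=> `[- L, L]%classic)) => i; exact: segment_compact.
move=> /compact_bounded[C [_ /(_ (C + 1))]]; rewrite ltrDl ltr01 => /(_ isT) fC.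
have fb : {ae mu, forall x, `|f x| <= C + 1}.
  apply: ae_box => x xL; apply: fC; exists x => // i.
  by rewrite /= in_itv/=; have /andP[-> /ltW] := xL i.
have mf2 : measurable_fun setT (fun x => (f x ^+ 2)%:E).
  by apply/measurable_EFinP; exact: measurable_funX.
split=> //; apply/integrableP; split=> //.
apply: (@le_lt_trans _ _ (\int[mu]_x ((C + 1) ^+ 2)%:E)%E).
  apply: ae_ge0_le_integral => //.
  - exact: measurableT_comp.
  - by move=> x _; rewrite lee_fin sqr_ge0.
  - apply: filterS fb => x fx _; rewrite /= lee_fin ger0_norm ?sqr_ge0//.
    rewrite -[leLHS]real_normK ?num_real// ler_pXn2r ?nnegrE//.
    exact: le_trans fx.
by rewrite integral_cst// lte_mul_pinfty// lee_fin sqr_ge0.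
Qed.

Lemma smooth_sqi (phi : 'rV[R]_d -> R) (s : seq 'I_d) :
  smooth phi -> sqi mu (iter_partial s phi).
Proof.
by move=> sphi; apply: continuous_sqi => x; exact/differentiable_continuous/sphi.
Qed.

Lemma is_weak_partialP i (rho g : L2box d L) : is_weak_partial i rho g <->
  forall phi, smooth phi -> box_periodic L phi ->
    ip mu rho ('D_(basis_vec i) phi) = - ip mu g phi.
Proof.
have fin (f : L2box d L) (psi : 'rV[R]_d -> R) : sqi mu psi ->
    (\int[mu]_x (f x * psi x)%:E)%E = (ip mu f psi)%:E.
  move=> spsi; rewrite /ip /Rintegral fineK//.
  by apply: integrable_fin_num => //; exact: sqi_mulr_integrable (L2_sqi f) spsi.
split=> W phi sphi pphi; have := W phi sphi pphi;
  have sp := smooth_sqi [::] sphi; have sD := smooth_sqi [:: i] sphi.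
  by rewrite (fin _ _ sD) (fin _ _ sp) => -[].
by rewrite (fin _ _ sD) (fin _ _ sp) => ->.
Qed.

(** [cas L k] is an admissible test function, and its derivative is a multiple of [cas L (- k)]. *)
Lemma weak_partial_cas i (rho g : L2box d L) (k : 'rV[int]_d) : is_weak_partial i rho g ->
  pi / L * (k ord0 i)%:~R * ip mu rho (cas L (- k)) = - ip mu g (cas L k).
Proof.
move=> /is_weak_partialP/(_ _ (smooth_trig L 1 1 k)) <-; last first.
  by apply: periodic_trig; rewrite gt_eqF.
rewrite -(ipC _ (cas L (- k))) -ipZl; [|exact: cas_sqi|exact: L2_sqi].
rewrite ipC; congr ip; apply/funext => x; exact/esym/derive_cas.
Qed.

(** [weak_partial] is an arbitrary choice made by [xget]; this lets the gradient found as a limit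
    replace it in the energy. *)
Lemma weak_partial_unique i (rho g g' : L2box d L) :
  is_weak_partial i rho g -> is_weak_partial i rho g' ->
  {ae mu, forall x, g x = g' x}.
Proof.
move=> Wg Wg'.
have : {ae mu, forall x, g x - g' x = 0}.
  apply: (cas_complete L_gt0); first exact: sqiB (L2_sqi g) (L2_sqi g').
  move=> k; rewrite (ipBl (L2_sqi g) (L2_sqi g') (cas_sqi L_gt0 k)).
  have := weak_partial_cas k Wg; rewrite (weak_partial_cas k Wg').
  by move/oppr_inj => ->; rewrite subrr.
by apply: filterS => x /eqP; rewrite subr_eq0 => /eqP.
Qed.

Lemma weak_partialP i (rho : L2box d L) : H1p rho ->
  is_weak_partial i rho (weak_partial i rho).
Proof. by move=> /(_ i) Wg; exact: (@xgetPex _ rho (is_weak_partial i rho) Wg). Qed.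

End weak_partials.

(** * Frequencies in a sequence, and the bound by the gradient *)

Section frequency_enumeration.
Context {R : realType} (d : nat) (L : R).
Hypothesis L_gt0 : 0 < L.
Local Notation mu := (box_measure d L).

(** The ellipsoid is stated for sequences, so frequencies are listed by their codes; an index that
    codes no frequency gets the zero function. *)
Definition freq_fun (f : 'rV[int]_d -> 'rV[R]_d -> R) (n : nat) : 'rV[R]_d -> R :=
  if pickle_inv n is Some k then f k else fun=> 0.

(* Indices that are not codes of a frequency get the weight [n.+1], only so that
   the weights tend to infinity; [(k == 0)] keeps them at least 1. *)
Definition freq_weight (n : nat) : R :=
  if @pickle_inv 'rV[int]_d n is Some k
  then (k == 0)%:R + \sum_i ((k ord0 i)%:~R) ^+ 2 else n.+1%:R.

Lemma freq_weight_ge1 n : 1 <= freq_weight n.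
Proof.
rewrite /freq_weight; case: pickle_inv => [k|]; last by rewrite ler1n.
have s0 : 0 <= \sum_i ((k ord0 i)%:~R) ^+ 2 :> R by apply: sumr_ge0 => i _; exact: sqr_ge0.
have [->|k0] := eqVneq k 0; first by rewrite lerDl; apply: sumr_ge0 => i _; exact: sqr_ge0.
rewrite add0r; have [i ki] : exists i, k ord0 i != 0.
  apply: contrapT => /forallNP kz; move/negP : k0; apply; apply/eqP/rowP => i.
  by rewrite mxE; have /negP := kz i; rewrite negbK => /eqP.
rewrite (bigD1 i)//=; apply: ler_wpDr; first by apply: sumr_ge0 => j _; exact: sqr_ge0.
rewrite -[leRHS]real_normK ?num_real// -intr_norm exprn_ege1// -[1]/(1%:~R) ler_int.
by rewrite -gtz0_ge1 normr_gt0.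
Qed.

(** A weight below [K] forces |k_i| <= K for all i, since |k_i| <= |k_i|^2 for integers. The
    finitely many such frequencies are the values of [kf], and [m] exceeds all their codes. *)
Lemma freq_weight_large W : exists m, forall n, (m <= n)%N -> W <= freq_weight n.
Proof.
have [K WK] : exists K : nat, W <= K%:R.
  by exists (Num.truncn `|W|).+1; apply: le_trans (ler_norm W) _; exact/ltW/truncnS_gt.
pose kf (f : {ffun 'I_d -> 'I_(K.*2.+1)}) : 'rV[int]_d := \row_i ((f i)%:Z - K%:Z).
exists (maxn K (\max_f pickle (kf f)).+1) => n; rewrite geq_max => /andP[Kn fn].
rewrite /freq_weight; case kE : (pickle_inv n) => [k|]; last first.
  by apply: le_trans WK _; rewrite ler_nat ltnW.
rewrite leNgt; apply/negP => kW.
have ki i : `|k ord0 i| <= K%:Z.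
  rewrite leNgt; apply/negP => Kk.
  move: kW; apply/negP; rewrite -leNgt; apply: le_trans WK _.
  rewrite (bigD1 i)//= -{1}[(k ord0 i)%:~R ^+ 2]real_normK ?num_real//.
  have s0 : 0 <= \sum_(j < d | j != i) ((k ord0 j)%:~R) ^+ 2 :> R.
    by apply: sumr_ge0 => j _; exact: sqr_ge0.
  have b0 : 0 <= (k == 0)%:R :> R by rewrite ler0n.
  have K0 : 0 <= K%:R :> R by rewrite ler0n.
  have : K%:R <= `|(k ord0 i)%:~R| ^+ 2 :> R.
    have k1 : 1 <= `|(k ord0 i)%:~R| :> R.
      by rewrite -intr_norm -[1]/(1%:~R) ler_int; lia.
    have kK : K%:R <= `|(k ord0 i)%:~R| :> R.
      by rewrite -intr_norm -[K%:R]/(K%:Z%:~R) ler_int ltW.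
    by apply: le_trans kK _; rewrite expr2 ler_peMr.
  lra.
have kb i : (`|(k ord0 i + K%:Z)%R|%N < K.*2.+1)%N by have := ki i; lia.
have /(congr1 pickle) : kf [ffun i => Ordinal (kb i)] = k.
  apply/rowP => i; rewrite !mxE ffunE /= gez0_abs ?addrK//.
  by have := ki i; rewrite ler_norml -lerBlDr sub0r => /andP[].
have := @pickle_invK 'rV[int]_d n; rewrite /= kE /= => -> nE.
by move: fn; rewrite -nE ltnNge => /negP; apply; exact: leq_bigmax.
Qed.

End frequency_enumeration.

Section freq_ellipsoid.
Context {R : realType} (d : nat) (L : R).
Hypothesis L_gt0 : 0 < L.
Local Notation mu := (box_measure d L).
Local Notation B := ((L *+ 2) ^+ d).

Let mu_fin := box_measure_lty (ltW L_gt0) d.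

Let B_gt0 : 0 < B.
Proof. by rewrite exprn_gt0// pmulrn_rgt0. Qed.

(** The identity serves for the density itself, the sign change for its derivatives. *)
Variable s : 'rV[int]_d -> 'rV[int]_d.
Hypothesis s_inj : injective s.
Let e := freq_fun (fun k => cas L (s k)) : nat -> 'rV[R]_d -> R.

Lemma freq_sqi n : sqi mu (e n).
Proof.
rewrite /e /freq_fun; case: pickle_inv => [k|]; first exact: cas_sqi.
exact: sqi0.
Qed.

Lemma freq_orth m n : m != n -> ip mu (e m) (e n) = 0.
Proof.
rewrite /e /freq_fun => mn.
have := @pickle_invK 'rV[int]_d m; have := @pickle_invK 'rV[int]_d n.
case: (@pickle_inv _ m) => [k|]/=; last by rewrite ipC ip0r.
case: (@pickle_inv _ n) => [l|]/=; last by rewrite ip0r.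
move=> ln km; rewrite (ip_cas L_gt0); case: eqP => // /s_inj kl.
by move: mn; rewrite -ln -km kl eqxx.
Qed.

Lemma freq_norm n : ip mu (e n) (e n) = B \/ e n = fun=> 0.
Proof.
rewrite /e /freq_fun; case: (@pickle_inv _ n) => [k|]; last by right.
by left; rewrite (ip_cas L_gt0) eqxx.
Qed.

Lemma freq_Bessel f n : sqi mu f ->
  \sum_(0 <= k < n) fcoef mu e f k ^+ 2 <= B * ip mu f f.
Proof. exact: (Bessel B_gt0 freq_sqi freq_orth freq_norm). Qed.

End freq_ellipsoid.

Section gradient_bound.
Context {R : realType} (d : nat) (L : R).
Hypothesis L_gt0 : 0 < L.
Local Notation mu := (box_measure d L).
Local Notation B := ((L *+ 2) ^+ d).
Local Notation e := (freq_fun (cas L) : nat -> 'rV[R]_d -> R).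

Lemma freq_ellipsoid_compact M : compact (ellipsoid (mu := mu) e (freq_weight d) M).
Proof.
have B_gt0 : 0 < B by rewrite exprn_gt0// pmulrn_rgt0.
apply: (ellipsoid_compact (box_measure_lty (ltW L_gt0) d) B_gt0
  (freq_sqi L_gt0 id) (freq_orth L_gt0 (@inj_id _)) (freq_norm L_gt0 id)).
- move=> h sh h0; apply: (cas_complete L_gt0 sh) => k.
  by have := h0 (pickle k); rewrite /fcoef /freq_fun pickleK_inv.
- exact: freq_weight_ge1.
- exact: freq_weight_large.
Qed.

(** By [weak_partial_cas], |k|^2 times the squared coefficient of [rho] at k is (L/pi)^2 times the
    sum of those of the [g i] at -k, which Bessel's inequality bounds. Frequency 0 has weight 1 and
    its coefficient is the mass, hence the leading 1. *)
Lemma grad_ellipsoid (rho : L2box d L) (g : 'I_d -> L2box d L) :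
  (forall i, is_weak_partial i rho (g i)) -> (\int[mu]_x (rho x)%:E = 1)%E ->
  ellipsoid e (freq_weight d)
    (1 + (L / pi) ^+ 2 * B * \sum_i ip mu (g i) (g i)) rho.
Proof.
move=> Wg rho1 N.
have p0 : pi != 0 :> R by rewrite gt_eqF ?pi_gt0.
have L0 : L != 0 by rewrite gt_eqF.
pose e' := freq_fun (fun k => cas L (- k)) : nat -> 'rV[R]_d -> R.
pose c n := fcoef mu e rho n.
have cE n : freq_weight d n * c n ^+ 2 =
    (n == pickle (0 : 'rV[int]_d))%:R +
    (L / pi) ^+ 2 * \sum_i fcoef mu e' (g i) n ^+ 2.
  rewrite /c /fcoef /e' /freq_fun /freq_weight.
  have := @pickle_invK 'rV[int]_d n; case kE: (@pickle_inv _ n) => [k|] /= nE; last first.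
    rewrite !ip0r expr0n mulr0 big1 => [|i _]; last by rewrite ip0r expr0n.
    rewrite mulr0 addr0; case: eqP => // n0.
    by move: kE; rewrite n0 pickleK_inv.
  rewrite mulrDl; congr (_ + _).
    rewrite -nE; have [->|k0] := eqVneq k 0.
      rewrite !eqxx mul1r /ip /Rintegral; under eq_integral do
        rewrite /cas /trig phase0k cos0 sin0 mulr0 addr0 !mulr1.
      by rewrite rho1 expr1n.
    rewrite mul0r; case: eqP => // /(pcan_inj pickleK_inv) k0'.
    by move: k0; rewrite k0' eqxx.
  rewrite mulr_suml mulr_sumr; apply: eq_bigr => i _.
  have := weak_partial_cas L_gt0 (- k) (Wg i); rewrite opprK mxE mulrNz.
  move=> h; rewrite (_ : ip mu (g i) (cas L (- k)) =
    pi / L * (k ord0 i)%:~R * ip mu rho (cas L k)); last by lra.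
  have key (P l x y : R) : P != 0 -> l != 0 ->
      x ^+ 2 * y ^+ 2 = (l / P) ^+ 2 * (P / l * x * y) ^+ 2.
    by move=> P0 l0; field; rewrite P0 l0.
  exact: key.
under eq_bigr do rewrite -/(c _) cE.
rewrite big_split/=; apply: lerD.
  set p := pickle _; have [pN|pN] := boolP (p \in index_iota 0 N); last first.
    rewrite big1_seq// => k /andP[_ kN]; case: eqP => // kp.
    by move: pN; rewrite -kp kN.
  rewrite (big_rem p pN)/= eqxx big1_seq ?addr0// => k /andP[_].
  by rewrite mem_rem_uniq ?iota_uniq// inE => /andP[/negbTE ->].
rewrite -mulr_sumr -mulrA ler_wpM2l ?sqr_ge0//.
rewrite exchange_big/= mulr_sumr; apply: ler_sum => i _.
by apply: (freq_Bessel L_gt0 (@oppr_inj _)); exact: L2_sqi.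
Qed.

End gradient_bound.

(** * The energy densities *)

Section denominators.
Context {R : realType}.
Variable r : R -> R -> R.
Hypothesis r_adm : admissible_denominators r.

(** The maximum extends the function from the half-line to the line. Where [r'] is the derivative,
    one-sided at 0, the difference quotients near m are bounded by |r' m| + 1. *)
Lemma denom_continuous eps : 0 < eps -> continuous (fun s : R => r eps (Num.max s 0)).
Proof.
move=> eps0; have [r' [dr _ _]] := denom_C1_ndecr r_adm eps0.
move=> s; pose m := Num.max s 0; have m0 : 0 <= m by rewrite le_max lexx orbT.
apply/cvgrPdist_le => e e0.
have /cvgrPdist_lt/(_ _ ltr01) := dr m m0.
rewrite /within/= => /nbhs_ballP[h /= h0 hP].
have C0 : 0 < `|r' m| + 1 by rewrite ltr_wpDl.
have d0 : 0 < Num.min h (e / (`|r' m| + 1)) by rewrite lt_min h0 divr_gt0.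
near=> t.
have tm : `|Num.max t 0 - m| <= `|t - s|.
  rewrite /m; case: (leP t 0) => t0; case: (leP s 0) => s0 //.
  - by rewrite subrr normr0.
  - by rewrite sub0r normrN [leRHS]ler0_norm ?gtr0_norm//; lra.
  - by rewrite subr0 gtr0_norm// ger0_norm; lra.
have ts : `|t - s| < Num.min h (e / (`|r' m| + 1)).
  by rewrite distrC; near: t; exact: cvgr_dist_lt.
rewrite -/m; have [->|tNm] := eqVneq (Num.max t 0) m; first by rewrite subrr normr0 ltW.
pose k := Num.max t 0 - m.
have k0 : k != 0 by rewrite subr_eq0.
have mk : m + k = Num.max t 0 by rewrite /k addrC subrK.
have kh : ball (0 : R) h k.
  rewrite /ball/= sub0r normrN; apply: le_lt_trans tm _.
  by move: ts; rewrite lt_min => /andP[].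
have := hP _ kh k0; rewrite /= mk => /(_ _)/wrap[]; first by rewrite le_max lexx orbT.
rewrite distrC => q1.
set D := r eps _ - r eps m in q1 *.
have {}q1 : `|k^-1 * D| <= `|r' m| + 1.
  have := ler_distD 0 (k^-1 * D) (r' m).
  by have := lerB_dist (k^-1 * D) (r' m); lra.
have -> : `|r eps m - r eps (Num.max t 0)| = `|k| * `|k^-1 * D|.
  by rewrite -normrM mulrA divff// mul1r /D distrC.
apply: (@le_trans _ _ (`|k| * (`|r' m| + 1))); first by rewrite ler_wpM2l.
rewrite -ler_pdivlMr//; apply: le_trans tm _.
by move: ts; rewrite lt_min => /andP[_ /ltW].
Unshelve. all: by end_near. Qed.

Lemma denom_midpoint eps s t : 0 < eps -> 0 <= s -> 0 <= t ->
  (r eps s + r eps t) / 2 <= r eps ((s + t) / 2).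
Proof.
move=> eps0 s0 t0.
have := denom_concave r_adm eps0.
have h01 : 0 <= (2^-1 : R) <= 1 by lra.
move=> /(_ (Itv01 (proj1 (andP h01)) (proj2 (andP h01))) s t).
rewrite !inE/= !in_itv/= !andbT => /(_ s0 t0).
move=> h; have {}h : - r eps (2^-1 * s + (1 - 2^-1) * t) <=
  2^-1 * - r eps s + (1 - 2^-1) * - r eps t := h.
have E : 2^-1 * s + (1 - 2^-1) * t = (s + t) / 2 by field.
by rewrite E in h; lra.
Qed.

Lemma denom_cvg_seq (s : R) : 0 <= s -> r (harmonic n) s @[n --> \oo] --> s.
Proof.
move=> s0; have /cvg_at_rightP := denom_cvg r_adm s0.
by apply; split; [move=> n; rewrite /harmonic/= invr_gt0|exact: cvg_harmonic].
Qed.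

End denominators.

Section potential.
Context {R : realType}.
Implicit Types s t a b : R.

Let rt a s := Num.sqrt (s ^+ 2 + a ^+ 2).

Let rt_ge0 a s : 0 <= rt a s. Proof. exact: sqrtr_ge0. Qed.

Let rt_sqr a s : rt a s ^+ 2 = s ^+ 2 + a ^+ 2.
Proof. by rewrite sqr_sqrtr// addr_ge0 ?sqr_ge0. Qed.

Let rt_ge a s : 0 <= a -> a <= rt a s.
Proof.
move=> a0; rewrite -(ler_pXn2r (n:=2)) ?nnegrE// rt_sqr.
by rewrite lerDr sqr_ge0.
Qed.

Lemma potential_reg_ge0 a s : 0 < a -> 0 <= potential_reg a s.
Proof. by move=> a0; rewrite subr_ge0 rt_ge// ltW. Qed.

Lemma potential_reg_le a s : 0 < a -> 0 <= s -> potential_reg a s <= s.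
Proof.
move=> a0 s0; rewrite lerBlDr -(ler_pXn2r (n:=2)) ?nnegrE ?rt_ge0//; last first.
  by rewrite addr_ge0// ltW.
by rewrite rt_sqr; have := mulr_ge0 s0 (ltW a0); nra.
Qed.

Lemma potential_reg_mono a b s : 0 < a -> a <= b ->
  potential_reg b s <= potential_reg a s.
Proof.
move=> a0 ab; have aA := rt_ge s (ltW a0); have A2 := rt_sqr a s.
rewrite /potential_reg -/(rt a s) -/(rt b s) lerBlDr.
rewrite -(ler_pXn2r (n:=2)) ?nnegrE ?rt_ge0//; last by lra.
rewrite rt_sqr.
(* Twice this product is the difference of the two squared sides. *)
have : 0 <= (b - a) * (rt a s - a) by rewrite mulr_ge0 ?subr_ge0.
by nra.
Qed.

(** Up to a constant this is the Euclidean norm of (s, a); its convexity follows from the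
    Cauchy-Schwarz inequality for (s, a) and (t, a). *)
Lemma potential_reg_midpoint a s t :
  potential_reg a ((s + t) / 2) <= (potential_reg a s + potential_reg a t) / 2.
Proof.
rewrite /potential_reg -/(rt a _) -/(rt a s) -/(rt a t).
have sA := rt_sqr a s; have tA := rt_sqr a t.
have [s0 t0] := (rt_ge0 a s, rt_ge0 a t).
suff : rt a ((s + t) / 2) <= (rt a s + rt a t) / 2 by lra.
rewrite -(ler_pXn2r (n:=2)) ?nnegrE ?rt_ge0//; last by rewrite divr_ge0// addr_ge0.
rewrite rt_sqr.
have : s * t + a ^+ 2 <= rt a s * rt a t.
  have [st|/ltW st] := leP (s * t + a ^+ 2) 0; first exact/(le_trans st)/mulr_ge0.
  rewrite -(ler_pXn2r (n:=2)) ?nnegrE ?mulr_ge0// exprMn sA tA.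
  by have := sqr_ge0 (a * (s - t)); nra.
by nra.
Qed.

Lemma potential_reg_cvg (u : R^nat) s a : u n @[n --> \oo] --> s ->
  potential_reg a (u n) @[n --> \oo] --> potential_reg a s.
Proof.
move=> us; apply: cvgB; last exact: cvg_cst.
have us2 : (u n ^+ 2 + a ^+ 2) @[n --> \oo] --> s ^+ 2 + a ^+ 2.
  by apply: cvgD; [exact: (cvgM us us)|exact: cvg_cst].
by apply: cvg_comp us2 _; exact: sqrt_continuous.
Qed.

Lemma potential_reg_cvg0 (a : R^nat) s : 0 <= s -> a n @[n --> \oo] --> 0 ->
  potential_reg (a n) s @[n --> \oo] --> s.
Proof.
move=> s0 a0; rewrite -[X in _ --> X]subr0; apply: cvgB => //.
have as2 : (s ^+ 2 + a n ^+ 2) @[n --> \oo] --> s ^+ 2.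
  rewrite -[X in _ --> X]addr0 -[X in _ + X](mulr0 0).
  by apply: cvgD; [exact: cvg_cst|exact: (cvgM a0 a0)].
rewrite -[X in _ --> X](ger0_norm s0) -sqrtr_sqr.
by apply: cvg_comp as2 _; exact: sqrt_continuous.
Qed.

Lemma measurable_potential_reg a : measurable_fun setT (potential_reg a).
Proof.
apply: measurable_funB => //.
apply: (measurableT_comp (continuous_measurable_fun (@sqrt_continuous R))).
by apply: measurable_funD => //; exact: measurable_funX.
Qed.

End potential.

(** * Pointwise properties of the integrands *)

Section density.
Context {R : realType} {d : nat}.
Implicit Types (r : R -> R) (s t v : R) (p q : 'rV[R]_d).
Variables beta delta : R.
Hypotheses (beta_ge0 : 0 <= beta) (delta_gt0 : 0 < delta).

Definition dens r (a v s : R) q : R :=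
  kinetic r s q + v * potential_reg a s + beta / 2 * s ^+ 2 + delta / 2 * sqnorm q.

Definition dens0 (v s : R) q : \bar R :=
  (kinetic0 s q + (v * s + beta / 2 * s ^+ 2 + delta / 2 * sqnorm q)%:E)%E.

Lemma sqnorm_ge0 q : 0 <= sqnorm q.
Proof. by apply: sumr_ge0 => i _; exact: sqr_ge0. Qed.

Lemma sqnorm_eq0 q : (sqnorm q == 0) = (q == 0).
Proof.
apply/idP/eqP => [|->]; last by rewrite /sqnorm big1// => i _; rewrite mxE expr0n.
rewrite psumr_eq0 => [/allP q0|i _]; last exact: sqr_ge0.
apply/rowP => i; rewrite mxE; apply/eqP; rewrite -sqrf_eq0.
by apply: q0; rewrite mem_index_enum.
Qed.

Lemma kinetic_ge0 r s q : (forall s, 0 <= s -> 0 < r s) -> 0 <= kinetic r s q.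
Proof.
move=> r0; rewrite /kinetic; case: ifPn => // s0.
by rewrite divr_ge0 ?sqnorm_ge0// mulr_ge0// ltW// r0.
Qed.

Lemma dens_ge_grad r a v s q : (forall s, 0 <= s -> 0 < r s) -> 0 < a -> 0 <= v ->
  delta / 2 * sqnorm q <= dens r a v s q.
Proof.
move=> r0 a0 v0; rewrite /dens lerDr addr_ge0 ?addr_ge0 ?kinetic_ge0//.
  by rewrite mulr_ge0// potential_reg_ge0.
by rewrite mulr_ge0 ?sqr_ge0// divr_ge0.
Qed.

Lemma dens_ge0 r a v s q : (forall s, 0 <= s -> 0 < r s) -> 0 < a -> 0 <= v ->
  0 <= dens r a v s q.
Proof.
move=> r0 a0 v0; apply: le_trans (dens_ge_grad _ _ r0 a0 v0).
by rewrite mulr_ge0 ?sqnorm_ge0// divr_ge0// ltW.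
Qed.

(** Midpoint concavity replaces r((s + t)/2) by the mean of the two values, and a^2/x is jointly
    convex: its midpoint defect is a square over a positive number. *)
Lemma kinetic_midpoint r s t p q : (forall s, 0 <= s -> 0 < r s) ->
  (r s + r t) / 2 <= r ((s + t) / 2) -> 0 <= s -> 0 <= t ->
  kinetic r ((s + t) / 2) (2^-1 *: (p + q)) <= (kinetic r s p + kinetic r t q) / 2.
Proof.
move=> r0 rm s0 t0; have m0 : 0 <= (s + t) / 2 by rewrite divr_ge0// addr_ge0.
rewrite /kinetic s0 t0 m0 /sqnorm !mulr_suml -big_split mulr_suml /=.
apply: ler_sum => i _; rewrite !mxE.
have [x0 y0 z0] := And3 (r0 s s0) (r0 t t0) (r0 _ m0).
set x := r s in rm x0 *; set y := r t in rm y0 *; set z := r _ in rm z0 *.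
set a := p _ _; set b := q _ _.
apply: (@le_trans _ _ ((2^-1 * (a + b)) ^+ 2 / (8 * ((x + y) / 2)))).
  have xy0 : 0 < (x + y) / 2 by rewrite divr_gt0 ?addr_gt0.
  apply: ler_wpM2l; first exact: sqr_ge0.
  by rewrite lef_pV2 ?posrE; [rewrite ler_pM2l|exact: mulr_gt0|exact: mulr_gt0].
rewrite -subr_ge0.
have -> : (a ^+ 2 / (8 * x) + b ^+ 2 / (8 * y)) / 2 -
    (2^-1 * (a + b)) ^+ 2 / (8 * ((x + y) / 2)) =
    (a * y - b * x) ^+ 2 / (16 * x * y * (x + y)).
  by field; rewrite !gt_eqF ?addr_gt0.
by rewrite divr_ge0 ?sqr_ge0// !mulr_ge0 ?addr_ge0// ltW.
Qed.

Lemma sqnorm_midpoint p q : sqnorm (2^-1 *: (p + q)) <= (sqnorm p + sqnorm q) / 2.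
Proof.
rewrite /sqnorm -big_split mulr_suml; apply: ler_sum => i _; rewrite !mxE /=.
by have := sqr_ge0 (p ord0 i - q ord0 i); nra.
Qed.

Lemma dens_midpoint r a v s t p q : (forall s, 0 <= s -> 0 < r s) ->
  (r s + r t) / 2 <= r ((s + t) / 2) -> 0 <= v -> 0 <= s -> 0 <= t ->
  dens r a v ((s + t) / 2) (2^-1 *: (p + q)) <=
  (dens r a v s p + dens r a v t q) / 2.
Proof.
move=> r0 rm v0 s0 t0; rewrite /dens.
have h1 := kinetic_midpoint p q r0 rm s0 t0.
have h2 := ler_wpM2l v0 (potential_reg_midpoint a s t).
have b2 : 0 <= beta / 2 by rewrite divr_ge0.
have d2 : 0 <= delta / 2 by rewrite divr_ge0// ltW.
have h4 := ler_wpM2l d2 (sqnorm_midpoint p q).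
have h3 : beta / 2 * ((s + t) / 2) ^+ 2 <= beta / 2 * ((s ^+ 2 + t ^+ 2) / 2).
  by rewrite ler_wpM2l//; have := sqr_ge0 (s - t); nra.
lra.
Qed.

Lemma dens_mono r1 r2 a1 a2 v s q : (forall s, 0 <= s -> 0 < r1 s) ->
  r1 s <= r2 s -> 0 < a1 -> a1 <= a2 -> 0 <= v -> 0 <= s ->
  dens r2 a2 v s q <= dens r1 a1 v s q.
Proof.
move=> r10 r12 a10 a12 v0 s0; rewrite /dens !lerD2r; apply: lerD; last first.
  by rewrite ler_wpM2l// potential_reg_mono.
rewrite /kinetic s0 ler_wpM2l ?sqnorm_ge0// lef_pV2 ?posrE ?mulr_gt0 ?r10//.
  by rewrite ler_pM2l.
exact: lt_le_trans (r10 _ s0) r12.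
Qed.

Lemma dens_le_dens0 r a v s q : (forall s, 0 <= s -> 0 < r s) -> s <= r s ->
  0 < a -> 0 <= v -> 0 <= s -> ((dens r a v s q)%:E <= dens0 v s q)%E.
Proof.
move=> r0 sr a0 v0 s0; rewrite /dens /dens0 /kinetic /kinetic0 s0.
have pv : v * potential_reg a s <= v * s by rewrite ler_wpM2l// potential_reg_le.
case: ifPn => [sp|].
  rewrite -EFinD lee_fin -!addrA; apply: lerD; last by rewrite lerD2r.
  by rewrite ler_wpM2l ?sqnorm_ge0// lef_pV2 ?posrE ?mulr_gt0 ?r0// ler_pM2l.
rewrite -leNgt => sle; case: ifPn => [/eqP q0|_]; last by rewrite addye// leey.
rewrite add0e lee_fin; have -> : sqnorm q = 0 by apply/eqP; rewrite sqnorm_eq0 q0.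
by rewrite mul0r add0r !lerD2r.
Qed.

Lemma dens0_ge0 v s q : 0 <= v -> 0 <= s -> (0 <= dens0 v s q)%E.
Proof.
move=> v0 s0; rewrite /dens0; apply: adde_ge0.
  rewrite /kinetic0; case: ifPn => [sp|_]; last by case: ifP; rewrite ?leey.
  by rewrite lee_fin divr_ge0 ?sqnorm_ge0// mulr_ge0.
rewrite lee_fin !addr_ge0 ?mulr_ge0 ?sqr_ge0 ?sqnorm_ge0 ?divr_ge0//; exact: ltW.
Qed.

Lemma sqnorm_cvg (Q : nat -> 'rV[R]_d) q :
  (forall i, Q n ord0 i @[n --> \oo] --> q ord0 i) ->
  sqnorm (Q n) @[n --> \oo] --> sqnorm q.
Proof.
move=> Qq; rewrite /sqnorm; apply: cvg_big => [|i _]; first exact: add_continuous.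
exact: (cvgM (Qq i) (Qq i)).
Qed.

Lemma dens_cvg r a v (S : R^nat) (Q : nat -> 'rV[R]_d) s q :
  (forall s, 0 <= s -> 0 < r s) -> continuous (fun s : R => r (Num.max s 0)) ->
  (forall n, 0 <= S n) -> 0 <= s -> S n @[n --> \oo] --> s ->
  (forall i, Q n ord0 i @[n --> \oo] --> q ord0 i) ->
  dens r a v (S n) (Q n) @[n --> \oo] --> dens r a v s q.
Proof.
move=> r0 rc S0 s0 Ss Qq; have Nq := sqnorm_cvg Qq; rewrite /dens.
apply: cvgD; last by apply: cvgM => //; exact: cvg_cst.
apply: cvgD; last by apply: cvgM; [exact: cvg_cst|exact: (cvgM Ss Ss)].
apply: cvgD; last by apply: cvgM; [exact: cvg_cst|exact: potential_reg_cvg].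
rewrite /kinetic s0; under eq_fun do rewrite S0.
apply: cvgM => //; apply: cvgV; first by rewrite mulf_neq0// gt_eqF// r0.
apply: cvgM; first exact: cvg_cst.
have -> : r s = r (Num.max s 0) by rewrite max_l.
have -> : (fun n => r (S n)) = (fun n => r (Num.max (S n) 0)).
  by apply/funext => n; rewrite max_l.
exact: (cvg_comp _ (fun s : R => r (Num.max s 0)) Ss (rc s)).
Qed.

Lemma dens_cvg_dens0 (r : nat -> R -> R) (a : R^nat) v s q :
  (forall n s, 0 <= s -> 0 < r n s) -> 0 <= s ->
  r n s @[n --> \oo] --> s -> a n @[n --> \oo] --> 0 ->
  (dens (r n) (a n) v s q)%:E @[n --> \oo] --> dens0 v s q.
Proof.
move=> r0 s0 rs a0; rewrite /dens /dens0.
under eq_fun do rewrite -!addrA EFinD !addrA.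
have c2 : (v * potential_reg (a n) s + beta / 2 * s ^+ 2 + delta / 2 * sqnorm q)%:E
    @[n --> \oo] --> (v * s + beta / 2 * s ^+ 2 + delta / 2 * sqnorm q)%:E.
  apply: cvg_EFin; first exact: nearW.
  apply: cvgD; last exact: cvg_cst.
  apply: cvgD; last exact: cvg_cst.
  by apply: cvgM; [exact: cvg_cst|exact: potential_reg_cvg0].
apply: cvgeD => //.
  by rewrite /kinetic0; case: ifP => // _; case: ifP.
rewrite /kinetic /kinetic0 s0; case: ifPn => [sp|].
  apply: cvg_EFin; first exact: nearW.
  apply: cvgM; first exact: cvg_cst.
  apply: cvgV; first by rewrite mulf_neq0// gt_eqF.
  by apply: cvgM => //; exact: cvg_cst.
rewrite -leNgt => sle; have sE : s = 0 by apply/eqP; rewrite eq_le sle s0.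
case: ifPn => [/eqP q0|q0].
  have -> : sqnorm q = 0 by apply/eqP; rewrite sqnorm_eq0 q0.
  by under eq_fun do rewrite mul0r; exact: cvg_cst.
(* Here s = 0 and q is nonzero, so the limit is +oo: once [r n s] is below the threshold [e0], the
   quotient exceeds |A| + 1. *)
apply/cvgeryP; apply/cvgryPge => A.
have Nq : 0 < sqnorm q by rewrite lt_neqAle eq_sym sqnorm_eq0 q0 sqnorm_ge0.
have A0 : 0 < `|A| + 1 by rewrite ltr_wpDl.
have e0 : 0 < sqnorm q / (8 * (`|A| + 1)) by rewrite divr_gt0// mulr_gt0.
move: rs; rewrite {2}sE => /cvgr0Pnorm_lt/(_ _ e0); apply: filterS => n.
have rn := r0 n s s0; rewrite gtr0_norm// ltr_pdivlMr ?mulr_gt0// => h.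
rewrite ler_pdivlMr ?mulr_gt0//; have := ler_norm A; nra.
Qed.

Lemma measurable_sqnorm {disp} {T : measurableType disp} (G : T -> 'rV[R]_d) :
  (forall i, measurable_fun setT (fun x => G x ord0 i)) ->
  measurable_fun setT (fun x => sqnorm (G x)).
Proof.
by move=> mG; apply: measurable_sum => i; exact: measurable_funX.
Qed.

Lemma measurable_dens {disp} {T : measurableType disp} r a (V S : T -> R)
    (G : T -> 'rV[R]_d) : (forall s, 0 <= s -> 0 < r s) ->
  continuous (fun s : R => r (Num.max s 0)) ->
  measurable_fun setT V -> measurable_fun setT S ->
  (forall i, measurable_fun setT (fun x => G x ord0 i)) ->
  measurable_fun setT (fun x => dens r a (V x) (S x) (G x)).
Proof.
move=> r0 rc mV mS mG; have mN := measurable_sqnorm mG; rewrite /dens.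
apply: measurable_funD; last exact: measurable_funM.
apply: measurable_funD; last by apply: measurable_funM => //; exact: measurable_funX.
apply: measurable_funD; last first.
  by apply: measurable_funM => //; exact: measurableT_comp (measurable_potential_reg a) mS.
have -> : (fun x => kinetic r (S x) (G x)) = (fun x => if 0 <= S x
    then sqnorm (G x) * (8 * r (Num.max (S x) 0))^-1 else 0).
  by apply/funext => x; rewrite /kinetic; case: ifP => // S0; rewrite max_l.
apply: measurable_fun_ifT => //; first exact: measurable_fun_ler.
apply: measurable_funM => //.
apply: (measurableT_comp (f := fun s : R => (8 * r (Num.max s 0))^-1)) => //.
apply: continuous_measurable_fun => s; apply: cvgV.
  by rewrite mulf_neq0// gt_eqF// r0// le_max lexx orbT.
by apply: cvgM; [exact: cvg_cst|exact: rc].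
Qed.

Lemma measurable_dens0 {disp} {T : measurableType disp} (V S : T -> R)
    (G : T -> 'rV[R]_d) :
  measurable_fun setT V -> measurable_fun setT S ->
  (forall i, measurable_fun setT (fun x => G x ord0 i)) ->
  measurable_fun setT (fun x => dens0 (V x) (S x) (G x)).
Proof.
move=> mV mS mG; have mN := measurable_sqnorm mG; rewrite /dens0.
apply: emeasurable_funD; last first.
  apply/measurable_EFinP; apply: measurable_funD; last exact: measurable_funM.
  by apply: measurable_funD; apply: measurable_funM => //; exact: measurable_funX.
have -> : (fun x => kinetic0 (S x) (G x)) = (fun x => if 0 < S x
    then (sqnorm (G x) * (8 * S x) `^ (-1))%:E
    else if G x == 0 then 0%E else +oo%E).
  apply/funext => x; rewrite /kinetic0; case: ifP => // S0.
  by rewrite powR_inv1// mulr_ge0// ltW.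
apply: measurable_fun_ifT; first exact: measurable_fun_ltr.
  apply/measurable_EFinP; apply: measurable_funM => //.
  by apply: (measurableT_comp (measurable_powR _)); exact: measurable_funM.
apply: measurable_fun_ifT => //.
by under eq_fun do rewrite -sqnorm_eq0; exact: measurable_fun_eqr.
Qed.

End density.

(** * Lower semicontinuity *)

Section midpoints.
Context {disp : measure_display} {T : measurableType disp} {R : realType}.
Variable mu : {measure set T -> \bar R}.
Implicit Types f g h : T -> R.

Definition mid f g : T -> R := fun x => (f x + g x) / 2.

Lemma midE f g : mid f g = (fun x => 2^-1 * (f x + g x)).
Proof. by apply/funext => x; rewrite /mid mulrC. Qed.

Lemma mid_sqi f g : sqi mu f -> sqi mu g -> sqi mu (mid f g).
Proof. by move=> sf sg; rewrite midE; exact/sqiZ/sqiD. Qed.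

Lemma ip_midl f g h : sqi mu f -> sqi mu g -> sqi mu h ->
  ip mu (mid f g) h = (ip mu f h + ip mu g h) / 2.
Proof.
move=> sf sg sh; rewrite midE (ipZl _ (sqiD sf sg) sh) (ipDl sf sg sh).
exact: mulrC.
Qed.

Lemma ip_mid f g : sqi mu f -> sqi mu g ->
  ip mu (mid f g) (mid f g) = (ip mu f f + 2 * ip mu f g + ip mu g g) / 4.
Proof.
move=> sf sg; have sm := mid_sqi sf sg.
rewrite (ip_midl sf sg sm) !(ipC mu _ (mid f g)) (ip_midl sf sg sf) (ip_midl sf sg sg) (ipC mu g f).
by field.
Qed.

Lemma sqdist_parallelogram f g : sqi mu f -> sqi mu g ->
  sqdist mu f g = 2 * ip mu f f + 2 * ip mu g g - 4 * ip mu (mid f g) (mid f g).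
Proof. by move=> sf sg; rewrite ip_mid// /sqdist (ip_sqrB sf sg); field. Qed.

Lemma sqdist_mid f g h (e : R) : sqi mu f -> sqi mu g -> sqi mu h ->
  sqdist mu f h <= e -> sqdist mu g h <= e -> sqdist mu (mid f g) h <= e.
Proof.
move=> sf sg sh fe ge; rewrite /sqdist.
have -> : (fun x => mid f g x - h x) = mid (fun x => f x - h x) (fun x => g x - h x).
  by apply/funext => x; rewrite /mid; field.
have := ip_ge0 mu (fun x => (f x - h x) - (g x - h x)).
rewrite (ip_mid (sqiB sf sh) (sqiB sg sh)) (ip_sqrB (sqiB sf sh) (sqiB sg sh)).
rewrite -/(sqdist mu f h) -/(sqdist mu g h); lra.
Qed.

End midpoints.

Section lower_semicontinuity.
Context {R : realType} (d : nat) (L : R).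
Hypothesis L_gt0 : 0 < L.
Local Notation mu := (box_measure d L).
Variables (V : 'rV[R]_d -> R) (beta delta : R) (r : R -> R -> R).
Hypotheses (V_cont : continuous V) (V_ge0 : forall x, 0 <= V x).
Hypotheses (beta_ge0 : 0 <= beta) (delta_gt0 : 0 < delta).
Hypothesis r_adm : admissible_denominators r.
Implicit Types (u f : 'rV[R]_d -> R) (g : 'I_d -> 'rV[R]_d -> R).

Let mu_fin := box_measure_lty (ltW L_gt0) d.
Let mV := continuous_measurable_rV V_cont.

(** [a] regularizes the denominator and [b] the potential, independently. A free vector field [g]
    replaces the gradient, so midpoints can be formed without uniqueness of weak derivatives. *)
Definition dens_int (a b : R) u g : \bar R :=
  (\int[mu]_x (dens beta delta (r a) b (V x) (u x) (\row_i g i x))%:E)%E.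

Definition wpart i u f : Prop := forall phi, smooth phi -> box_periodic L phi ->
  ip mu u ('D_(basis_vec i) phi) = - ip mu f phi.

Definition grad_norm g : R := \sum_i ip mu (g i) (g i).

Lemma measurable_dens_row a b u g : 0 < a -> sqi mu u -> (forall i, sqi mu (g i)) ->
  measurable_fun setT (fun x => (dens beta delta (r a) b (V x) (u x) (\row_i g i x))%:E).
Proof.
move=> a0 [mu_ _] sg; apply/measurable_EFinP; apply: measurable_dens => //.
- by move=> s; exact: denom_gt0.
- exact: denom_continuous.
- by move=> i; under eq_fun do rewrite mxE; exact: (sg i).1.
Qed.

Lemma grad_norm_le_dens_int a b u g t : 0 < a -> 0 < b -> sqi mu u ->
  (forall i, sqi mu (g i)) -> (dens_int a b u g <= t%:E)%E ->
  delta / 2 * grad_norm g <= t.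
Proof.
move=> a0 b0 su sg; rewrite -lee_fin; apply: le_trans.
have -> : (delta / 2 * grad_norm g)%:E =
    (\int[mu]_x (delta / 2 * sqnorm (\row_i g i x))%:E)%E.
  under eq_integral do rewrite EFinM.
  have mS : measurable_fun setT (fun x => sqnorm (\row_i g i x)).
    by apply: measurable_sqnorm => i; under eq_fun do rewrite mxE; exact: (sg i).1.
  rewrite ge0_integralZl_EFin//; last 3 first.
  - by move=> x _; rewrite lee_fin sqnorm_ge0.
  - exact/measurable_EFinP.
  - by rewrite divr_ge0// ltW.
  rewrite EFinM; congr (_ * _)%E; rewrite /grad_norm -sumEFin.
  under eq_bigr do rewrite (ip_sqE (sg _)).
  rewrite -ge0_integral_sum//; last 2 first.
  - by move=> i; apply/measurable_EFinP/measurable_funX; exact: (sg i).1.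
  - by move=> i x _; rewrite lee_fin sqr_ge0.
  apply: eq_integral => x _; rewrite sumEFin; congr EFin.
  by apply: eq_bigr => i _; rewrite mxE.
apply: ge0_le_integral => //.
- by move=> x _; rewrite lee_fin mulr_ge0 ?sqnorm_ge0// divr_ge0// ltW.
- apply/measurable_EFinP; apply: measurable_funM => //.
  by apply: measurable_sqnorm => i; under eq_fun do rewrite mxE; exact: (sg i).1.
- exact: measurable_dens_row.
- move=> x _; rewrite lee_fin; apply: dens_ge_grad => // s; exact: denom_gt0.
Qed.

Lemma dens_int_mono a b a' b' u g : 0 < a -> a <= a' -> 0 < b -> b <= b' ->
  sqi mu u -> (forall i, sqi mu (g i)) -> {ae mu, forall x, 0 <= u x} ->
  (dens_int a' b' u g <= dens_int a b u g)%E.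
Proof.
move=> a0 aa b0 bb su sg u0.
have [a'0 b'0] := (lt_le_trans a0 aa, lt_le_trans b0 bb).
apply: ae_ge0_le_integral => //.
- by move=> x _; rewrite lee_fin dens_ge0// => s; exact: denom_gt0.
- exact: measurable_dens_row.
- by move=> x _; rewrite lee_fin dens_ge0// => s; exact: denom_gt0.
- exact: measurable_dens_row.
- apply: filterS u0 => x ux _; rewrite lee_fin; apply: dens_mono => //.
    by move=> s; exact: denom_gt0.
  exact: denom_mono.
Qed.

Lemma dens_int_mid a b u v g h t : 0 < a -> 0 < b -> sqi mu u -> sqi mu v ->
  (forall i, sqi mu (g i)) -> (forall i, sqi mu (h i)) ->
  {ae mu, forall x, 0 <= u x} -> {ae mu, forall x, 0 <= v x} ->
  (dens_int a b u g <= t%:E)%E -> (dens_int a b v h <= t%:E)%E ->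
  (dens_int a b (mid u v) (fun i => mid (g i) (h i)) <= t%:E)%E.
Proof.
move=> a0 b0 su sv sg sh u0 v0 ut vt.
have r0 s : 0 <= s -> 0 < r a s by exact: denom_gt0.
have D0 w k x : (0 <= (dens beta delta (r a) b (V x) (w x) (\row_i k i x))%:E)%E.
  by rewrite lee_fin dens_ge0.
have mD w k := @measurable_dens_row a b w k a0.
apply: (@le_trans _ _ (\int[mu]_x ((2^-1)%:E *
    ((dens beta delta (r a) b (V x) (u x) (\row_i g i x))%:E +
     (dens beta delta (r a) b (V x) (v x) (\row_i h i x))%:E)))%E).
  apply: ae_ge0_le_integral => //.
  - by move=> x _; rewrite lee_fin dens_ge0.
  - apply: (mD (mid u v) (fun i => mid (g i) (h i))) => [|i]; exact: mid_sqi.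
  - by move=> x _; rewrite mule_ge0 ?adde_ge0// lee_fin.
  - by apply: emeasurable_funM => //; apply: emeasurable_funD; exact: mD.
  - apply: filterS2 u0 v0 => x ux vx _; rewrite -EFinD -EFinM lee_fin mulrC.
    have -> : \row_i mid (g i) (h i) x = 2^-1 *: (\row_i g i x + \row_i h i x).
      by apply/rowP => i; rewrite !mxE /mid mulrC.
    by apply: dens_midpoint => //; exact: denom_midpoint.
rewrite ge0_integralZl_EFin//; last 2 first.
- by move=> x _; rewrite adde_ge0.
- by apply: emeasurable_funD; exact: mD.
rewrite ge0_integralD//; [|exact: mD|exact: mD].
rewrite -/(dens_int a b u g) -/(dens_int a b v h).
apply: (@le_trans _ _ ((2^-1)%:E * (t%:E + t%:E))%E).
  by apply: lee_wpmul2l; rewrite ?lee_fin// leeD.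
by rewrite -EFinD -EFinM lee_fin; lra.
Qed.

End lower_semicontinuity.

(** * Competitors with almost minimal gradient *)

Section minimizing_sequence.
Context {R : realType} (d : nat) (L : R).
Hypothesis L_gt0 : 0 < L.
Local Notation mu := (box_measure d L).
Variables (V : 'rV[R]_d -> R) (beta delta : R) (r : R -> R -> R).
Hypotheses (V_cont : continuous V) (V_ge0 : forall x, 0 <= V x).
Hypotheses (beta_ge0 : 0 <= beta) (delta_gt0 : 0 < delta).
Hypothesis r_adm : admissible_denominators r.
Variables (rho : 'rV[R]_d -> R) (t : R).
Hypothesis rho_sqi : sqi mu rho.
Implicit Types (u f : 'rV[R]_d -> R) (g : 'I_d -> 'rV[R]_d -> R).

Let mu_fin := box_measure_lty (ltW L_gt0) d.
Local Notation D n := (dens_int L V beta delta r (harmonic n) (harmonic n)).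

Let tau_gt0 n : 0 < (harmonic n : R).
Proof. by rewrite /harmonic/= invr_gt0. Qed.

Let half_exp (n : nat) : 0 < (2^-1 ^+ n : R).
Proof. by rewrite exprn_gt0. Qed.

Let half_exp_le m n : (m <= n)%N -> (2^-1 ^+ n : R) <= 2^-1 ^+ m.
Proof. by move=> mn; rewrite ler_wiXn2l//; lra. Qed.

(* The regularization parameters eps and sigma of stage [m] are both 1/(m+1); the
   competitors of stage [m] decrease with [m] and are stable under midpoints. *)
Definition competitor m u g : Prop :=
  [/\ sqi mu u /\ (forall i, sqi mu (g i)), forall i, wpart L i u (g i),
   {ae mu, forall x, 0 <= u x} /\ ip mu u (fun=> 1) = 1,
   sqdist mu u rho <= 2^-1 ^+ m & (D m u g <= t%:E)%E].

Lemma competitor_mono m n u g : (m <= n)%N -> competitor n u g -> competitor m u g.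
Proof.
move=> mn [[su sg] wu [u0 u1] ur uD]; split=> //.
  exact: le_trans ur (half_exp_le mn).
have tmn : (harmonic n : R) <= harmonic m.
  by rewrite /harmonic/= lef_pV2 ?posrE// ler_nat ltnS.
by apply: le_trans uD; apply: dens_int_mono.
Qed.

Lemma competitor_mid m u v g h : competitor m u g -> competitor m v h ->
  competitor m (mid u v) (fun i => mid (g i) (h i)).
Proof.
move=> [[su sg] wu [u0 u1] ur uD] [[sv sh] wv [v0 v1] vr vD].
have s1 : sqi mu (fun=> 1) by exact: sqi_cst.
split.
- by split=> [|i]; exact: mid_sqi.
- move=> i phi sphi pphi.
  have sp := smooth_sqi L_gt0 [::] sphi; have sD := smooth_sqi L_gt0 [:: i] sphi.
  rewrite (ip_midl su sv sD) (ip_midl (sg i) (sh i) sp) wu// wv//; lra.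
- split; last by rewrite ip_midl// u1 v1; lra.
  by apply: filterS2 u0 v0 => x ux vx; rewrite /mid divr_ge0// addr_ge0.
- exact: sqdist_mid.
- by apply: dens_int_mid.
Qed.

(** In [energy_liminf] the competitors are late terms of the given sequence. *)
Hypothesis competitor_ex : forall m, exists u g, competitor m u g.

Let norms m : set R := [set y | exists u g, competitor m u g /\ y = grad_norm L g].

Let norms_lb m : lbound (norms m) 0.
Proof. by move=> y [u [g [_ ->]]]; apply: sumr_ge0 => i _; exact: ip_ge0. Qed.

Let norms_has_inf m : has_inf (norms m).
Proof.
split; last by exists 0; exact: norms_lb.
by have [u [g ug]] := competitor_ex m; exists (grad_norm L g), u, g.
Qed.

Let a m : R := inf (norms m).

Let a_le m u g : competitor m u g -> a m <= grad_norm L g.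
Proof.
move=> ug; apply: ge_inf; first by exists 0; exact: norms_lb.
by exists u, g.
Qed.

Let a_mono m n : (m <= n)%N -> a m <= a n.
Proof.
move=> mn; apply: lb_le_inf; first by have [] := norms_has_inf n.
by move=> y [u [g [ug ->]]]; apply: a_le; exact: competitor_mono ug.
Qed.

Let a_ub m : a m <= t / (delta / 2).
Proof.
have [u [g ug]] := competitor_ex m; apply: le_trans (a_le ug) _.
have [[su sg] _ _ _ uD] := ug.
rewrite ler_pdivlMr ?divr_gt0// mulrC.
exact: (grad_norm_le_dens_int V_cont V_ge0 beta_ge0 delta_gt0 r_adm (tau_gt0 m) (tau_gt0 m) su sg uD).
Qed.

(* The infimum of the squared gradient norm over the competitors of stage [m] is
   nondecreasing in [m] and bounded; for almost minimal competitors the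
   parallelogram identity makes the gradients Cauchy. *)
Lemma minimizing_sequence : exists (u : nat -> 'rV[R]_d -> R)
    (g : nat -> 'I_d -> 'rV[R]_d -> R),
  (forall n, competitor n (u n) (g n)) /\
  (forall i m n, (m <= n)%N -> sqdist mu (g n i) (g m i) <= 8 * 2^-1 ^+ m).
Proof.
have hs : has_sup (range a).
  split; first by exists (a 0%N), 0%N.
  by exists (t / (delta / 2)) => _ [m _ <-]; exact: a_ub.
pose A := sup (range a).
have aA m : a m <= A by apply: ub_le_sup; [have [] := hs|exists m].
have /choice[N NP] n : exists N, A - 2^-1 ^+ n < a N.
  by have [_ [N _ <-] AN] := sup_adherent (half_exp n) hs; exists N.
pose p n := (n + \sum_(i < n.+1) N i)%N.
have np n : (n <= p n)%N by rewrite leq_addr.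
have Np n : (N n <= p n)%N by rewrite /p big_ord_recr/= addnA leq_addl.
have p_mono m n : (m <= n)%N -> (p m <= p n)%N.
  move=> mn; rewrite leq_add// -(big_mkord xpredT N) -(big_mkord xpredT N).
  by rewrite [leqRHS](@big_cat_nat _ _ _ m.+1)//= leq_addr.
have /choice[ug ugP] n : exists ug : ('rV[R]_d -> R) * ('I_d -> 'rV[R]_d -> R),
    competitor (p n) ug.1 ug.2 /\ grad_norm L ug.2 < A + 2^-1 ^+ n.
  have [_ [u [g [ug ->]]] gA] := inf_adherent (half_exp n) (norms_has_inf (p n)).
  exists (u, g); split=> //; apply: lt_le_trans gA _.
  by rewrite lerD2r aA.
exists (fun n => (ug n).1), (fun n => (ug n).2); split=> [n|i m n mn].
  exact: competitor_mono (np n) (ugP n).1.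
have [cm gm] := ugP m; have [cn gn] := ugP n.
have cn' := competitor_mono (p_mono _ _ mn) cn.
have [[_ sgm] _ _ _ _] := cm; have [[_ sgn] _ _ _ _] := cn.
(* Both squared norms are below A + 2^-m and that of the midpoint is above A - 2^-m, so the
   parallelogram identity leaves at most (2 + 2 + 4) 2^-m. *)
have := a_le (competitor_mid cn' cm); have := NP m; have := a_mono (Np m).
have := half_exp_le mn.
have total : \sum_j sqdist mu ((ug n).2 j) ((ug m).2 j) =
    2 * grad_norm L (ug n).2 + 2 * grad_norm L (ug m).2 -
    4 * grad_norm L (fun j => mid ((ug n).2 j) ((ug m).2 j)).
  rewrite /grad_norm !mulr_sumr -big_split -sumrB; apply: eq_bigr => j _ /=.
  by rewrite sqdist_parallelogram.
have : sqdist mu ((ug n).2 i) ((ug m).2 i) <=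
    \sum_j sqdist mu ((ug n).2 j) ((ug m).2 j).
  rewrite (bigD1 i)//= lerDl; apply: sumr_ge0 => j _; exact: sqdist_ge0.
rewrite total; lra.
Qed.

(** Strong convergence carries the weak derivatives and the mass to the limit. Every later
    competitor is also one of stage [m], so Fatou's lemma applies at each fixed [m]. *)
Lemma limit_gradient : exists G : 'I_d -> 'rV[R]_d -> R,
  [/\ forall i, sqi mu (G i), forall i, wpart L i rho (G i),
   {ae mu, forall x, 0 <= rho x}, ip mu rho (fun=> 1) = 1 &
   forall m, (D m rho G <= t%:E)%E].
Proof.
have [u [g [ugP gC]]] := minimizing_sequence.
have su n : sqi mu (u n) by have [[]] := ugP n.
have sg n i : sqi mu (g n i) by have [[_ /(_ i)]] := ugP n.
have half0 : (2^-1 ^+ n : R) @[n --> \oo] --> 0.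
  by apply: cvg_expr; rewrite ger0_norm//; lra.
have ur : sqdist mu (u n) rho @[n --> \oo] --> 0.
  apply: (@squeeze_cvgr _ _ _ _ (fun=> 0) (fun n => 2^-1 ^+ n)) => //; last exact: cvg_cst.
  by apply: nearW => n; rewrite sqdist_ge0/=; have [] := ugP n.
have /choice[G GP] i : exists G, sqi mu G /\ sqdist mu (g n i) G @[n --> \oo] --> 0.
  have [|G sG gG] := @sqi_complete _ _ _ _ (fun n => g n i) mu_fin (sg ^~ i).
    move=> e e0; have e8 : 0 < e / 8 by rewrite divr_gt0.
    have [N _ NP] := (cvgr0Pnorm_le _).1 half0 _ e8.
    have N8 : 8 * 2^-1 ^+ N <= e.
      by have := NP N (leqnn N); rewrite /= ger0_norm ?(ltW (half_exp _))//; lra.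
    exists N => m n Nm Nn; rewrite -/(sqdist mu _ _); have [mn|/ltnW nm] := leqP m n.
      rewrite sqdistC; apply: le_trans (gC i _ _ mn) _; apply: le_trans N8.
      by rewrite ler_pM2l// half_exp_le.
    apply: le_trans (gC i _ _ nm) _; apply: le_trans N8.
    by rewrite ler_pM2l// half_exp_le.
  by exists G; split=> //; apply/sqdist_cvg0P.
have sG i := (GP i).1; have gG i := (GP i).2.
(* One choice of indices fast enough for almost everywhere convergence of the densities and of all
   gradient components at once. *)
have [q qP] : exists q : nat -> nat, forall n, [/\ (n <= q n)%N,
    sqdist mu (u (q n)) rho <= 2^-1 ^+ n &
    forall i, sqdist mu (g (q n) i) (G i) <= 2^-1 ^+ n].
  suff /choice[q qP] : forall n, exists q, [/\ (n <= q)%N,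
    sqdist mu (u q) rho <= 2^-1 ^+ n &
    forall i, sqdist mu (g q i) (G i) <= 2^-1 ^+ n] by exists q.
  move=> n.
  have ev1 : \forall k \near \oo, `|sqdist mu (u k) rho| <= 2^-1 ^+ n.
    by move/cvgr0Pnorm_le : ur => /(_ _ (half_exp n)).
  have ev2 : \forall k \near \oo, forall i, `|sqdist mu (g k i) (G i)| <= 2^-1 ^+ n.
    by apply: filter_forall => i; have /cvgr0Pnorm_le/(_ _ (half_exp n)) := gG i.
  have ev3 : \forall k \near \oo, (n <= k)%N by exact: nbhs_infty_ge.
  have [k [[k1 k2] k3]] := filter_ex (filterI (filterI ev1 ev2) ev3).
  exists k; split=> //; first by apply: le_trans k1; exact: ler_norm.
  by move=> i; apply: le_trans (k2 i); exact: ler_norm.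
have aeu : {ae mu, forall x, u (q n) x @[n --> \oo] --> rho x}.
  have := @ae_cvg_sqi0 _ _ _ mu (fun n x => u (q n) x - rho x).
  move=> /(_ (fun n => sqiB (su _) rho_sqi))/(_ _)/wrap[|].
    by move=> n; have [_ + _] := qP n.
  by apply: filterS => x /cvg_sub0; apply; exact: cvg_cst.
have aeg : {ae mu, forall x i, g (q n) i x @[n --> \oo] --> G i x}.
  apply: filter_forall => i.
  have := @ae_cvg_sqi0 _ _ _ mu (fun n x => g (q n) i x - G i x).
  move=> /(_ (fun n => sqiB (sg _ _) (sG i)))/(_ _)/wrap[|].
    by move=> n; have [_ _ h] := qP n; exact: h.
  by apply: filterS => x /cvg_sub0; apply; exact: cvg_cst.
have aeu0 : {ae mu, forall x n, 0 <= u (q n) x}.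
  by apply/ae_foralln => n; have [_ _ []] := ugP (q n).
have rho0 : {ae mu, forall x, 0 <= rho x}.
  apply: filterS2 aeu aeu0 => x ux u0.
  rewrite -(cvg_lim _ ux)//; apply: limr_ge; first by apply/cvg_ex; exists (rho x).
  exact: nearW.
exists G; split=> //.
- move=> i phi sphi pphi.
  have sp := smooth_sqi L_gt0 [::] sphi; have sD := smooth_sqi L_gt0 [:: i] sphi.
  have c1 := cvg_ip su rho_sqi sD ur.
  have c2 := cvg_ip (sg ^~ i) (sG i) sp (gG i).
  apply: (cvg_unique _ c1) => //=.
  rewrite (_ : (fun n => _) = (fun n => - ip mu (g n i) phi)); first exact: cvgN.
  by apply/funext => n; have [_ /(_ i) w _ _ _] := ugP n; exact: w.
- have c1 := cvg_ip su rho_sqi (sqi_cst mu_fin 1) ur.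
  apply: (cvg_unique _ c1) => //=.
  rewrite (_ : (fun n => _) = (fun=> 1)); first exact: cvg_cst.
  by apply/funext => n; have [_ _ []] := ugP n.
- move=> m.
  apply: (@fatou_le _ _ _ mu (fun n x => (dens beta delta (r (harmonic m)) (harmonic m)
    (V x) (u (q n) x) (\row_i g (q n) i x))%:E) _ _ m).
  + by move=> n; apply: (measurable_dens_row (L := L)).
  + by apply: (measurable_dens_row (L := L)).
  + by move=> n x; rewrite lee_fin dens_ge0// => s; exact: denom_gt0.
  + by move=> x; rewrite lee_fin dens_ge0// => s; exact: denom_gt0.
  + have ae0 : {ae mu, forall x, (forall n, 0 <= u (q n) x) /\ 0 <= rho x}.
      by apply: filterS2 aeu0 rho0 => x.
    apply: filterS3 aeu aeg ae0 => x ux gx [u0 r0].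
    apply: cvg_EFin; first exact: nearW.
    apply: (@dens_cvg R d beta delta (r (harmonic m)) (harmonic m) (V x)
      (fun n => u (q n) x) (fun n => \row_i g (q n) i x)) => //.
    * by move=> s; exact: denom_gt0.
    * exact: denom_continuous.
    * by move=> i; under eq_fun do rewrite mxE; rewrite mxE; exact: gx.
  + move=> n mn; have [nq _ _] := qP n.
    by have [] := competitor_mono (leq_trans mn nq) (ugP (q n)).
Qed.

Lemma limit_energy0 : exists G : 'I_d -> 'rV[R]_d -> R,
  [/\ forall i, sqi mu (G i), forall i, wpart L i rho (G i),
   {ae mu, forall x, 0 <= rho x}, ip mu rho (fun=> 1) = 1 &
   (\int[mu]_x dens0 beta delta (V x) (rho x) (\row_i G i x) <= t%:E)%E].
Proof.
have [G [sG wG rho0 rho1 DG]] := limit_gradient; exists G; split=> //.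
have [mrho _] := rho_sqi.
have mrp : measurable_fun setT (fun x => Num.max (rho x) 0) by exact: measurable_maxr.
have mG i : measurable_fun setT (fun x => (\row_i G i x : 'rV[R]_d) ord0 i).
  by under eq_fun do rewrite mxE; exact: (sG i).1.
have mV := continuous_measurable_rV V_cont.
(* [dens0] can be negative where rho < 0, and [fatou_le] asks for nonnegativity everywhere;
   truncation changes only a null set. *)
rewrite (@ae_eq_integral _ _ _ mu setT
  (fun x => dens0 beta delta (V x) (Num.max (rho x) 0) (\row_i G i x)))//; last 3 first.
- exact: measurable_dens0.
- exact: measurable_dens0.
- by apply: filterS rho0 => x rx _; rewrite max_l.
apply: (@fatou_le _ _ _ mu (fun n x => (dens beta delta (r (harmonic n)) (harmonic n)
    (V x) (rho x) (\row_i G i x))%:E) _ _ 0%N).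
- by move=> n; apply: (measurable_dens_row (L := L)).
- exact: measurable_dens0.
- by move=> n x; rewrite lee_fin dens_ge0// => s; exact: denom_gt0.
- by move=> x; rewrite dens0_ge0// le_max lexx orbT.
- apply: filterS rho0 => x rx; rewrite max_l//; apply: dens_cvg_dens0 => //.
  + by move=> n s; exact: denom_gt0.
  + exact: denom_cvg_seq.
  + exact: cvg_harmonic.
- by move=> n _; exact: DG.
Qed.

End minimizing_sequence.

(** * Gamma-convergence and equicoercivity *)

Section energies.
Context {R : realType} (d : nat) (L : R).
Hypothesis L_gt0 : 0 < L.
Local Notation mu := (box_measure d L).
Variables (V : 'rV[R]_d -> R) (beta delta : R) (r : R -> R -> R) (sigma : R -> R).
Hypotheses (V_cont : continuous V) (V_ge0 : forall x, 0 <= V x).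
Hypotheses (beta_ge0 : 0 <= beta) (delta_gt0 : 0 < delta).
Hypothesis r_adm : admissible_denominators r.
Hypothesis sigma_gt0 : forall eps, 0 < eps -> 0 < sigma eps.
Hypothesis sigma_cvg : sigma eps @[eps --> 0^'+] --> 0.

Let mu_fin := box_measure_lty (ltW L_gt0) d.
Local Notation E eps := (energy L V beta delta (r eps) (sigma eps)).
Local Notation E0 := (energy0 L V beta delta).
Local Notation wgrad rho := (fun i => weak_partial i rho : 'rV[R]_d -> R).

Lemma energyE eps (rho : L2box d L) : admissible rho ->
  E eps rho = dens_int L V beta delta r eps (sigma eps) rho (wgrad rho).
Proof. by move=> adm; rewrite /energy; case: asboolP. Qed.

Lemma energy_ge0 eps (rho : L2box d L) : 0 < eps -> (0 <= E eps rho)%E.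
Proof.
move=> eps0; have [adm|nadm] := pselect (admissible rho); last first.
  by rewrite /energy; case: asboolP.
rewrite energyE//; apply: integral_ge0 => x _; rewrite lee_fin dens_ge0//.
  by move=> s; exact: denom_gt0.
exact: sigma_gt0.
Qed.

Lemma energy_lty_admissible eps (rho : L2box d L) : (E eps rho < +oo)%E -> admissible rho.
Proof. by rewrite /energy; case: asboolP. Qed.

Lemma mass_ip (rho : L2box d L) :
  (\int[mu]_x (rho x)%:E = 1)%E <-> ip mu rho (fun=> 1) = 1.
Proof.
have E1 : (\int[mu]_x (rho x)%:E = (ip mu rho (fun=> 1))%:E)%E.
  rewrite /ip /Rintegral fineK.
    by apply: eq_integral => x _; rewrite mulr1.
  apply: integrable_fin_num => //.
  exact: sqi_mulr_integrable (L2_sqi rho) (sqi_cst mu_fin 1).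
by rewrite E1; split=> [[]|->].
Qed.

Lemma energy0E (rho : L2box d L) (G : 'I_d -> 'rV[R]_d -> R) : admissible rho ->
  (forall i, sqi mu (G i)) -> (forall i, {ae mu, forall x, weak_partial i rho x = G i x}) ->
  E0 rho = (\int[mu]_x dens0 beta delta (V x) (Num.max (rho x) 0%R) (\row_i G i x))%E.
Proof.
move=> adm sG wG; rewrite /energy0; case: asboolP => // _.
have [_ rho0 _] := adm; have mV := continuous_measurable_rV V_cont.
have mrho := measurable_L2 rho.
apply: (@ae_eq_integral _ _ _ mu setT) => //.
- by apply: measurable_dens0 => // i; under eq_fun do rewrite mxE; exact: measurable_L2.
- apply: measurable_dens0 => //; first exact: measurable_maxr.
  by move=> i; under eq_fun do rewrite mxE; exact: (sG i).1.
- have wG' : {ae mu, forall x i, weak_partial i rho x = G i x} by exact: filter_forall.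
  apply: filterS2 rho0 wG' => x rx gx _; rewrite max_l// /dens0.
  have -> // : weak_grad rho x = \row_i G i x.
  by apply/rowP => i; rewrite !mxE gx.
Qed.

Lemma energy_le_energy0 eps (rho : L2box d L) : 0 < eps -> (E eps rho <= E0 rho)%E.
Proof.
move=> eps0; have [adm|nadm] := pselect (admissible rho); last first.
  by rewrite [E0 rho]/energy0; case: asboolP => // _; rewrite leey.
have sw i : sqi mu (weak_partial i rho) := L2_sqi _.
have [_ rho0 _] := adm; have mV := continuous_measurable_rV V_cont.
rewrite energyE// (energy0E adm sw) => [|i]; last exact: nearW.
apply: ae_ge0_le_integral => //.
- move=> x _; rewrite lee_fin dens_ge0//; last exact: sigma_gt0.
  by move=> s; exact: denom_gt0.
- by apply: measurable_dens_row => //; exact: L2_sqi.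
- by move=> x _; rewrite dens0_ge0// le_max lexx orbT.
- apply: measurable_dens0 => //.
    by apply: measurable_maxr => //; exact: measurable_L2.
  by move=> i; under eq_fun do rewrite mxE; exact: measurable_L2.
- apply: filterS rho0 => x rx _; rewrite max_l//; apply: dens_le_dens0 => //.
  + by move=> s; exact: denom_gt0.
  + exact: denom_ge.
  + exact: sigma_gt0.
Qed.

Lemma energy_limsup (eps : R^nat) (rho : L2box d L) : (forall n, 0 < eps n) ->
  (limn_esup (fun n => E (eps n) rho) <= E0 rho)%E.
Proof.
move=> eps0; rewrite limn_esup_lim; apply: lime_le; first exact: is_cvg_esups.
apply: nearW => n; apply: ge_ereal_sup => _ [k _ <-].
exact: energy_le_energy0.
Qed.

(** The limit field is first turned into classes of [L2], which makes [rho] admissible; uniqueness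
    then identifies it with [weak_partial]. *)
Lemma energy0_le_limit (rho : L2box d L) (t : R) :
  (forall m, exists u g, competitor L V beta delta r rho t m u g) ->
  (E0 rho <= t%:E)%E.
Proof.
move=> cex.
have [G [sG wG rho0 rho1 Gt]] :=
  limit_energy0 L_gt0 V_cont V_ge0 beta_ge0 delta_gt0 r_adm (L2_sqi rho) cex.
have /choice[g gG] i := exists_L2 (sG i).
have wg i : is_weak_partial i rho (g i).
  apply/(is_weak_partialP L_gt0) => phi sphi pphi; rewrite wG//; congr (- _).
  have [mphi _] := smooth_sqi L_gt0 [::] sphi.
  apply/esym; apply: eq_ip_ae => //; [exact: measurable_L2|exact: (sG i).1].
have adm : admissible rho.
  by split=> //; [move=> i; exists (g i)|exact/mass_ip].
rewrite (energy0E adm sG); last first.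
  move=> i; have [H1 _ _] := adm.
  have := weak_partial_unique L_gt0 (weak_partialP i H1) (wg i).
  by apply: filterS2 (gG i) => x -> ->.
apply: le_trans Gt; rewrite le_eqVlt; apply/orP; left; apply/eqP.
have mV := continuous_measurable_rV V_cont; have mrho := measurable_L2 rho.
have mG i : measurable_fun setT (fun x => (\row_i G i x : 'rV[R]_d) ord0 i).
  by under eq_fun do rewrite mxE; exact: (sG i).1.
apply: (@ae_eq_integral _ _ _ mu setT) => //.
- by apply: measurable_dens0 => //; exact: measurable_maxr.
- exact: measurable_dens0.
- by apply: filterS rho0 => x rx _; rewrite max_l.
Qed.

Lemma energy_liminf (eps : R^nat) (rho : L2box d L) (u : nat -> L2box d L) :
  (forall n, 0 < eps n) -> eps n @[n --> \oo] --> 0 -> u n @[n --> \oo] --> rho ->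
  (E0 rho <= limn_einf (fun n => E (eps n) (u n)))%E.
Proof.
move=> eps0 epsc /L2_cvgP ur; set l := limn_einf _.
have l0 : (0 <= l)%E.
  rewrite /l limn_einf_lim; apply: lime_ge; first exact: is_cvg_einfs.
  by apply: nearW => n; apply: le_ereal_inf_tmp => _ [k _ <-]; exact: energy_ge0.
rewrite leNgt; apply/negP => lE.
(* A finite level strictly in between is needed: terms of energy below it are admissible, and they
   serve as competitors for the level [t]. *)
have [t lt tE] : exists2 t : R, (l < t%:E)%E & (t%:E < E0 rho)%E.
  move: l0 lE; case: l => [l||]; last 2 first.
  - by move=> _; rewrite ltNge leey.
  - by [].
  move=> _; case: (E0 rho) => [e||]; last by [].
  - rewrite lte_fin => le; exists ((l + e) / 2); rewrite lte_fin; lra.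
  - by move=> _; exists (l + 1); rewrite ?ltry// lte_fin ltrDl.
suff : (E0 rho <= t%:E)%E by rewrite leNgt tE.
apply: energy0_le_limit => m.
have h0 : 0 < (harmonic m : R) by rewrite /harmonic/= invr_gt0.
have b0 : 0 < (2^-1 ^+ m : R) by rewrite exprn_gt0.
have sc : sigma (eps n) @[n --> \oo] --> 0.
  by have /cvg_at_rightP := sigma_cvg; apply; split.
have ev1 : \forall n \near \oo, `|eps n| <= harmonic m.
  by move/cvgr0Pnorm_le : epsc => /(_ _ h0).
have ev2 : \forall n \near \oo, `|sigma (eps n)| <= harmonic m.
  by move/cvgr0Pnorm_le : sc => /(_ _ h0).
have ev3 : \forall n \near \oo, `|sqdist mu (u n) rho| <= 2^-1 ^+ m.
  by move/cvgr0Pnorm_le : ur => /(_ _ b0).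
have [N _ NP] : \forall n \near \oo, [/\ `|eps n| <= harmonic m,
    `|sigma (eps n)| <= harmonic m & `|sqdist mu (u n) rho| <= 2^-1 ^+ m].
  by apply: filterS3 ev1 ev2 ev3.
(* The infimum over k >= N is below [t]; one such k for each stage is enough, so no subsequence is
   extracted. *)
have [_ [k /= Nk <-] Et] : exists2 y, [set E (eps k) (u k) | k in [set k | (N <= k)%N]] y
    & (y < t%:E)%E.
  apply: ereal_inf_lt; apply: le_lt_trans lt.
  rewrite /l limn_einf_lim; have /cvg_lim -> // := @cvg_einfs_sup R (fun n => E (eps n) (u n)).
  by apply: ereal_sup_ubound; exists N.
have [] := NP k Nk.
rewrite (gtr0_norm (eps0 k)) (gtr0_norm (sigma_gt0 (eps0 k))) ger0_norm ?sqdist_ge0//.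
move=> ek sk rk.
have adm := energy_lty_admissible (lt_trans Et (ltry t)).
have [H1 u0 u1] := adm.
exists (u k), (wgrad (u k)); split=> //.
- by split=> [|i]; exact: L2_sqi.
- by move=> i; apply/(is_weak_partialP L_gt0); exact: weak_partialP.
- by split=> //; exact/mass_ip.
- apply: le_trans (ltW Et); rewrite energyE//.
  apply: dens_int_mono => //; [exact: sigma_gt0|exact: L2_sqi|].
  by move=> i; exact: L2_sqi.
Qed.

Lemma energy_Gamma_cvg : Gamma_cvg (fun eps : R => E eps) E0.
Proof.
move=> eps eps0 epsc rho; split=> [u ur|]; first exact: energy_liminf.
by exists (fun=> rho); split; [exact: cvg_cst|exact: energy_limsup].
Qed.

Lemma energy_equicoercive : equicoercive (fun eps : R => E eps).
Proof.
move=> t; pose C := (L / pi) ^+ 2 * (L *+ 2) ^+ d.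
(* The bound comes from delta/2 |grad rho|^2 <= t after integration and is uniform in eps. *)
exists (ellipsoid (mu := mu) (freq_fun (cas L)) (freq_weight d) (1 + C * (t / (delta / 2)))).
  exact: freq_ellipsoid_compact.
move=> eps eps0 rho /= Et.
have adm := energy_lty_admissible (le_lt_trans Et (ltry t)).
have [H1 rho0 rho1] := adm.
have C0 : 0 <= C by rewrite mulr_ge0 ?sqr_ge0// exprn_ge0// mulrn_wge0// ltW.
have gt : grad_norm L (wgrad rho) <= t / (delta / 2).
  rewrite ler_pdivlMr ?divr_gt0// mulrC.
  apply: (grad_norm_le_dens_int V_cont V_ge0 beta_ge0 delta_gt0 r_adm eps0
    (sigma_gt0 eps0) (L2_sqi rho)); first by move=> i; exact: L2_sqi.
  by rewrite -energyE.
have Wg i := weak_partialP i H1.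
move=> N; apply: le_trans (grad_ellipsoid L_gt0 Wg rho1 N) _.
by rewrite lerD2l ler_wpM2l.
Qed.

End energies.

Theorem theorem2p5 (R : realType) (d : nat) (L : R) (V : 'rV[R]_d -> R)
    (beta delta : R) (r : R -> R -> R) (sigma : R -> R)
    (d_gt0 : (0 < d)%N) (L_gt0 : 0 < L)
    (V_cont : continuous V) (V_per : box_periodic L V)
    (V_ge0 : forall x, 0 <= V x)
    (beta_ge0 : 0 <= beta) (delta_gt0 : 0 < delta)
    (r_adm : admissible_denominators r)
    (sigma_gt0 : forall eps, 0 < eps -> 0 < sigma eps)
    (sigma_cvg : sigma eps @[eps --> 0^'+] --> 0) :
  Gamma_cvg
    (fun eps : R => energy L V beta delta (r eps) (sigma eps))
    (energy0 L V beta delta) /\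
  equicoercive
    (fun eps : R => energy L V beta delta (r eps) (sigma eps)).
Proof. by split; [exact: energy_Gamma_cvg|exact: energy_equicoercive]. Qed.
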